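(* Let $r\ge 0$ be an integer and let $\Delta\subset\mathbb{R}^3$ be a closed tetrahedral vertex star with interior vertex $\gamma$ and $f_1^\circ$ interior edges. Put \[ D_\gamma:=\begin{cases} 2r & f_1^\circ=4,\\ \lfloor (5r+2)/3\rfloor & f_1^\circ=5,\\ \lfloor (3r+1)/2\rfloor & f_1^\circ\ge 6.\end{cases} \] If $d>D_\gamma$, then \[ \dim \mathcal{H}^r_d(\Delta)\ge \max\left\{\binom{d+2}{2},\ \mathrm{LB}_{cs}(\Delta,d,r)\right\} \] and \[ \dim \mathcal{S}^r_d(\Delta)\ge \binom{D_\gamma+3}{3}+\sum_{i=D_\gamma+1}^{d}\max\left\{\binom{i+2}{2},\ \mathrm{LB}_{cs}(\Delta,i,r)\right\}. \]
   Context: A tetrahedral vertex star is a pure $3$-dimensional simplicial complex $\Delta$ embedded in $\mathbb{R}^3$ (identified with its underlying space) all of whose tetrahedra share a common vertex $\gamma$ (placed at the origin), which is hereditary (whenever two tetrahedra meet in a vertex $v$, they are joined by a sequence of tetrahedra all containing $v$, consecutive ones sharing a triangle) and whose link (the simplices not containing $\gamma$) is simply connected. It is closed if $\gamma$ is an interior point of $\Delta$ (then $\gamma$ is the unique interior vertex). $\Delta^\circ_i$ denotes the set of interior $i$-faces and $f_i^\circ=|\Delta^\circ_i|$. $\mathcal{S}^r_d(\Delta)$ is the real vector space of $C^r$ functions on $\Delta$ whose restriction to each tetrahedron is a polynomial of total degree at most $d$ in $x,y,z$; $\mathcal{H}^r_d(\Delta)$ is the subspace of those whose restriction to each tetrahedron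 is a homogeneous polynomial of degree exactly $d$ (or zero). For an edge $\tau$, let $n_\tau$ be the number of $2$-faces of $\Delta$ containing $\tau$, $t_\tau=\min\{n_\tau,r+2\}$, $q_\tau=\lfloor t_\tau(r+1)/(t_\tau-1)\rfloor$, $a_\tau=t_\tau(r+1)-(t_\tau-1)q_\tau$, $b_\tau=t_\tau-1-a_\tau$. With the convention $\binom{a}{b}=0$ if $a<b$, \[ \mathrm{LB}_{cs}(\Delta,d,r):=2\binom{d+2}{2}+\Big(f_2^\circ-\sum_{\tau\in\Delta_1^\circ}t_\tau\Big)\binom{d+1-r}{2}+\sum_{\tau\in\Delta_1^\circ}\Big(a_\tau\binom{d+1-q_\tau}{2}+b_\tau\binom{d+2-q_\tau}{2}\Big). \] *)

(* Defs.v *)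
From HB Require Import structures.
From mathcomp Require Import all_boot all_order all_algebra.
(* The notations of mpoly clash with those of MathComp-Analysis, hence {mpoly R[n]}
   is written [mpoly n R], [msize p] is [mmeasure mdeg p], [p.@[v]] is [meval v p]
   and [p \is d.-homog] is [p \is ishomog1 d mdeg]. *)
From mathcomp Require Import -(notations) mpoly.
From mathcomp Require Import boolp classical_sets functions set_interval reals.
From mathcomp Require Import topology normedtype derive.

Set Implicit Arguments.
Unset Strict Implicit.
Unset Printing Implicit Defensive.

Import Order.TTheory GRing.Theory Num.Theory.
Import numFieldNormedType.Exports.

Local Open Scope classical_set_scope.
Local Open Scope ring_scope.

Section Topology.
Variables (R : realType) (T : topologicalType).
Implicit Types A : set T.

Definition path_in A (f : R -> T) : Prop :=
  {within `[0, 1], continuous f} /\ (forall t, t \in `[0, 1] -> A (f t)).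

Definition path_connected A : Prop :=
  forall x y, A x -> A y -> exists f, [/\ path_in A f, f 0 = x & f 1 = y].

(* [H (s, -)] is the loop at time [s]; the homotopy is relative to the base point. *)
Definition null_homotopic A (f : R -> T) : Prop :=
  exists H : R * R -> T,
    [/\ {within `[0, 1] `*` `[0, 1], continuous H},
        (forall s t, s \in `[0, 1] -> t \in `[0, 1] -> A (H (s, t))),
        (forall t, t \in `[0, 1] -> H (0, t) = f t),
        (forall t, t \in `[0, 1] -> H (1, t) = f 0)
      & (forall s, s \in `[0, 1] -> H (s, 0) = f 0 /\ H (s, 1) = f 0)].

Definition simply_connected A : Prop :=
  [/\ A !=set0, path_connected A
    & forall f, path_in A f -> f 0 = f 1 -> null_homotopic A f].

End Topology.

Section Smooth.
Variable R : realType.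
Implicit Types (U : set 'rV[R]_3) (f : 'rV[R]_3 -> R).

Fixpoint Cr_on (r : nat) U f : Prop :=
  (forall x, U x -> {for x, continuous f}) /\
  (if r is r'.+1 then
     forall i : 'I_3, (forall x, U x -> derivable f x (delta_mx 0 i)) /\
                      Cr_on r' U (fun x => 'D_(delta_mx 0 i) f x)
   else True).

(* A function on an arbitrary (here compact) set is C^r when it extends to a C^r
   function on an open neighbourhood of that set. *)
Definition Cr_function (r : nat) (A : set 'rV[R]_3) (F : A -> R) : Prop :=
  exists U g, [/\ open U, A `<=` U, Cr_on r U g & forall x : A, F x = g (val x)].

End Smooth.

(* [L] is a linear subspace, of dimension [n], of the space of functions [T -> R]:
   it is the bijective image of R^n under the map sending coordinates to the linear
   combinations of some family [b]. *)
Definition has_dim (R : realType) (T : Type) (L : set (T -> R)) (n : nat) : Prop :=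
  exists b : 'I_n -> T -> R,
    let comb := fun (c : 'rV[R]_n) (x : T) => \sum_i c 0 i * b i x in
    injective comb /\ range comb = L.

(* The vertices are labelled by [V]; [faces] lists the vertex sets of the nonempty
   simplices, and labels that occur in no face are irrelevant. *)
Record complex (R : realType) (V : finType) := Complex {
  pos : V -> 'rV[R]_3;
  faces : {set {set V}}
}.

Section Complex.
Variables (R : realType) (V : finType) (K : complex R V).
Implicit Types (s t : {set V}) (v g : V).

Definition simplex s : set 'rV[R]_3 :=
  [set x | exists c : V -> R,
     [/\ forall v, v \in s -> 0 <= c v, \sum_(v in s) c v = 1
       & x = \sum_(v in s) c v *: pos K v]].

Definition affinely_independent s : Prop :=
  forall c : V -> R, \sum_(v in s) c v = 0 -> \sum_(v in s) c v *: pos K v = 0 ->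
    forall v, v \in s -> c v = 0.

Definition simplicial_complex : Prop :=
  [/\ finset.set0 \notin faces K,
      (forall s t, s \in faces K -> t \subset s -> t != finset.set0 -> t \in faces K),
      (forall s, s \in faces K -> affinely_independent s)
    & (forall s t, s \in faces K -> t \in faces K ->
         simplex s `&` simplex t = simplex (s :&: t))].

Definition faces_dim (i : nat) : {set {set V}} :=
  [set s in faces K | #|s| == i.+1]%SET.

Definition tetrahedra : {set {set V}} := faces_dim 3.

Definition pure3 : Prop :=
  forall s, s \in faces K -> exists2 t, t \in tetrahedra & s \subset t.

Definition adjacent_at v : rel {set V} := fun s t =>
  [&& s \in tetrahedra, t \in tetrahedra, v \in s, v \in t & #|s :&: t| == 3%N].

Definition hereditary : Prop :=
  forall v s t, s \in tetrahedra -> t \in tetrahedra -> v \in s -> v \in t ->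
    connect (adjacent_at v) s t.

Definition realization : set 'rV[R]_3 :=
  [set x | exists2 s, s \in faces K & simplex s x].

Definition link_realization g : set 'rV[R]_3 :=
  [set x | exists2 s, (s \in faces K) && (g \notin s) & simplex s x].

Definition vertex_star g : Prop :=
  [/\ simplicial_complex /\ pure3, (forall s, s \in tetrahedra -> g \in s),
      pos K g = 0, hereditary & simply_connected R (link_realization g)].

Definition closed_vertex_star g : Prop :=
  vertex_star g /\ realization° (pos K g).

(* A face is interior when it is not contained in the boundary of [realization]. *)
Definition interior_face s : Prop :=
  ~ (simplex s `<=` closure realization `\` realization°).

Definition interior_faces (i : nat) : {set {set V}} :=
  [set s in faces_dim i | `[< interior_face s >]]%SET.

Definition poly_on s (P : pred (mpoly 3 R)) (F : realization -> R) : Prop :=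
  exists2 p, P p &
    forall x : realization, simplex s (val x) -> F x = meval (val x 0) p.

Definition splines (r d : nat) : set (realization -> R) :=
  [set F | Cr_function r F /\ forall s, s \in tetrahedra ->
     poly_on s (fun p => mmeasure mdeg p <= d.+1)%N F].

Definition homogeneous_splines (r d : nat) : set (realization -> R) :=
  [set F | Cr_function r F /\ forall s, s \in tetrahedra ->
     poly_on s (fun p => p \is ishomog1 d mdeg) F].

Local Open Scope nat_scope.

(* For an interior edge of a closed vertex star n_tau >= 3, so t_tau >= 2; then
   a_tau is the remainder of t_tau (r + 1) by t_tau - 1 > 0, and none of the
   natural number subtractions defining a_tau and b_tau is truncated. *)
Definition n_edge s : nat := #|[set t in faces_dim 2 | s \subset t]%SET|.
Definition t_edge (r : nat) s : nat := minn (n_edge s) r.+2.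
Definition q_edge (r : nat) s : nat := (t_edge r s * r.+1) %/ (t_edge r s - 1).
Definition a_edge (r : nat) s : nat :=
  t_edge r s * r.+1 - (t_edge r s - 1) * q_edge r s.
Definition b_edge (r : nat) s : nat := t_edge r s - 1 - a_edge r s.

(* Binomial coefficients vanish when the upper argument is smaller than the lower
   one, so truncated subtraction in the upper argument is harmless. *)
Definition LBcs (d r : nat) : int :=
  (2 * ('C(d + 2, 2))%:Z
   + (#|interior_faces 2|%:Z - \sum_(s in interior_faces 1) (t_edge r s)%:Z)
     * ('C(d + 1 - r, 2))%:Z
   + \sum_(s in interior_faces 1)
       ((a_edge r s)%:Z * ('C(d + 1 - q_edge r s, 2))%:Z
        + (b_edge r s)%:Z * ('C(d + 2 - q_edge r s, 2))%:Z))%R.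

(* A closed vertex star has at least four interior edges. *)
Definition Dgamma (r : nat) : nat :=
  let f1 := #|interior_faces 1| in
  if f1 == 4 then 2 * r
  else if f1 == 5 then (5 * r + 2) %/ 3
  else (3 * r + 1) %/ 2.

End Complex.

Arguments splines {R V} K r d.
Arguments homogeneous_splines {R V} K r d.

(* Main.v *)
(* A spline on the star is a family of forms [f s], one per tetrahedron, such that
   [f s - f s'] is divisible by [ell ^+ r.+1] whenever [s], [s'] share a triangle
   lying in the plane [ell = 0]. Such families form the kernel of a matrix [A] whose
   rank is bounded through its cokernel: to functionals [psi v] on forms of degree
   [d] that kill the ideals of the interior edges [v] one associates the differences
   [psi v - psi u] over the triangles, and this map is injective as soon as the ideal
   of the central vertex contains all forms of degree [d]. Together with Euler's
   formula this gives LBcs.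

   The last condition can fail for the given star, but the rank of [A] is lower
   semicontinuous in the vertex positions, so it suffices to have it for one choice
   of positions. On a conic it follows from Bezout's theorem: dually, a form of degree
   [d] vanishing to order [d - r] at the vertices of an arrangement of lines, each
   containing at least three of these points, is divisible by all the lines; after
   division by the [n] lines one has degree [d - n] and order [d - r - 2], and
   [d > Dgamma] makes the induction go through. *)

Require Import Defs.
From HB Require Import structures.
From mathcomp Require Import all_boot all_order all_algebra.
From mathcomp Require Import -(notations) mpoly.
From mathcomp Require Import ring lra zify.
From mathcomp Require Import boolp classical_sets functions reals.
From mathcomp Require Import topology normedtype derive.
Import Order.TTheory GRing.Theory Num.Theory.
Import numFieldNormedType.Exports.

Set Implicit Arguments.
Unset Strict Implicit.
Unset Printing Implicit Defensive.
Local Open Scope ring_scope.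

(** * Linear algebra *)

(** The deformation to a conic preserves incidences only; the moved points need not span a fan. The
    rank estimate is therefore proved for abstract incidence data, and the geometry of the star
    enters it mainly through three facts: boundaries cancel, the link is connected, and every
    interior edge has three neighbours. The thresholds of [Dgamma] come from one round of divisions
    by [n] lines, which sends degree and order [(d, m)] to [(d - n, m - 2)]. The quantities
    [2m - d], [5m - 2d] and [3m - d] then change by [n - 4], [2n - 10] and [n - 6], so they do not
    decrease from [n = 4], [5] and [6] on; the starting order is [m = d - r]. Euler's formula enters
    as the inequality [f3 - f2 + f1 >= 2], the direction that a lower bound asks for. For
    smoothness, tetrahedra are replaced by the cones that they span from the origin. These cover
    space, so a piecewise polynomial extends to all of it and can be differentiated piece by piece.
    The first entry of the maximum counts global forms, and up to degree [Dgamma] nothing else is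
    counted. *)

Section RankBounds.
Variable F : fieldType.

Definition mxf (S : nzRingType) (I J : finType) (A : I -> J -> S) :
    'M[S]_(#|I|, #|J|) :=
  \matrix_(i, j) A (enum_val i) (enum_val j).

Definition rowf (I : finType) (c : I -> F) : 'rV[F]_#|I| :=
  \row_i c (enum_val i).

Lemma sum_enum_val (S : nmodType) (I : finType) (f : I -> S) :
  \sum_(i < #|I|) f (enum_val i) = \sum_i f i.
Proof. by rewrite -big_enum_val. Qed.

Lemma rowf_enum_rank (I : finType) (v : 'rV[F]_#|I|) :
  rowf (fun i => v 0 (enum_rank i)) = v.
Proof. by apply/rowP => i; rewrite mxE enum_valK. Qed.

Lemma rowf_mul (I J : finType) (c : I -> F) (A : I -> J -> F) :
  rowf c *m mxf A = rowf (fun j => \sum_i c i * A i j).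
Proof.
apply/rowP => j; rewrite !mxE -[RHS]sum_enum_val.
by apply: eq_bigr => i _; rewrite !mxE.
Qed.

Lemma rowf_eq0 (I : finType) (c : I -> F) :
  rowf c = 0 <-> forall i, c i = 0.
Proof.
split=> [h i|h]; last by apply/rowP => i; rewrite !mxE h.
by move/rowP/(_ (enum_rank i)): h; rewrite !mxE enum_rankK.
Qed.

Lemma left_kernel_family (I J : finType) (A : I -> J -> F) :
  exists B : 'I_(#|I| - \rank (mxf A)) -> I -> F,
    (forall k j, \sum_i B k i * A i j = 0) /\
    (forall c : 'I_(#|I| - \rank (mxf A)) -> F,
       (forall i, \sum_k c k * B k i = 0) -> forall k, c k = 0).
Proof.
have e : \rank (kermx (mxf A)) = (#|I| - \rank (mxf A))%N by rewrite mxrank_ker.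
rewrite -e; set b := row_base (kermx (mxf A)).
exists (fun k i => b k (enum_rank i)); split=> [k j|c hc k].
  have : row k b *m mxf A = 0.
    apply/sub_kermxP; apply: submx_trans (row_sub _ _) _.
    by rewrite eq_row_base.
  rewrite -[row k b]rowf_enum_rank rowf_mul => /rowf_eq0 /(_ j) h.
  by rewrite -[RHS]h; apply: eq_bigr => i _; rewrite [row k b _ _]mxE.
have : (\row_k c k) *m b = 0.
  apply/rowP => i; rewrite mxE [RHS]mxE -[RHS](hc (enum_val i)).
  by apply: eq_bigr => l _; rewrite mxE enum_valK.
rewrite -[RHS](mul0mx _ b) => /(row_free_inj (row_base_free _)) /rowP /(_ k).
by rewrite !mxE.
Qed.

(** The vectors [y] that satisfy the conditions [C] form a space of dimension at least
    [#|P| - #|Q|], and [D] embeds it into the annihilator of the rows of [A], of dimension [#|J|]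
    minus the rank of [A]. *)
Lemma rank_le_of_functionals (I J P Q : finType) (A : I -> J -> F)
    (D : P -> J -> F) (C : P -> Q -> F) :
  (forall y, (forall q, \sum_p y p * C p q = 0) ->
     forall i, \sum_j (\sum_p y p * D p j) * A i j = 0) ->
  (forall y, (forall q, \sum_p y p * C p q = 0) ->
     (forall j, \sum_p y p * D p j = 0) -> forall p, y p = 0) ->
  (\rank (mxf A) + #|P| <= #|J| + #|Q|)%N.
Proof.
move=> hA hD.
set X := kermx (mxf C).
have yX (u : 'rV_#|P|) : (u <= X)%MS ->
    forall q, \sum_p u 0 (enum_rank p) * C p q = 0.
  by move/sub_kermxP; rewrite -{1}[u]rowf_enum_rank rowf_mul => /rowf_eq0.
have rkX : \rank X = (#|P| - \rank (mxf C))%N by rewrite mxrank_ker.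
clearbody X.
have XDA : (X *m mxf D) *m (mxf A)^T = 0.
  apply/row_matrixP => k; rewrite row0 !row_mul.
  have hk := yX _ (row_sub k X); rewrite -[row k X]rowf_enum_rank rowf_mul.
  apply/rowP => i; rewrite mxE [RHS]mxE -[RHS](hA _ hk (enum_val i)) -[RHS]sum_enum_val.
  by apply: eq_bigr => j _; rewrite [LHS]mulrC mxE [rowf _ _ _]mxE mxE mulrC.
have rX : \rank (X *m mxf D) = \rank X.
  apply/mxrank_injP/rowV0P => v; rewrite sub_capmx => /andP[vX /sub_kermxP].
  rewrite -{1}[v]rowf_enum_rank rowf_mul => /rowf_eq0 vD.
  have := hD _ (yX _ vX) vD => h0.
  by apply/rowP => i; rewrite -[i]enum_valK h0 mxE.
have := mulmx0_rank_max XDA; rewrite mxrank_tr rX rkX.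
have := rank_leq_col (mxf C); have := rank_leq_row (mxf C); lia.
Qed.

End RankBounds.

(** * Semicontinuity of the rank in one parameter *)

Section Semicontinuity.
Variable F : fieldType.

Definition evalmx (t : F) m n (A : 'M[{poly F}]_(m, n)) : 'M[F]_(m, n) :=
  map_mx (horner_eval t) A.

Lemma full_rank_minor m n (A : 'M[F]_(m, n)) :
  exists (f : 'I_(\rank A) -> 'I_m) (g : 'I_(\rank A) -> 'I_n),
    mxsub f g A \in unitmx.
Proof.
pose f := maxrankfun A.
have rf : \rank (rowsub f A) = \rank A by apply/eqP; rewrite -/(row_free _) maxrowsub_free.
pose B := (rowsub f A)^T.
have fullB : row_full B^T^T.
  by rewrite trmxK /row_full /B mxrank_tr rf.
rewrite trmxK in fullB.
exists f, (fullrankfun fullB).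
have := fullrowsub_unit fullB; rewrite -unitmx_tr.
by rewrite (_ : _^T = mxsub f (fullrankfun fullB) A) //; apply/matrixP => i j; rewrite !mxE.
Qed.

(* The nonvanishing minor of [A(t0)] is a polynomial in [t]. *)
Lemma rank_semicontinuous m n (A : 'M[{poly F}]_(m, n)) (t0 : F) :
  exists2 p : {poly F}, p != 0 &
    forall t, p.[t] != 0 -> (\rank (evalmx t0 A) <= \rank (evalmx t A))%N.
Proof.
have [f [g ufg]] := full_rank_minor (evalmx t0 A).
have ev t : \det (mxsub f g (evalmx t A)) = (\det (mxsub f g A)).[t].
  by rewrite -[RHS]/(horner_eval t _) -det_map_mx /= map_mxsub.
exists (\det (mxsub f g A)) => [|t].
  apply/eqP => h0; move: ufg; rewrite unitmxE ev h0 horner0.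
  by rewrite unitr0.
rewrite -ev -unitfE -unitmxE => u.
rewrite -[X in (X <= _)%N](mxrank_unit u).
have -> : mxsub f g (evalmx t A) =
    rowsub f 1%:M *m (evalmx t A *m colsub g 1%:M).
  by rewrite mulmx_colsub mulmx1 mul_rowsub_mx mul1mx; apply/matrixP => i j; rewrite !mxE.
exact: leq_trans (mxrankM_maxr _ _) (mxrankM_maxl _ _).
Qed.

End Semicontinuity.

Lemma natr_uniq (R : numDomainType) n : uniq [seq k%:R : R | k <- iota 0 n].
Proof. by rewrite map_inj_uniq ?iota_uniq // => a b /eqP; rewrite eqr_nat => /eqP. Qed.

Lemma poly_nonroot (R : numFieldType) (p : {poly R}) :
  p != 0 -> exists t : R, p.[t] != 0.
Proof.
move=> p0; apply: contrapT => h.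
have := max_poly_roots p0 _ (natr_uniq R (size p)).
rewrite size_map size_iota ltnn => /(_ _)/negP; apply; last by [].
by apply/allP => x _; apply/rootP/eqP/negPn/negP => hx; apply: h; exists x.
Qed.

Lemma poly_ext (R : numFieldType) (p q : {poly R}) :
  (forall t, p.[t] = q.[t]) -> p = q.
Proof.
move=> h; apply/eqP; rewrite -subr_eq0; apply: contrapT => /negP/poly_nonroot[t].
by rewrite hornerD hornerN h subrr eqxx.
Qed.

(** * Dimensions of spaces of real functions *)

Section Dimension.
Variables (R : realType) (T : Type).
Implicit Types (L : set (T -> R)) (n : nat).

Definition comb n (b : 'I_n -> T -> R) (c : 'I_n -> R) (x : T) : R :=
  \sum_i c i * b i x.

Definition independent n (b : 'I_n -> T -> R) : Prop :=
  forall c : 'I_n -> R, (forall x, comb b c x = 0) -> forall i, c i = 0.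

Definition subspace L : Prop :=
  L (fun=> 0) /\ forall a F G, L F -> L G -> L (fun x => a * F x + G x).

Lemma subspace_comb L n (b : 'I_n -> T -> R) c :
  subspace L -> (forall i, L (b i)) -> L (comb b c).
Proof.
move=> [L0 LD]; elim: n b c => [|n IH] b c Lb.
  by rewrite (_ : comb b c = fun=> 0) //; apply/funext => x; rewrite /comb big_ord0.
rewrite (_ : comb b c = fun x => c ord_max * b ord_max x +
   comb (fun i => b (widen_ord (leqnSn n) i)) (fun i => c (widen_ord (leqnSn n) i)) x).
  by apply: LD => //; apply: IH.
by apply/funext => x; rewrite /comb big_ord_recr /= addrC.
Qed.

Lemma independent_le_span N n (b : 'I_N -> T -> R) (u : 'I_n -> T -> R) :
  (forall i, exists c, u i = comb b c) -> independent u -> (n <= N)%N.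
Proof.
move=> hu iu; rewrite leqNgt; apply/negP => ltNn.
pose A : 'M[R]_(n, N) := \matrix_(i, j) projT1 (cid (hu i)) j.
have hA i x : u i x = \sum_j A i j * b j x.
  have := projT2 (cid (hu i)) => e; rewrite {1}e /comb.
  by apply: eq_bigr => j _; rewrite mxE.
have : kermx A != 0.
  rewrite -mxrank_eq0 mxrank_ker -lt0n subn_gt0.
  exact: leq_ltn_trans (rank_leq_col _) ltNn.
case/rowV0Pn => v /sub_kermxP vA /negP; apply; apply/eqP/rowP => i; rewrite mxE.
apply: (iu (v 0)) => x; rewrite /comb.
under eq_bigr => k _ do rewrite hA mulr_sumr.
rewrite exchange_big big1 //= => j _.
under eq_bigr => k _ do rewrite mulrA.
rewrite -mulr_suml; move/rowP/(_ j): vA; rewrite !mxE => ->.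
by rewrite mul0r.
Qed.

Definition has_independent L n : Prop :=
  exists2 u : 'I_n -> T -> R, independent u & forall i, L (u i).

(* A maximal independent family of a finitely spanned subspace is a basis. *)
Lemma has_dim_exists L N (b : 'I_N -> T -> R) :
  subspace L -> (forall F, L F -> exists c, F = comb b c) ->
  exists2 n, has_dim L n & forall k, has_independent L k -> (k <= n)%N.
Proof.
move=> sL hb.
have bnd k : has_independent L k -> (k <= N)%N.
  by move=> [u iu Lu]; apply: (independent_le_span (b := b) _ iu) => i; apply: hb.
have ex0 : exists k, `[< has_independent L k >].
  by exists 0%N; apply/asboolP; exists (fun=> fun=> 0) => [c _ []|[]].
have bnd' k : `[< has_independent L k >] -> (k <= N)%N by move/asboolP/bnd.
have [n /asboolP [u iu Lu] nmax] := ex_maxnP ex0 bnd'.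
exists n; last by move=> k hk; apply: nmax; apply/asboolP.
exists u => /=; split.
  move=> c c' /= e; apply/rowP => i; apply/eqP; rewrite -subr_eq0; apply/eqP.
  apply: (iu (fun i => c 0 i - c' 0 i)) => x; rewrite /comb.
  under eq_bigr => k _ do rewrite mulrBl.
  by rewrite sumrB; have /(congr1 (@^~ x)) /= -> := e; rewrite subrr.
apply/seteqP; split=> [_ [c _ <-]|F LF] /=.
  exact: (subspace_comb (c 0) sL Lu).
apply: contrapT => nF.
suff : has_independent L n.+1 by move/asboolP/nmax; rewrite ltnn.
exists (fun i => if unlift ord_max i is Some j then u j else F).
  move=> c hc.
  have e x : comb u (fun i => c (lift ord_max i)) x + c ord_max * F x = 0.
    rewrite -[RHS](hc x) /comb big_ord_recr /= unlift_none; congr (_ + _).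
    apply: eq_bigr => i _.
    have -> : widen_ord (leqnSn n) i = lift ord_max i.
      by apply/val_inj; rewrite /= /bump leqNgt ltn_ord.
    by rewrite liftK.
  have cm : c ord_max = 0.
    apply/eqP/negPn/negP => c0; apply: nF.
    exists (\row_i (- c (lift ord_max i) / c ord_max)) => //.
    apply/funext => x; apply: (mulfI c0).
    apply/eqP; rewrite -subr_eq0 -oppr_eq0 opprB addrC -[X in _ == X](e x) /comb.
    rewrite mulr_sumr -sumrN; apply/eqP; congr (_ + _); apply: eq_bigr => i _.
    by rewrite mxE; field.
  have ci i : c (lift ord_max i) = 0.
    by apply: (iu (fun i => c (lift ord_max i))) => x; have := e x; rewrite cm mul0r addr0.
  move=> i; case: (unliftP ord_max i) => [j ->|->] //.
by move=> i; case: unliftP => [j _|_].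
Qed.

Lemma has_independent_of_dim L n : has_dim L n -> has_independent L n.
Proof.
move=> [b [ib rb]]; exists b => [c hc i|i].
  have : \row_i c i = 0.
    apply: ib; apply/funext => x; rewrite [RHS]big1 => [|j _]; last by rewrite mxE mul0r.
    by rewrite -[RHS](hc x); apply: eq_bigr => j _; rewrite mxE.
  by move/rowP/(_ i); rewrite !mxE.
rewrite -rb; exists (delta_mx 0 i) => //; apply/funext => x.
rewrite (bigD1 i) //= mxE !eqxx mul1r big1 ?addr0 // => j /negbTE ji.
by rewrite mxE ji andbF mul0r.
Qed.

Lemma has_independent_cat L L1 L2 n1 n2 :
  subspace L1 -> subspace L2 -> (L1 `<=` L)%classic -> (L2 `<=` L)%classic ->
  (forall F, L1 F -> L2 F -> forall x, F x = 0) ->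
  has_independent L1 n1 -> has_independent L2 n2 -> has_independent L (n1 + n2).
Proof.
move=> s1 s2 h1 h2 h12 [u iu Lu] [v iv Lv].
exists (fun i => match fintype.split i with inl j => u j | inr j => v j end).
  move=> c hc.
  have e x : comb u (fun i => c (lshift n2 i)) x + comb v (fun i => c (rshift n1 i)) x = 0.
    rewrite -[RHS](hc x) /comb big_split_ord /=.
    congr (_ + _); apply: eq_bigr => i _.
      by rewrite (fintype.unsplitK (inl i)).
    by rewrite (fintype.unsplitK (inr i)).
  have u0 x : comb u (fun i => c (lshift n2 i)) x = 0.
    apply: h12; first exact: subspace_comb.
    rewrite (_ : comb u _ = fun x => (-1) * comb v (fun i => c (rshift n1 i)) x + 0).
      by case: (s2) => l0 lD; apply: lD => //; apply: subspace_comb.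
    by apply/funext => y; rewrite addr0 mulN1r; apply/eqP; rewrite -addr_eq0 e.
  have v0 x : comb v (fun i => c (rshift n1 i)) x = 0 by rewrite -(e x) u0 add0r.
  move=> i; rewrite -(fintype.splitK i); case: (fintype.split i) => j /=; [exact: iu u0 j|exact: iv v0 j].
by move=> i; case: (fintype.split i) => j; [apply/h1/Lu|apply/h2/Lv].
Qed.

End Dimension.

(** * Counting generators of edge ideals *)

Section Counting.
Local Open Scope nat_scope.

(* Bounds the dimension in degree [d] of the ideal of an edge lying in [n]
   triangles; the summand [j] counts binary forms of degree [j]. *)
Definition edge_count (r d n : nat) : nat :=
  \sum_(j < d.+1) minn j.+1 (n * (j - r)).

(** For [j > r] the difference [(r + 2) * (j - r) - (j + 1)] equals [(r + 1) * (j - r - 1) >= 0], so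
    with [r + 2] planes the minimum is already [j + 1]. This is the source of the cap in
    [t_edge]. *)
Lemma minn_edge_cap r n j : minn j.+1 (n * (j - r)) = minn j.+1 (minn n r.+2 * (j - r)).
Proof.
case: (leqP j r) => [/eqP ->|rj]; first by rewrite !muln0.
have [nr|rn] := leqP n r.+2; first by [].
have h : j.+1 <= r.+2 * (j - r) by nia.
rewrite (minn_idPl h) (minn_idPl _) //; apply: leq_trans h _; nia.
Qed.

Lemma edge_count_cap r d n : edge_count r d n = edge_count r d (minn n r.+2).
Proof. by apply: eq_bigr => j _; apply: minn_edge_cap. Qed.

(** Comparing consecutive values of [d] reduces the identity to [t (j - r) - (j + 1) = a (j - q) + b
    (j + 1 - q)], true because [a + b = t - 1] and [t (r + 1) = q (t - 1) + a]. For [t <= r + 2],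
    [a] and [b] are the numbers of syzygies of degrees [q + 1] and [q] among the powers of exponent
    [r + 1] of [t] pairwise independent binary linear forms. *)
Lemma edge_count_binomial r d t : 2 <= t ->
  let q := (t * r.+1) %/ (t - 1) in
  let a := t * r.+1 - (t - 1) * q in
  let b := t - 1 - a in
  edge_count r d t + a * 'C(d + 1 - q, 2) + b * 'C(d + 2 - q, 2) =
  t * 'C(d + 1 - r, 2).
Proof.
move=> t2 q a b.
have [s ts] : exists s, t = s.+2 by exists t.-2; lia.
have et : t * r.+1 = q * (t - 1) + a.
  rewrite /a /q; have := divn_eq (t * r.+1) (t - 1); lia.
have alt : a < t - 1.
  have := ltn_pmod (t * r.+1) (d := t - 1); have := divn_eq (t * r.+1) (t - 1).
  rewrite -/q; lia.
have eb : a + b = t - 1 by rewrite /b; lia.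
have rq : r < q by nia.
clearbody q a b.
rewrite /edge_count; elim: d => [|d IH].
  by rewrite big_ord1 sub0n muln0 minn0 !bin_small ?muln0 //; lia.
rewrite big_ord_recr /=.
have bin2S m k : 'C(m.+1 - k, 2) = 'C(m - k, 2) + (m - k).
  have [km|mk] := leqP k m; first by rewrite subSn // binS bin1 addnC.
  by rewrite !bin_small //; lia.
rewrite !addSn !bin2S.
set S := \sum_(i < _) _ in IH *.
suff : minn d.+2 (t * (d.+1 - r)) + a * (d + 1 - q) + b * (d + 2 - q) = t * (d + 1 - r) by nia.
(* The crossover degree is [q]: below it the [t * (j - r)] products do not exceed [j + 1] and both
   binomial increments vanish; from [q] on the minimum is [j + 1]. *)
have [dq|qd] := ltnP d.+1 q.
  have -> : d + 2 - q = 0 by lia.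
  have -> : d + 1 - q = 0 by lia.
  rewrite !muln0 !addn0 addn1; apply/minn_idPr.
  have [dr|rd] := leqP d.+1 r; first by rewrite (eqP dr) muln0.
  nia.
have -> : minn d.+2 (t * (d.+1 - r)) = d.+2 by apply/minn_idPl; nia.
nia.
Qed.

End Counting.

(** * Ternary forms and directional derivatives *)

Section Forms.

Definition i0 : 'I_3 := @Ordinal 3 0 isT.
Definition i1 : 'I_3 := @Ordinal 3 1 isT.
Definition i2 : 'I_3 := @Ordinal 3 2 isT.

Lemma ord3P (i : 'I_3) : [\/ i = i0, i = i1 | i = i2].
Proof.
by case: i => [[|[|[|//]]]] h; [apply: Or31|apply: Or32|apply: Or33]; apply/val_inj.
Qed.

Lemma sum3 (S : nmodType) (f : 'I_3 -> S) : \sum_i f i = f i0 + f i1 + f i2.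
Proof.
rewrite !big_ord_recl big_ord0 addr0 addrA.
by congr (f _ + f _ + f _); apply/val_inj.
Qed.

Definition hom (S : nzRingType) (d : nat) : qualifier 0 (mpoly 3 S) :=
  ishomog1 d mdeg.

Definition vx (S : nzRingType) (i : 'I_3) : mpoly 3 S := mpolyX S (mnm1 i).

Definition lform (S : nzRingType) (c : 'rV[S]_3) : mpoly 3 S :=
  \sum_i c 0 i *: vx S i.

Lemma hom_lform (S : nzRingType) (c : 'rV[S]_3) : lform c \is hom S 1.
Proof.
by apply: rpred_sum => i _; apply: rpredZ; rewrite dhomogX; apply/eqP/mdeg1.
Qed.

Lemma hom_eq (S : nzRingType) d e (p : mpoly 3 S) :
  d = e -> p \is hom S d -> p \is hom S e.
Proof. by move=> ->. Qed.

Lemma homX (S : nzRingType) d k (p : mpoly 3 S) :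
  p \is hom S d -> p ^+ k \is hom S (d * k).
Proof. exact: dhomogMn. Qed.

Lemma homX1 (S : nzRingType) k (p : mpoly 3 S) : p \is hom S 1 -> p ^+ k \is hom S k.
Proof. by move=> /(homX k); rewrite mul1n. Qed.

Lemma homM (S : nzRingType) d e (p q : mpoly 3 S) :
  p \is hom S d -> q \is hom S e -> p * q \is hom S (d + e).
Proof. exact: dhomogM. Qed.

Section Field.
Variable R : realFieldType.
Local Notation mp := (mpoly 3 R).
Local Notation hom := (hom R).

Definition lin_closed (P : mp -> Prop) :=
  P 0 /\ forall c p q, P p -> P q -> P (c *: p + q).

Lemma hom_ind (P : mp -> Prop) d : lin_closed P ->
  (forall m : multinom 3, mdeg m = d -> P (mpolyX R m)) ->
  forall h, h \is hom d -> P h.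
Proof.
move=> [P0 PD] PX h /dhomogP hh; rewrite (mpolyE h) big_seq.
apply: (big_ind P) => // [x y Px Py|m hm].
  by rewrite -[x]scale1r; apply: PD.
by rewrite -[X in P X]addr0; apply: PD => //; apply/PX/hh.
Qed.

Lemma multinom_divisible (m : multinom 3) : (0 < mdeg m)%N ->
  exists i, m = mnm_add (mnm1 i) (mnm_sub m (mnm1 i)).
Proof.
move=> md; have [i mi] : exists i, (0 < m i)%N.
  apply/existsP; apply: contraTT md; rewrite negb_exists -leqNgt leqn0 => /forallP h.
  by rewrite mdegE sum_nat_eq0; apply/forallP => i; rewrite -leqn0 leqNgt h.
exists i; apply/mnmP => j; rewrite mnmDE mnmBE mnm1E.
by case: eqP => [<-|_]; [rewrite subnKC|rewrite subn0].
Qed.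

(** Induction on the degree with [P] generalized: one variable is split off, written in [a], [b],
    [w], and the induction hypothesis is applied to the predicate [P (vx R i * _)]. *)
Lemma span_forms (a b w : mp) :
  (forall i, exists c : R * R * R, vx R i = c.1.1 *: a + c.1.2 *: b + c.2 *: w) ->
  forall (P : mp -> Prop) d, lin_closed P ->
  (forall i j k, (i + j + k = d)%N -> P (a ^+ i * b ^+ j * w ^+ k)) ->
  forall h, h \is hom d -> P h.
Proof.
move=> hx P d Pl PP; apply: hom_ind => // m; elim: d P Pl PP m => [|d IH] P Pl PP m md.
  have -> : m = mnm0.
    by apply/eqP; rewrite -mdeg_eq0 md.
  by rewrite mpolyX0; have := PP 0%N 0%N 0%N erefl; rewrite !expr0 !mul1r.
have [i em] : exists i, m = mnm_add (mnm1 i) (mnm_sub m (mnm1 i)).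
  by apply: multinom_divisible; rewrite md.
rewrite em mpolyXD; move: md; rewrite {1}em mdegD mdeg1 add1n => -[md'].
case: Pl => P0 PD.
apply: (IH (fun h => P (vx R i * h)) _ _ _ md').
  by split=> [|c p q Pp Pq]; rewrite ?mulr0 // mulrDr -scalerAr; apply: PD.
move=> e f g efg; have [[[c1 c2] c3] /= ->] := hx i.
have -> : (c1 *: a + c2 *: b + c3 *: w) * (a ^+ e * b ^+ f * w ^+ g) =
   c1 *: (a ^+ e.+1 * b ^+ f * w ^+ g) + (c2 *: (a ^+ e * b ^+ f.+1 * w ^+ g) +
   (c3 *: (a ^+ e * b ^+ f * w ^+ g.+1) + 0)).
  by rewrite -!mul_mpolyC !exprS; ring.
by do 3![apply: (PD); first by apply: PP; lia].
Qed.

Lemma mderiv_vx i j : mderiv i (vx R j) = mpolyC 3 (i == j)%:R.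
Proof.
rewrite mderivX mnm1E eq_sym; case: eqP => [->|_]; last by rewrite scale0r mpolyC0.
rewrite scale1r (_ : mnm_sub _ _ = mnm0) ?mpolyX0 ?mpolyC1 //.
by apply/mnmP => k; rewrite mnmBE subnn mnm0E.
Qed.

Lemma mderiv_lform i (c : 'rV[R]_3) : mderiv i (lform c) = mpolyC 3 (c 0 i).
Proof.
rewrite /lform linear_sum (bigD1 i) //= big1 => [|j /negbTE ji].
  by rewrite addr0 mderivZ mderiv_vx eqxx mpolyC1 -mul_mpolyC mulr1.
by rewrite mderivZ mderiv_vx eq_sym ji mpolyC0 scaler0.
Qed.

Section Derivation.
Variable p : 'rV[R]_3.

Definition ddir (h : mp) : mp := \sum_i p 0 i *: mderiv i h.

Lemma ddir_is_linear : linear ddir.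
Proof.
move=> c f g; rewrite /ddir scaler_sumr -big_split /=; apply: eq_bigr => i _.
by rewrite linearP scalerDr !scalerA mulrC.
Qed.
HB.instance Definition _ := GRing.isLinear.Build R mp mp _ ddir ddir_is_linear.

Lemma ddirM f g : ddir (f * g) = ddir f * g + f * ddir g.
Proof.
rewrite /ddir mulr_suml mulr_sumr -big_split /=; apply: eq_bigr => i _.
by rewrite mderivM scalerDr scalerAl scalerAr.
Qed.

Lemma ddirC c : ddir (mpolyC 3 c) = 0.
Proof. by rewrite /ddir big1 // => i _; rewrite mderivC scaler0. Qed.

Lemma ddirX f k : ddir (f ^+ k.+1) = (k.+1%:R *: f ^+ k) * ddir f.
Proof.
elim: k => [|k IH]; first by rewrite expr1 expr0 scale1r mul1r.
rewrite exprS ddirM {}IH -!mul_mpolyC -[k.+2%:R]natr1 mpolyCD mpolyC1 !exprS.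
by ring.
Qed.

Lemma ddir_lform c : ddir (lform c) = mpolyC 3 (\sum_i c 0 i * p 0 i).
Proof.
rewrite /ddir rmorph_sum /=; apply: eq_bigr => i _.
by rewrite mderiv_lform -mul_mpolyC -mpolyCM mulrC.
Qed.

Lemma hom_mderiv d i (h : mp) : h \is hom d.+1 -> mderiv i h \is hom d.
Proof.
move: h; apply: hom_ind => [|m md].
  split=> [|c f g hf hg]; first by rewrite linear0 dhomog0.
  by rewrite linearP rpredD // rpredZ.
rewrite mderivX; have [->|mi] := eqVneq (m i) 0%N; first by rewrite scale0r dhomog0.
apply: rpredZ; rewrite dhomogX; apply/eqP.
have : mdeg (mnm_add (mnm_sub m (mnm1 i)) (mnm1 i)) = d.+1.
  rewrite -md; congr mdeg; apply/mnmP => j; rewrite mnmDE mnmBE mnm1E.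
  by case: eqP => [<-|_]; rewrite ?subnK ?subn0 ?addn0 // lt0n.
by rewrite mdegD mdeg1 addn1 => -[].
Qed.

Lemma hom0_const (h : mp) : h \is hom 0 -> exists c, h = mpolyC 3 c.
Proof.
move: h; apply: hom_ind => [|m /eqP]; last first.
  by rewrite mdeg_eq0 => /eqP ->; exists 1; rewrite mpolyX0 mpolyC1.
split=> [|c _ _ [f ->] [g ->]]; first by exists 0; rewrite mpolyC0.
by exists (c * f + g); rewrite mpolyCD mpolyCM mul_mpolyC.
Qed.

Lemma hom_ddir d (h : mp) : h \is hom d.+1 -> ddir h \is hom d.
Proof. by move=> hh; apply: rpred_sum => i _; apply/rpredZ/hom_mderiv. Qed.

Lemma ddir_hom0 (h : mp) : h \is hom 0 -> ddir h = 0.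
Proof. by case/hom0_const => c ->; apply: ddirC. Qed.

Lemma hom_iter_ddir d k (h : mp) :
  h \is hom d -> iter k ddir h \is hom (d - k) /\ ((d < k)%N -> iter k ddir h = 0).
Proof.
move=> hh; elim: k => [|k [IH IH0]]; first by rewrite subn0.
rewrite iterS; have [dk|kd] := leqP d k.
  have -> : ddir (iter k ddir h) = 0.
    by move: dk; rewrite leq_eqVlt => /orP[/eqP e|/IH0 ->];
      [apply: ddir_hom0; move: IH; rewrite e subnn|rewrite linear0].
  by rewrite dhomog0.
by split=> [|]; [apply: hom_ddir; rewrite subnSK|lia].
Qed.

Variable w : mp.
Hypothesis w_hom : w \is hom 1.
Hypothesis ddir_w : ddir w = 1.

(** Repeated integration by parts along [p], where [w] has derivative 1 and its divided powers are
    the iterated antiderivatives of 1. The series may stop at [d] because each derivative lowers the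
    degree of a form. The derivative of the sum telescopes to [h]. *)
Definition antider (d : nat) (h : mp) : mp :=
  \sum_(k < d.+1) ((-1) ^+ k / (k.+1)`!%:R) *: (w ^+ k.+1 * iter k ddir h).

Lemma iter_ddir_linear k : linear (iter k ddir).
Proof. by elim: k => [|k IH] c f g //; rewrite !iterS IH linearP. Qed.

Lemma antider_is_linear d : linear (antider d).
Proof.
move=> c f g; rewrite /antider scaler_sumr -big_split /=; apply: eq_bigr => k _.
by rewrite iter_ddir_linear mulrDr -scalerAr scalerDr !scalerA mulrC.
Qed.
HB.instance Definition _ d := GRing.isLinear.Build R mp mp _ (antider d) (antider_is_linear d).

Lemma hom_antider d h : h \is hom d -> antider d h \is hom d.+1.
Proof.
move=> hh; apply: rpred_sum => k _; apply: rpredZ.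
apply: (@hom_eq _ (1 * k.+1 + (d - k))); first by have := ltn_ord k; lia.
by apply: homM; [apply: homX|case: (hom_iter_ddir k hh)].
Qed.

Lemma antiderK d h : h \is hom d -> ddir (antider d h) = h.
Proof.
move=> hh; rewrite /antider linear_sum /=.
pose t k : mp := ((-1) ^+ k / k`!%:R) *: (w ^+ k * iter k ddir h).
rewrite (eq_bigr (fun k : 'I_d.+1 => t k - t k.+1)); last first.
  move=> k _; rewrite linearZ /= ddirM ddirX ddir_w mulr1 scalerDr /t; congr (_ + _).
    rewrite -scalerAl scalerA factS natrM; congr (_ *: _); field.
    by rewrite nat1r !pnatr_eq0 -lt0n fact_gt0.
  by rewrite -scaleNr -mulNr [(-1) ^+ k.+1]exprS mulN1r opprK.
rewrite sumrB big_ord_recl [X in _ - X]big_ord_recr /= opprD addrA.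
rewrite (_ : t d.+1 = 0) ?subr0; last first.
  by rewrite /t; case: (hom_iter_ddir d.+1 hh) => _ ->; rewrite ?mulr0 ?scaler0.
by rewrite addrK /t expr0 fact0 invr1 mulr1 scale1r expr0 mul1r.
Qed.

Lemma iter_ddir_mulX (g : mp) k l : ddir g = 0 ->
  iter l ddir (g * w ^+ k) = (k ^_ l)%:R *: (g * w ^+ (k - l)).
Proof.
move=> g0; elim: l => [|l IH]; first by rewrite ffactn0 scale1r subn0.
rewrite iterS IH linearZ /= ddirM g0 mul0r add0r ffactnSr.
have [kl|lk] := leqP k l.
  by rewrite (eqP kl) muln0 scale0r expr0 -mpolyC1 ddirC mulr0 scaler0.
rewrite -(subnSK lk) ddirX ddir_w mulr1 -scalerAr scalerA natrM.
by rewrite subnSK // subnSK.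
Qed.

(** Every term of the series for [g * w ^+ k] is a multiple of [g * w ^+ k.+1]. The total factor is
    read off from [antiderK], so the alternating sum is never evaluated. *)
Lemma antider_ddir_mulX (g : mp) d k : g * w ^+ k \is hom d -> ddir g = 0 ->
  antider d (ddir (g * w ^+ k.+1)) = g * w ^+ k.+1.
Proof.
move=> gh g0.
have e1 : ddir (g * w ^+ k.+1) = k.+1%:R *: (g * w ^+ k).
  by rewrite ddirM g0 mul0r add0r ddirX ddir_w mulr1 -scalerAr.
have [c ec] : exists c, antider d (g * w ^+ k) = c *: (g * w ^+ k.+1).
  exists (\sum_(l < d.+1) ((-1) ^+ l / (l.+1)`!%:R) * (k ^_ l)%:R).
  rewrite scaler_suml; apply: eq_bigr => l _; rewrite iter_ddir_mulX //.
  rewrite -scalerAr scalerA; have [lk|kl] := leqP l k.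
    by rewrite mulrCA -exprD addSn subnKC.
  by rewrite ffact_small // mulr0 !scale0r.
have := antiderK gh; rewrite ec linearZ /= e1 scalerA => h.
have : (c * k.+1%:R - 1) *: (g * w ^+ k) = 0 by rewrite scalerBl h scale1r subrr.
move/eqP; rewrite scaler_eq0 => /orP[|/eqP gw].
  rewrite subr_eq0 => /eqP ck.
  by rewrite linearZ /= ec scalerA mulrC ck scale1r.
by rewrite exprSr mulrA gw scaler0 mul0r linear0.
Qed.

End Derivation.

(* Seen as a form of degree [d] on the dual plane, [psi] vanishes to order at
   least [m] at the point [l]. *)
Definition mult (psi : {scalar mp}) (d : nat) (l : mp) (m : nat) : Prop :=
  forall k h, (k < m)%N -> (k <= d)%N -> h \is hom k -> psi (l ^+ (d - k) * h) = 0.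

Section Descent.
Variables (p : 'rV[R]_3) (a b w : mp) (d : nat) (psi : {scalar mp}).
Hypotheses (a_hom : a \is hom 1) (b_hom : b \is hom 1) (w_hom : w \is hom 1).
Hypotheses (Da : ddir p a = 0) (Db : ddir p b = 0) (Dw : ddir p w = 1).
Hypothesis span : forall i, exists c : R * R * R,
  vx R i = c.1.1 *: a + c.1.2 *: b + c.2 *: w.
Hypothesis kills : forall i j, (i + j = d.+1)%N -> psi (a ^+ i * b ^+ j) = 0.

Let psi' (h : mp) : R := psi (antider p w d h).

Let psi'_linear : linear_for *%R psi'.
Proof. by move=> c f g; rewrite /psi' !linearP. Qed.

Lemma ddir_mon i j : ddir p (a ^+ i * b ^+ j) = 0.
Proof.
rewrite ddirM.
have e f k : ddir p f = 0 -> ddir p (f ^+ k) = 0.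
  by case: k => [_|k f0]; [rewrite expr0 -mpolyC1 ddirC|rewrite ddirX f0 mulr0].
by rewrite !e // mul0r mulr0 addr0.
Qed.

(* A functional killing the kernel of the surjection [ddir p] factors through it. *)
Lemma descend : exists psi1 : {scalar mp},
  forall h, h \is hom d.+1 -> psi h = psi1 (ddir p h).
Proof.
pose lin := GRing.isLinear.Build R mp R *%R psi' psi'_linear.
pose psi1 : {scalar mp} := HB.pack psi' lin.
exists psi1; rewrite /psi1 /=.
rewrite /psi'; apply: (span_forms span) => [|i j [|k] ijk].
- by split=> [|c f g hf hg]; rewrite ?linear0 // !linearP /= hf hg.
- rewrite addn0 in ijk.
  by rewrite expr0 mulr1 kills // ddir_mon !linear0.
rewrite antider_ddir_mulX ?ddir_mon //.
have -> : d = (1 * i + 1 * j + 1 * k)%N by lia.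
by rewrite !homM // homX.
Qed.

End Descent.

Section MultDescent.
Variables (p : 'rV[R]_3) (d : nat) (psi psi1 : {scalar mp}).
Hypothesis psi1E : forall h, h \is hom d.+1 -> psi h = psi1 (ddir p h).

(** By [psi1E] the dual form [psi] is [psi1] times the line dual to [p], so a point [l] on that line
    loses one order. The test form [h] is lifted to an antiderivative of degree [k + 1], and
    [l ^+ (d - k)] passes through [ddir p] because [ddir p l = 0]. *)
Lemma mult_descend_through w l m : w \is hom 1 -> ddir p w = 1 ->
  l \is hom 1 -> ddir p l = 0 ->
  mult psi d.+1 l m -> mult psi1 d l m.-1.
Proof.
move=> w_hom Dw lh l0 ml k h km kd hh.
have Hh : antider p w k h \is hom k.+1 by apply: hom_antider.
have eh : ddir p (antider p w k h) = h by apply: antiderK.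
rewrite -{1}eh.
have -> : l ^+ (d - k) * ddir p (antider p w k h) = ddir p (l ^+ (d - k) * antider p w k h).
  rewrite ddirM; case: (d - k)%N => [|e]; first by rewrite expr0 -mpolyC1 ddirC mul0r add0r.
  by rewrite ddirX l0 mulr0 mul0r add0r.
rewrite -psi1E; last first.
  apply: (@hom_eq _ (1 * (d - k) + k.+1)); first by lia.
  by apply: homM => //; apply: homX.
by rewrite -subSS; apply: ml => //; lia.
Qed.

(** A point off the line keeps its order. The product rule on [l ^+ (d.+1 - k) * h] gives a nonzero
    multiple of [l ^+ (d - k) * h] plus a term containing [ddir p h], which has lower degree and is
    killed by induction on [k]. *)
Lemma mult_descend_off l c m : l \is hom 1 -> ddir p l = mpolyC 3 c -> c != 0 ->
  mult psi d.+1 l m -> mult psi1 d l m.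
Proof.
move=> lh lc c0 ml k; elim: k => [|k IH] h km kd hh.
  have := ml 0%N h km isT hh; rewrite subn0 psi1E; last first.
    apply: (@hom_eq _ (1 * d.+1 + 0)); first by lia.
    by apply: homM => //; apply: homX.
  rewrite ddirM (ddir_hom0 _ hh) mulr0 addr0 ddirX lc -mulrA -scalerAl linearZ /=.
  rewrite mul_mpolyC -scalerAr linearZ /= subn0 => /eqP.
  by rewrite !mulf_eq0 pnatr_eq0 (negbTE c0) /= => /eqP.
have := ml k.+1 h km (leqW kd) hh; rewrite psi1E; last first.
  apply: (@hom_eq _ (1 * (d.+1 - k.+1) + k.+1)); first by lia.
  by apply: homM => //; apply: homX.
rewrite subSS ddirM linearD /= -(subnSK kd) ddirX.
have -> : psi1 (l ^+ (d - k.+1).+1 * ddir p h) = 0.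
  by rewrite subnSK //; apply: IH; [lia|lia|apply: hom_ddir].
rewrite addr0 lc -mulrA -scalerAl linearZ /= mul_mpolyC -scalerAr linearZ /= => /eqP.
by rewrite !mulf_eq0 pnatr_eq0 (negbTE c0) /= => /eqP.
Qed.

End MultDescent.

Section Bezout.
Variables (psi : {scalar mp}) (d : nat) (a b : mp).

(** The restriction of the dual form to the line of points [b - x *: a], expanded in [x] at [c].
    Order [m] at [b - c *: a] makes the first [m] coefficients vanish, and by [fE] the polynomial is
    the same for all [c]. *)
Let f c : {poly R} :=
  \sum_(k < d.+1) ((-1) ^+ k * psi ((b - c *: a) ^+ (d - k) * a ^+ k) *+ 'C(d, k)) *:
    ('X - c%:P) ^+ k.

Let fE c x : (f c).[x] = psi ((b - x *: a) ^+ d).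
Proof.
rewrite horner_sum.
have -> : b - x *: a = (b - c *: a) + (- (x - c)) *: a.
  by rewrite opprB scalerBl addrA subrK.
rewrite exprDn linear_sum; apply: eq_bigr => k _.
rewrite hornerZ horner_exp hornerXsubC exprZn -scalerAr linearMn scalarZ.
by rewrite -[- (x - c)]mulN1r exprMn mulrnAl; congr (_ *+ _); ring.
Qed.

Let f_dvd c m : a \is hom 1 -> mult psi d (b - c *: a) m ->
  (('X - c%:P) ^+ m %| f c)%R.
Proof.
move=> ah mc; rewrite /f.
apply: (big_ind (fun q => (('X - c%:P) ^+ m %| q)%R)) => [|x y|k _];
  [exact: dvdp0|exact: dvdp_add|].
have [km|mk] := ltnP k m.
  rewrite mc //; [by rewrite mulr0 mul0rn scale0r dvdp0|by rewrite -ltnS|].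
  exact: homX1.
by rewrite -mul_polyC; apply: dvdp_mull; apply: dvdp_exp2l.
Qed.

(* Dual form of: a binary form of degree [d] with more than [d] zeros vanishes. *)
Lemma bezout3 c1 c2 c3 m1 m2 m3 : a \is hom 1 ->
  c1 != c2 -> c1 != c3 -> c2 != c3 ->
  mult psi d (b - c1 *: a) m1 -> mult psi d (b - c2 *: a) m2 ->
  mult psi d (b - c3 *: a) m3 -> (d < m1 + m2 + m3)%N ->
  forall i j, (i + j = d)%N -> psi (a ^+ i * b ^+ j) = 0.
Proof.
move=> ah n12 n13 n23 h1 h2 h3 dm.
have ff c c' : f c = f c' by apply: poly_ext => x; rewrite !fE.
have cop c c' m m' : c != c' -> coprimep (('X - c%:P) ^+ m) (('X - c'%:P) ^+ m' : {poly R}).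
  by move=> cc; apply/coprimep_expl/coprimep_expr; rewrite coprimep_XsubC2 // subr_eq0 eq_sym.
have dv : (('X - c1%:P) ^+ m1 * (('X - c2%:P) ^+ m2 * ('X - c3%:P) ^+ m3) %| f 0)%R.
  rewrite Gauss_dvdp; last by rewrite coprimepMr !cop.
  rewrite Gauss_dvdp ?cop //.
  by rewrite (ff 0 c1) f_dvd //= (ff c1 c2) f_dvd //= (ff c2 c3) f_dvd.
have sz : (size (f 0) <= d.+1)%N.
  apply: (leq_trans (size_sum _ _ _)); apply/bigmax_leqP => k _.
  by apply: (leq_trans (size_scale_leq _ _)); rewrite size_exp_XsubC ltn_ord.
have f0 : f 0 = 0.
  apply: contraTeq (dm) => f0; have := dvdp_leq f0 dv.
  rewrite size_proper_mul; last first.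
    by rewrite !lead_coefM !lead_coef_exp !lead_coefXsubC !expr1n !mulr1 oner_neq0.
  rewrite size_proper_mul; last first.
    by rewrite !lead_coef_exp !lead_coefXsubC !expr1n mulr1 oner_neq0.
  rewrite !size_exp_XsubC; move: (size (f 0)) sz => n sz; lia.
move=> i j ij; have id : (i < d.+1)%N by lia.
have : (f 0)`_i = 0 by rewrite f0 coef0.
rewrite coef_sum (bigD1 (Ordinal id)) //= big1 => [|k]; last first.
  by rewrite -val_eqE /= subr0 coefZ coefXn eq_sym => /negbTE ->; rewrite mulr0.
rewrite addr0 subr0 coefZ coefXn eqxx mulr1 scale0r subr0 -mulr_natr => /eqP.
rewrite !mulf_eq0 pnatr_eq0 signr_eq0 -leqn0 leqNgt bin_gt0 -ltnS id /= orbF => /eqP.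
by rewrite mulrC (_ : d - i = j)%N //; lia.
Qed.

End Bezout.
End Field.
End Forms.

(** * Powers of linear forms dual to points of a conic *)

Section LinearForms.

Definition row3 (S : nzRingType) (x y z : S) : 'rV[S]_3 := \row_i [:: x; y; z]`_i.

Lemma row3_eq (S : nzRingType) (u v : 'rV[S]_3) :
  u 0 i0 = v 0 i0 -> u 0 i1 = v 0 i1 -> u 0 i2 = v 0 i2 -> u = v.
Proof. by move=> h0 h1 h2; apply/rowP => i; case: (ord3P i) => ->. Qed.

Variable R : realFieldType.
Local Notation mp := (mpoly 3 R).

Lemma lform_is_linear : linear (@lform R).
Proof.
move=> c u v; rewrite /lform scaler_sumr -big_split /=; apply: eq_bigr => i _.
by rewrite !mxE scalerDl scalerA.
Qed.
HB.instance Definition _ :=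
  GRing.isLinear.Build R 'rV[R]_3 mp _ (@lform R) lform_is_linear.

Lemma lform_delta i : lform (delta_mx 0 i) = vx R i.
Proof.
rewrite /lform (bigD1 i) //= mxE !eqxx scale1r big1 ?addr0 // => j /negbTE ji.
by rewrite mxE ji scale0r.
Qed.

End LinearForms.

(** Here [m] is the order of vanishing at the vertices of [n] lines. For [m = d - r] the
    inequalities read [2r < d], [5r + 2 < 3d] and [3r + 1 < 2d], the three cases of [Dgamma]. Each
    implies [d < 3m], so a line with three vertices carries more zeros than the degree allows. *)
Definition degree_bound (n d m : nat) : bool :=
  [|| (4 <= n) && (d < 2 * m), (5 <= n) && (2 * d + 3 <= 5 * m)
    | (6 <= n) && (d + 2 <= 3 * m)]%N.

Lemma degree_bound_step n e m : degree_bound n (e + n) m ->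
  (e < e + n)%N /\ degree_bound n e (m - 2).
Proof. rewrite /degree_bound; lia. Qed.

Lemma degree_bound_lt n d m : degree_bound n d m -> (d + 0 < 3 * m)%N.
Proof. rewrite /degree_bound; lia. Qed.

Section Witness.
Variables (R : realFieldType) (W : finType) (s : W -> R) (adj : rel W).
Hypothesis s_inj : injective s.
Hypothesis nbr3 : forall v, exists u : W * W * W,
  [/\ adj v u.1.1, adj v u.1.2 & adj v u.2] /\
  uniq [:: v; u.1.1; u.1.2; u.2].
Hypothesis adj_irr : forall v, ~~ adj v v.
Local Notation mp := (mpoly 3 R).

(* All [moment v] lie on one conic, so any three of them are independent, and
   [chord v u] spans the linear forms vanishing at [moment v] and [moment u]. *)
Definition moment v : 'rV[R]_3 := row3 1 (s v) (s v ^+ 2).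

Definition chord v u : mp := lform (row3 (s v * s u) (- (s v + s u)) 1).

Let fa v : mp := lform (row3 (- s v) 1 0).
Let fb v : mp := lform (row3 (- s v ^+ 2) 0 1).
Let fw : mp := lform (row3 1 0 0).

(** The value vanishes only if [v] is an end of the chord, as no three points of a conic are
    collinear. So dividing by the line of [v] lowers the order only at the vertices on that line. *)
Lemma ddir_chord v x y :
  ddir (moment v) (chord x y) = mpolyC 3 ((s v - s x) * (s v - s y)).
Proof. by rewrite ddir_lform sum3 !mxE /=; congr (mpolyC _ _); ring. Qed.

(** On the line of [v] the vertex shared with [u] has parameter [s v + s u]; injectivity of [s]
    makes these parameters distinct, as [bezout3] requires. *)
Lemma chordE v u : chord v u = fb v - (s v + s u) *: fa v.
Proof.
rewrite /fb /fa -linearZ -linearB; congr lform.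
by apply: row3_eq; rewrite !mxE /=; ring.
Qed.

Let ddir_fa v : ddir (moment v) (fa v) = 0.
Proof. by rewrite ddir_lform sum3 !mxE /= -[RHS]mpolyC0; congr (mpolyC _ _); ring. Qed.

Let ddir_fb v : ddir (moment v) (fb v) = 0.
Proof. by rewrite ddir_lform sum3 !mxE /= -[RHS]mpolyC0; congr (mpolyC _ _); ring. Qed.

Let ddir_fw v : ddir (moment v) fw = 1.
Proof. by rewrite ddir_lform sum3 !mxE /= -[RHS]mpolyC1; congr (mpolyC _ _); ring. Qed.

Let span_abw v i : exists c : R * R * R,
  vx R i = c.1.1 *: fa v + c.1.2 *: fb v + c.2 *: fw.
Proof.
exists ((i == i1)%:R, (i == i2)%:R, (s v) ^+ i) => /=.
rewrite -lform_delta -!linearZ -!linearD; congr lform.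
by case: (ord3P i) => ->; apply: row3_eq; rewrite !mxE /= ?expr0 ?expr1; ring.
Qed.

Definition kills (psi : {scalar mp}) d := forall h, h \is hom R d -> psi h = 0.

Lemma mult_le (psi : {scalar mp}) d l m m' :
  (m' <= m)%N -> mult psi d l m -> mult psi d l m'.
Proof. by move=> mm h k f km; apply: h; apply: leq_trans mm. Qed.

Let sub3_bound (e n m b1 b2 b3 : nat) : (b1 + b2 + b3 <= n)%N ->
  (e + n < 3 * m)%N -> (e < (m - b1) + (m - b2) + (m - b3))%N.
Proof. lia. Qed.

(** [A] holds the lines already divided out, [l] the remaining ones. A vertex has lost one order for
    each of its lines in [A], so three vertices on a new line have total order at least [3m - #|A|].
    This exceeds the degree [e] because [e + #|A|] stays constant during the round. The continuation
    [hend] takes over once all lines are used. *)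
Lemma round m (l : seq W) (A : {set W}) e (psi : {scalar mp}) :
  uniq l -> (forall v, (v \in A) = (v \notin l)) -> (e + #|A| < 3 * m)%N ->
  (forall v u, adj v u -> mult psi e (chord v u) (m - (v \in A) - (u \in A))) ->
  (forall e' (psi' : {scalar mp}), e = (e' + size l)%N ->
     (forall v u, adj v u -> mult psi' e' (chord v u) (m - 2)) -> kills psi' e') ->
  kills psi e.
Proof.
elim: l A e psi => [|v l IH] A e psi ul hA hm hmult hend.
  apply: hend => [|v u vu]; first by rewrite addn0.
  by apply: mult_le (hmult _ _ vu); rewrite !hA /= -subnDA.
have [[[u1 u2] u3] /= [[a1 a2 a3]]] := nbr3 v.
rewrite !inE !negb_or => /and4P[/and3P[n1 n2 n3] /andP[n12 n13] n23 _].
have vA : (v \in A) = false by rewrite hA inE eqxx.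
have nulls i j : (i + j = e)%N -> psi (fa v ^+ i * fb v ^+ j) = 0.
  have ms x y : x != y -> s v + s x != s v + s y.
    by apply: contra => /eqP/addrI/s_inj ->.
  have mu u : adj v u -> mult psi e (fb v - (s v + s u) *: fa v) (m - (u \in A)).
    by move=> vu; have := hmult _ _ vu; rewrite vA subn0 chordE.
  apply: (bezout3 (hom_lform _) (ms _ _ n12) (ms _ _ n13) (ms _ _ n23)
    (mu _ a1) (mu _ a2) (mu _ a3)).
  apply: (sub3_bound _ hm).
  rewrite (cardsD1 u1 A) (cardsD1 u2 (A :\ u1)) (cardsD1 u3 (A :\ u1 :\ u2)).
  by rewrite !inE ![_ == u1]eq_sym n12 n13 eq_sym n23 /= !addnA leq_addr.
(* In degree 0 there is nothing left to divide: [nulls] already says that [psi] kills 1. *)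
case: e hm hmult hend nulls => [|e] hm hmult hend nulls.
  move=> h /hom0_const[c ->]; rewrite -[mpolyC 3 c]mulr1 mul_mpolyC scalarZ.
  by have := nulls 0%N 0%N erefl; rewrite !expr0 mulr1 => ->; rewrite mulr0.
have [psi1 psi1E] := descend (hom_lform _) (hom_lform _) (hom_lform _)
  (ddir_fa v) (ddir_fb v) (ddir_fw v) (span_abw v) nulls.
move: ul => /= /andP[vl ul].
suff k1 : kills psi1 e.
  by move=> h hh; rewrite psi1E // k1 //; apply: hom_ddir.
apply: (IH (v |: A)) => //.
- move=> x; rewrite !inE hA inE negb_or; case: eqP => [->|_] //=.
- by rewrite cardsU1 vA /= add1n addnS -addSn.
- move=> x y xy; rewrite !inE.
  have hxy := hmult _ _ xy.
  have thr : ddir (moment v) (chord x y) = 0 ->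
      mult psi1 e (chord x y) (m - (x \in A) - (y \in A)).-1.
    by move=> d0; apply: (mult_descend_through psi1E (hom_lform _) (ddir_fw v) (hom_lform _) d0 hxy).
  have [xv|xv] := eqVneq x v.
    have yv : (y == v) = false.
      by apply: contraNF (adj_irr v) => /eqP yv; rewrite -{1}xv -yv.
    apply: mult_le (thr _); last by rewrite ddir_chord xv subrr mul0r mpolyC0.
    by rewrite xv yv vA /= subn0 -[X in (_ <= X)%N]subn1 subnAC.
  have [yv|yv] := eqVneq y v.
    apply: mult_le (thr _); last by rewrite ddir_chord yv subrr mulr0 mpolyC0.
    by rewrite yv vA /= subn0 subn1.
  apply: (mult_descend_off psi1E _ (ddir_chord v x y)) => //; first exact: hom_lform.
  by rewrite mulf_neq0 // subr_eq0 (inj_eq s_inj) eq_sym.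
- by move=> e' psi' ee hp; apply: hend => //=; rewrite ee addnS.
Qed.

(* Each round of [#|W|] divisions by the lines of the arrangement lowers the
   multiplicities by 2, as every point lies on two of the lines. *)
Lemma witness_kills d m (psi : {scalar mp}) : degree_bound #|W| d m ->
  (forall v u, adj v u -> mult psi d (chord v u) m) -> kills psi d.
Proof.
elim/ltn_ind: d m psi => d IH m psi hb hm.
apply: (round (m := m) (l := enum W) (A := finset.set0)) => //.
- exact: enum_uniq.
- by move=> v; rewrite inE mem_enum.
- by rewrite cards0; apply: degree_bound_lt hb.
- by move=> v u vu; rewrite !inE !subn0; apply: hm.
move=> e psi'; rewrite -cardE => de hm'; move: hb; rewrite {1}de.
by case/degree_bound_step; rewrite -de => ed hb; apply: IH hm'.
Qed.

End Witness.

(** * Monomials and edge ideals *)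

Section Monomials.

Definition monoms (d : nat) : seq (multinom 3) :=
  [seq s2m (tval t) | t <- enum (mpoly.basis 3 d)].

Definition Mon (d : nat) : finType := seq_sub (monoms d).

Lemma mem_monoms d m : (m \in monoms d) = (mdeg m == d).
Proof. by rewrite basis_cover. Qed.

Lemma mdeg_Mon d (m : Mon d) : mdeg (val m) = d.
Proof. by apply/eqP; rewrite -mem_monoms; apply: valP. Qed.

Lemma card_Mon d : #|Mon d| = 'C(d + 2, 2).
Proof. by rewrite card_seq_sub ?uniq_basis // size_basis addnC -bin_sub ?leq_addl // addnK. Qed.

Variable R : realFieldType.
Local Notation mp := (mpoly 3 R).

Definition monX d (m : Mon d) : mp := mpolyX R (val m).

Lemma hom_monX d (m : Mon d) : monX m \is hom R d.
Proof. by rewrite dhomogX; apply/eqP; apply: mdeg_Mon. Qed.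

Lemma hom_expand d (h : mp) : h \is hom R d ->
  h = \sum_(m : Mon d) mcoeff (val m) h *: monX m.
Proof.
move=> hh; apply/mpolyP => m; rewrite linear_sum /=.
have [md|md] := boolP (m \in monoms d).
  rewrite (bigD1 (SeqSub md)) //= mcoeffZ mcoeffX eqxx mulr1 big1 ?addr0 // => k nk.
  rewrite mcoeffZ mcoeffX; case: eqP => [e|_]; last by rewrite mulr0.
  by case/eqP: nk; apply/val_inj.
rewrite big1 => [|k _].
  by apply: (dhomog_nemf_coeff hh); rewrite -mem_monoms.
rewrite mcoeffZ mcoeffX; case: eqP => [e|_]; last by rewrite mulr0.
by case/negP: md; rewrite -e; apply: valP.
Qed.

Lemma mcoeff_sum_monX d (c : Mon d -> R) (a : Mon d) :
  mcoeff (val a) (\sum_b c b *: monX b) = c a.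
Proof.
rewrite linear_sum (bigD1 a) //= mcoeffZ mcoeffX eqxx mulr1 big1 ?addr0 // => b ba.
rewrite mcoeffZ mcoeffX; case: eqP => [e|_]; last by rewrite mulr0.
by case/eqP: ba; apply/val_inj.
Qed.

Definition functional d (y : Mon d -> R) (h : mp) : R :=
  \sum_m y m * mcoeff (val m) h.

Lemma functional_is_linear d (y : Mon d -> R) : linear_for *%R (functional y).
Proof.
move=> c f g; rewrite /functional mulr_sumr -big_split /=; apply: eq_bigr => m _.
by rewrite mcoeffD mcoeffZ mulrDr mulrCA.
Qed.
HB.instance Definition _ d (y : Mon d -> R) :=
  GRing.isLinear.Build R mp R _ (functional y) (functional_is_linear y).

Lemma functionalX d (y : Mon d -> R) m : functional y (monX m) = y m.
Proof.
rewrite /functional (bigD1 m) //= mcoeffX eqxx mulr1 big1 ?addr0 // => k nk.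
rewrite mcoeffX; case: eqP => [e|_]; last by rewrite mulr0.
by case/eqP: nk; apply/val_inj.
Qed.

Lemma kills_hom_ideal e (psi : {scalar mp}) (g : mp) :
  (forall m : Mon e, psi (g * monX m) = 0) ->
  forall h, h \is hom R e -> psi (g * h) = 0.
Proof.
move=> hg h /hom_expand ->; rewrite mulr_sumr linear_sum big1 //= => m _.
by rewrite -scalerAr scalarZ hg mulr0.
Qed.

End Monomials.

Section Cross.
Variable S : comNzRingType.

Definition cross (p q : 'rV[S]_3) : 'rV[S]_3 :=
  row3 (p 0 i1 * q 0 i2 - p 0 i2 * q 0 i1)
       (p 0 i2 * q 0 i0 - p 0 i0 * q 0 i2)
       (p 0 i0 * q 0 i1 - p 0 i1 * q 0 i0).

End Cross.

Lemma map_lform (S S' : comNzRingType) (f : {rmorphism S -> S'}) (c : 'rV[S]_3) :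
  map_mpoly f (lform c) = lform (map_mx f c).
Proof.
rewrite /lform rmorph_sum /=; apply: eq_bigr => i _.
by rewrite map_mpolyZ map_mpolyX mxE.
Qed.

Lemma map_cross (S S' : comNzRingType) (f : {rmorphism S -> S'}) (p q : 'rV[S]_3) :
  map_mx f (cross p q) = cross (map_mx f p) (map_mx f q).
Proof. by apply: row3_eq; rewrite !mxE /= rmorphB !rmorphM. Qed.

Section EdgeIdeal.
Variable R : realFieldType.
Local Notation mp := (mpoly 3 R).

(** For nonzero [p] the forms vanishing at [p] are spanned by [a] and [b], and [w] completes them to
    a basis. The last case also covers [p = 0], where every [cross p q] is zero. *)
Lemma edge_frame (p : 'rV[R]_3) : exists a b w : mp,
  (forall i, exists c : R * R * R, vx R i = c.1.1 *: a + c.1.2 *: b + c.2 *: w) /\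
  (forall q, exists c : R * R, lform (cross p q) = c.1 *: a + c.2 *: b).
Proof.
have [p00|p00] := eqVneq (p 0 i0) 0; last first.
  exists (lform (row3 (- p 0 i1) (p 0 i0) 0)), (lform (row3 (- p 0 i2) 0 (p 0 i0))),
    (lform (row3 1 0 0)); split=> [i|q].
    exists ((i == i1)%:R / p 0 i0, (i == i2)%:R / p 0 i0, p 0 i / p 0 i0) => /=.
    rewrite -lform_delta -!linearZ -!linearD; congr lform.
    by case: (ord3P i) => ->; apply: row3_eq; rewrite !mxE /=; field.
  exists ((p 0 i2 * q 0 i0 - p 0 i0 * q 0 i2) / p 0 i0,
          (p 0 i0 * q 0 i1 - p 0 i1 * q 0 i0) / p 0 i0) => /=.
  rewrite -!linearZ -!linearD; congr lform.
  by apply: row3_eq; rewrite !mxE /=; field.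
have [p10|p10] := eqVneq (p 0 i1) 0; last first.
  exists (lform (row3 (p 0 i1) 0 0)), (lform (row3 0 (- p 0 i2) (p 0 i1))),
    (lform (row3 0 1 0)); split=> [i|q].
    exists ((i == i0)%:R / p 0 i1, (i == i2)%:R / p 0 i1, p 0 i / p 0 i1) => /=.
    rewrite -lform_delta -!linearZ -!linearD; congr lform.
    by case: (ord3P i) => ->; apply: row3_eq; rewrite !mxE /= ?p00; field.
  exists ((p 0 i1 * q 0 i2 - p 0 i2 * q 0 i1) / p 0 i1, - q 0 i0) => /=.
  rewrite -!linearZ -!linearD; congr lform.
  by apply: row3_eq; rewrite !mxE /= ?p00; field.
exists (vx R i0), (vx R i1), (vx R i2); split=> [i|q].
  exists ((i == i0)%:R, (i == i1)%:R, (i == i2)%:R) => /=.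
  rewrite -!lform_delta -!linearZ -!linearD; congr lform.
  by case: (ord3P i) => ->; apply: row3_eq; rewrite !mxE /=; ring.
exists (- (p 0 i2 * q 0 i1), p 0 i2 * q 0 i0) => /=.
rewrite -!lform_delta -!linearZ -!linearD; congr lform.
by apply: row3_eq; rewrite !mxE /= ?p00 ?p10; ring.
Qed.

(** The generators are sorted by their degree [J] in [a] and [b]. For each [J] the list takes the
    [size ls * (J - r)] products of the powers with binary monomials if they are fewer than [J + 1],
    and otherwise all binary monomials of degree [J]. In the second case the list may span more than
    the ideal, which only strengthens the condition on [psi]; hence a bound on the dimension, not
    its value. *)
Lemma edge_generators (p : 'rV[R]_3) (ls : seq mp) (r d : nat) : (r < d)%N ->
  (forall l, l \in ls -> exists c q, l = c *: lform (cross p q)) ->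
  exists2 gs : seq mp, size gs = edge_count r d (size ls) &
    forall psi : {scalar mp}, (forall g, g \in gs -> psi g = 0) ->
    forall l, l \in ls -> forall h, h \is hom R (d - r.+1) -> psi (l ^+ r.+1 * h) = 0.
Proof.
move=> rd hls; have [a [b [w [hx hc]]]] := edge_frame p.
pose mon i j k : mp := a ^+ i * b ^+ j * w ^+ k.
pose few j := (size ls * (j - r) < j.+1)%N.
pose g j := if few j
  then [seq l ^+ r.+1 * mon i (j - r.+1 - i)%N (d - j)%N | l <- ls, i <- iota 0 (j - r)]
  else [seq mon i (j - i)%N (d - j)%N | i <- iota 0 j.+1].
exists (flatten [seq g j | j <- iota 0 d.+1]).
  rewrite size_flatten /shape -map_comp sumnE big_map -[iota 0 d.+1]/(index_iota 0 d.+1).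
  rewrite big_mkord; apply: eq_bigr => j _; rewrite /= /g /few.
  have [h|h] := ltnP (size ls * (j - r)) j.+1.
    by rewrite size_allpairs size_iota.
  by rewrite size_map size_iota.
move=> psi hpsi l lls; apply: (span_forms hx).
  by split=> [|c f h hf hh]; rewrite ?mulr0 ?linear0 // mulrDr -scalerAr linearP /= hf hh mulr0 addr0.
move=> i j k ijk; pose J := (i + j + r.+1)%N.
have Jd : (J < d.+1)%N by rewrite /J; lia.
have gJ f : f \in g J -> psi f = 0.
  move=> fg; apply: hpsi; apply/flattenP; exists (g J) => //.
  by apply/mapP; exists J => //; rewrite mem_iota.
have kJ : k = (d - J)%N by rewrite /J; lia.
rewrite -/(mon i j k) kJ; have [fJ|fJ] := boolP (few J).
  apply: gJ; rewrite /g fJ; apply/allpairsP; exists (l, i) => /=; split=> //.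
    by rewrite mem_iota /J; lia.
  by congr (_ * mon _ _ _); rewrite /J; lia.
have [c [q ->]] := hls _ lls; have [[c1 c2] /= ->] := hc q.
rewrite exprZn -scalerAl scalarZ exprDn mulr_suml linear_sum big1 ?mulr0 //= => e _.
rewrite mulrnAl linearMn /= !exprZn -scalerAl -scalerAr -!scalerAl !scalarZ.
have -> : a ^+ (r.+1 - e) * b ^+ e * mon i j (d - J)%N =
    mon (r.+1 - e + i)%N (J - (r.+1 - e + i))%N (d - J)%N.
  have -> : (J - (r.+1 - e + i) = e + j)%N by rewrite /J; have := ltn_ord e; lia.
  by rewrite /mon !exprD; ring.
rewrite gJ ?mulr0 ?mul0rn // /g (negbTE fJ); apply/mapP; exists (r.+1 - e + i)%N => //.
by rewrite mem_iota /J; lia.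
Qed.

End EdgeIdeal.

(** * The kernel of the algebraic spline matrix *)

Lemma sum_pair (S : nmodType) (I J : finType) (f : I * J -> S) :
  \sum_p f p = \sum_i \sum_j f (i, j).
Proof. by rewrite pair_bigA; apply: eq_bigr => -[]. Qed.

Lemma row_free_functional (F : fieldType) (I J : finType) (G : I -> J -> F) :
  (\rank (mxf G) = #|I|)%N <->
  (forall y, (forall j, \sum_i y i * G i j = 0) -> forall i, y i = 0).
Proof.
split=> [h y hy|h].
  apply/rowf_eq0; apply: (row_free_inj (introT eqP h)).
  by rewrite mul0mx rowf_mul; apply/rowf_eq0.
apply/eqP; rewrite -/(row_free _) -kermx_eq0; apply/rowV0P => v /sub_kermxP.
rewrite -[v]rowf_enum_rank rowf_mul => /rowf_eq0 hv.
by apply/rowf_eq0; apply: h.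
Qed.

(* [T3], [T2] and [W] index the tetrahedra, interior triangles and interior edges
   of the star; [ta t], [tb t] are the two edges of the triangle [t] and [sp t],
   [sm t] the tetrahedra on its two sides. *)
Section AlgebraicSplines.
Variables (R : realFieldType) (T3 T2 W : finType).
Variables (ta tb : T2 -> W) (sp sm : T2 -> T3) (p0 : W -> 'rV[R]_3).
Variables (r d : nat).

Local Notation mp := (mpoly 3 R).

(** The incidences from tetrahedra to triangles and from triangles to edges compose to zero. Thus
    the differences [psi (ta t) - psi (tb t)], summed over the triangles, cancel on the differences
    [f (sp t) - f (sm t)]. *)
Hypothesis closed : forall (s : T3) (v : W),
  \sum_t ((sp t == s)%:R - (sm t == s)%:R) * ((ta t == v)%:R - (tb t == v)%:R) = 0 :> R.
Hypothesis connected : forall y : W -> R,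
  (forall t, y (ta t) = y (tb t)) -> forall v w, y v = y w.
Hypothesis ta_neq_tb : forall t, ta t != tb t.

Definition adjacent : rel W := fun v u =>
  [exists t, ((ta t == v) && (tb t == u)) || ((ta t == u) && (tb t == v))].

Hypothesis nbr3 : forall v, exists u : W * W * W,
  [/\ adjacent v u.1.1, adjacent v u.1.2 & adjacent v u.2] /\
  uniq [:: v; u.1.1; u.1.2; u.2].
Hypothesis rd : (r < d)%N.
Hypothesis bound : degree_bound #|W| d (d - r).

Definition valency (v : W) : nat := #|[set t | (ta t == v) || (tb t == v)]%SET|.

Let s (v : W) : R := (enum_rank v)%:R.

Let s_inj : injective s.
Proof.
by move=> v u /eqP; rewrite eqr_nat => /eqP/val_inj/enum_rank_inj.
Qed.

(** A segment from the given position at [t = 0] to a point of the conic at [t = 1]. Replacing [t]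
    by an indeterminate in [ppt] gives matrices with polynomial entries, to which
    [rank_semicontinuous] applies. *)
Let pt (t : R) (v : W) : 'rV[R]_3 := p0 v + t *: (moment s v - p0 v).

Let ppt (v : W) : 'rV[{poly R}]_3 :=
  map_mx polyC (p0 v) + 'X *: map_mx polyC (moment s v - p0 v).

Let ppt_eval t v : map_mx (horner_eval t) (ppt v) = pt t v.
Proof. by apply/rowP => i; rewrite !mxE /horner_eval !hornerE. Qed.

Let ell (p : W -> 'rV[R]_3) (t : T2) : mp := lform (cross (p (ta t)) (p (tb t))).

Let cf (p : W -> 'rV[R]_3) t (a : Mon (d - r.+1)) (b : Mon d) : R :=
  mcoeff (val b) (ell p t ^+ r.+1 * monX R a).

Let pcf t (a : Mon (d - r.+1)) (b : Mon d) : {poly R} :=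
  mcoeff (val b) (lform (cross (ppt (ta t)) (ppt (tb t))) ^+ r.+1 * mpolyX {poly R} (val a)).

Let pcf_eval x t a b : (pcf t a b).[x] = cf (pt x) t a b.
Proof.
rewrite -[LHS]/(horner_eval x _) /pcf -mcoeff_map_mpoly rmorphM rmorphXn /=.
by rewrite map_lform map_cross !ppt_eval map_mpolyX.
Qed.

Local Notation dom := (T3 * Mon d + T2 * Mon (d - r.+1))%type.

(* Matrix of [(f, h) |-> f (sp t) - f (sm t) - ell t ^+ r.+1 * h t]; its kernel is
   the space of splines. *)
Let A (p : W -> 'rV[R]_3) (i : dom) (j : T2 * Mon d) : R :=
  match i with
  | inl (s, a) => ((sp j.1 == s)%:R - (sm j.1 == s)%:R) * (a == j.2)%:R
  | inr (t, a) => - (t == j.1)%:R * cf p j.1 a j.2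
  end.

Let pA (i : dom) (j : T2 * Mon d) : {poly R} :=
  match i with
  | inl (s, a) => (((sp j.1 == s)%:R - (sm j.1 == s)%:R) * (a == j.2)%:R)%:P
  | inr (t, a) => (- (t == j.1)%:R)%:P * pcf j.1 a j.2
  end.

Let pA_eval x : evalmx x (mxf pA) = mxf (A (pt x)).
Proof.
apply/matrixP => i j; rewrite !mxE /horner_eval /pA /A.
by case: (enum_val i) => -[u a]; rewrite ?hornerM ?hornerC ?pcf_eval.
Qed.

(* Its rows are independent when the ideal of the central vertex contains all
   forms of degree [d]. *)
Let G (p : W -> 'rV[R]_3) (b : Mon d) (j : T2 * Mon (d - r.+1)) : R := cf p j.1 j.2 b.

Let pG (b : Mon d) (j : T2 * Mon (d - r.+1)) : {poly R} := pcf j.1 j.2 b.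

Let pG_eval x : evalmx x (mxf pG) = mxf (G (pt x)).
Proof. by apply/matrixP => i j; rewrite !mxE /horner_eval pcf_eval. Qed.

Let cfE p t a (y : Mon d -> R) :
  \sum_b y b * cf p t a b = functional y (ell p t ^+ r.+1 * monX R a).
Proof. by []. Qed.

Let pt0 v : pt 0 v = p0 v.
Proof. by rewrite /pt scale0r addr0. Qed.

Let pt1 v : pt 1 v = moment s v.
Proof. by rewrite /pt scale1r addrC subrK. Qed.

Let chord_sym v u : chord s v u = chord s u v.
Proof. by rewrite /chord mulrC [s u + s v]addrC. Qed.

Let cross_moment v u :
  lform (cross (moment s v) (moment s u)) = (s u - s v) *: chord s v u.
Proof.
by rewrite /chord -linearZ; congr lform; apply: row3_eq; rewrite !mxE /=; ring.
Qed.

Let adjacent_irr v : ~~ adjacent v v.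
Proof.
apply/existsP => -[t /orP[]/andP[/eqP h1 /eqP h2]];
by have := ta_neq_tb t; rewrite h1 h2 eqxx.
Qed.

(** A functional orthogonal to all columns kills the multiples of [chord ^+ r.+1]. Seen on the dual
    plane it vanishes to order [d - r] at every chord, since [k < d - r] means [d - k >= r + 1];
    then [witness_kills] applies. *)
Let G_full_at1 : \rank (mxf (G (pt 1))) = #|Mon d|.
Proof.
apply/row_free_functional => y hy.
have kill t h : h \is hom R (d - r.+1) ->
    functional y (chord s (ta t) (tb t) ^+ r.+1 * h) = 0.
  apply: kills_hom_ideal => m; have := hy (t, m); rewrite /G /= cfE /ell !pt1.
  rewrite cross_moment exprZn -scalerAl linearZ /= => /eqP.
  rewrite mulf_eq0 expf_eq0 /= subr_eq0 (inj_eq s_inj) [_ == ta t]eq_sym.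
  by rewrite (negbTE (ta_neq_tb t)) => /eqP.
have mlt v u : adjacent v u -> mult (functional y) d (chord s v u) (d - r).
  move=> /existsP[t vu] k h kdr kd hh.
  have -> : chord s v u = chord s (ta t) (tb t).
    by case/orP: vu => /andP[/eqP -> /eqP ->]; rewrite // chord_sym.
  have -> : (d - k = r.+1 + (d - k - r.+1))%N by lia.
  rewrite exprD -mulrA; apply: kill; apply: (@hom_eq _ (d - k - r.+1 + k)); first by lia.
  by apply: homM => //; apply/homX1/hom_lform.
move=> m; rewrite -[y m]functionalX.
by apply: (witness_kills s_inj nbr3 adjacent_irr bound mlt); apply: hom_monX.
Qed.

Let rank_bound_at x : \rank (mxf (G (pt x))) = #|Mon d| ->
  (\rank (mxf (A (pt x))) + #|W| * #|Mon d| <=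
     #|T2| * #|Mon d| + \sum_v edge_count r d (valency v))%N.
Proof.
move=> /row_free_functional hG.
pose ls v := [seq ell (pt x) t | t <- enum [set t | (ta t == v) || (tb t == v)]%SET].
have hls v l : l \in ls v -> exists c q, l = c *: lform (cross (pt x v) q).
  case/mapP => t; rewrite mem_enum inE => /orP[]/eqP e ->.
    by exists 1, (pt x (tb t)); rewrite scale1r -e.
  exists (-1), (pt x (ta t)); rewrite /ell e -linearZ; congr lform.
  by apply: row3_eq; rewrite !mxE /=; ring.
have gen v := edge_generators rd (hls v).
pose gs v := projT1 (cid2 (gen v)).
have gs_size v : size (gs v) = edge_count r d (valency v).
  by rewrite /gs; case: cid2 => /= g -> _; rewrite size_map -cardE.
have gs_kill v (psi : {scalar mp}) : (forall g, g \in gs v -> psi g = 0) ->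
    forall l, l \in ls v -> forall h, h \is hom R (d - r.+1) -> psi (l ^+ r.+1 * h) = 0.
  by rewrite /gs; case: cid2 => /= g _; apply.
(* There is one condition for each edge and each generator of its ideal: [C] evaluates the
   functional of the edge on the generator, and [D] takes differences of functionals over
   triangles. *)
pose Q : finType := {v : W & 'I_(size (gs v))}.
pose C (q1 : W * Mon d) (q : Q) : R :=
  if q1.1 == tag q then mcoeff (val q1.2) (nth 0 (gs (tag q)) (tagged q)) else 0.
pose D (q1 : W * Mon d) (j : T2 * Mon d) : R :=
  ((ta j.1 == q1.1)%:R - (tb j.1 == q1.1)%:R) * (q1.2 == j.2)%:R.
have -> : (\sum_v edge_count r d (valency v) = #|Q|)%N.
  rewrite card_tagged sumnE big_map big_enum /=.
  by apply: eq_bigr => v _; rewrite card_ord gs_size.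
have DE y j : \sum_q1 y q1 * D q1 j = y (ta j.1, j.2) - y (tb j.1, j.2).
  have e v : \sum_(q1 : W * Mon d) y q1 * ((v == q1.1)%:R * (q1.2 == j.2)%:R) = y (v, j.2).
    rewrite (bigD1 (v, j.2)) //= !eqxx !mulr1 big1 ?addr0 // => -[u b] /=.
    rewrite xpair_eqE [v == u]eq_sym.
    by case: (u == v); case: (b == j.2); rewrite ?mulr0 ?mul0r ?mulr0 //.
  rewrite -!e -sumrB; apply: eq_bigr => q1 _.
  by rewrite /D mulrBl mulrBr.
have psi_kill y : (forall q, \sum_q1 y q1 * C q1 q = 0) -> forall v t,
    (ta t == v) || (tb t == v) -> forall h, h \is hom R (d - r.+1) ->
    functional (fun b => y (v, b)) (ell (pt x) t ^+ r.+1 * h) = 0.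
  move=> hy v t tv; apply: (gs_kill v); last first.
    by apply/mapP; exists t => //; rewrite mem_enum inE.
  move=> g /(nthP 0)[k kg <-].
  have := hy (Tagged (fun v => 'I_(size (gs v))) (Ordinal kg)).
  rewrite sum_pair /= (bigD1 v) //= [X in _ + X]big1 ?addr0 => [h|u uv].
    by rewrite -[RHS]h; apply: eq_bigr => b _; rewrite /C eqxx.
  by apply: big1 => b _; rewrite /C /= (negbTE uv) mulr0.
rewrite -!card_prod; apply: (rank_le_of_functionals (D := D) (C := C)).
  (* On the rows of [f] the pairing vanishes by [closed]; on the rows of [h] it vanishes because the
     functionals of both ends of [t] kill the multiples of [ell ^+ r.+1]. *)
  move=> y hy [[u a]|[t a]].
    under eq_bigr => j _ do rewrite DE /=.
    rewrite sum_pair /= exchange_big /= (bigD1 a) //= [X in _ + X]big1 ?addr0; last first.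
      by move=> b ba; apply: big1 => t _; rewrite [a == b]eq_sym (negbTE ba) !mulr0.
    under eq_bigr => t _ do rewrite eqxx mulr1.
    transitivity (\sum_v y (v, a) * \sum_t ((sp t == u)%:R - (sm t == u)%:R) *
       ((ta t == v)%:R - (tb t == v)%:R)); last first.
      by apply: big1 => v _; rewrite closed mulr0.
    under [RHS]eq_bigr => v _ do rewrite mulr_sumr.
    rewrite exchange_big /=; apply: eq_bigr => t _.
    have e v : y (v, a) = \sum_w y (w, a) * (v == w)%:R.
      rewrite (bigD1 v) //= eqxx mulr1 big1 ?addr0 // => w wv.
      by rewrite eq_sym (negbTE wv) mulr0.
    rewrite (e (ta t)) (e (tb t)) -sumrB mulr_suml; apply: eq_bigr => w _.
    by rewrite -mulrBr mulrA [RHS]mulrAC -mulrA [RHS]mulrC; ring.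
  under eq_bigr => j _ do rewrite DE /=.
  rewrite sum_pair /= (bigD1 t) //= [X in _ + X]big1 ?addr0; last first.
    move=> t' t't; apply: big1 => b _.
    by rewrite eq_sym (negbTE t't) oppr0 mul0r mulr0.
  transitivity (- (functional (fun b => y (ta t, b)) (ell (pt x) t ^+ r.+1 * monX R a)
     - functional (fun b => y (tb t, b)) (ell (pt x) t ^+ r.+1 * monX R a))).
    rewrite -!cfE -sumrB -sumrN; apply: eq_bigr => b _.
    by rewrite eqxx /= mulN1r; ring.
  by rewrite !(psi_kill y hy) ?eqxx ?orbT ?subrr ?oppr0 //; apply: hom_monX.
(* Zero differences make all functionals equal by connectedness. The common one kills the ideals of
   all edges, and the full rank of [G] forces it to be zero. *)
move=> y hy hD [v b].
have yc u w c : y (u, c) = y (w, c).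
  apply: (connected (y := fun u => y (u, c))) => t.
  by apply/eqP; rewrite -subr_eq0; apply/eqP; rewrite -[RHS](hD (t, c)) DE.
apply: (hG (fun c => y (v, c))) => -[t a].
rewrite /G /= cfE -[RHS](psi_kill y hy (ta t) t _ _ (hom_monX R a)) ?eqxx //.
by congr (functional _ _); apply/funext => c; apply: yc.
Qed.

(** Semicontinuity is used twice: [G] keeps its full rank from [t = 1], and [A] has at least its
    rank at [t = 0], each outside finitely many [t]. A common good [t] carries the bound back to the
    given positions. *)
Let rank_bound_at0 : (\rank (mxf (A (pt 0))) + #|W| * #|Mon d| <=
     #|T2| * #|Mon d| + \sum_v edge_count r d (valency v))%N.
Proof.
have [P P0 hP] := rank_semicontinuous (mxf pA) 0.
have [P' P'0 hP'] := rank_semicontinuous (mxf pG) 1.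
have [x] := poly_nonroot (mulf_neq0 P0 P'0).
rewrite hornerM mulf_eq0 negb_or => /andP[/hP rA /hP' rG].
have {}rG : \rank (mxf (G (pt x))) = #|Mon d|.
  have e1 := etrans (congr1 (fun M => \rank M) (pG_eval 1)) G_full_at1.
  have ex := congr1 (fun M => \rank M) (pG_eval x).
  apply/eqP; rewrite eqn_leq rank_leq_row /=.
  exact: leq_trans (eq_leq (esym e1)) (leq_trans rG (eq_leq ex)).
have a0 := congr1 (fun M => \rank M) (pA_eval 0).
have ax := congr1 (fun M => \rank M) (pA_eval x).
apply: leq_trans (rank_bound_at rG); rewrite leq_add2r.
exact: leq_trans (eq_leq (esym a0)) (leq_trans rA (eq_leq ax)).
Qed.

Let count_solutions k : (k <= #|{: dom}|)%N ->
  (k + #|W| * #|Mon d| <= #|T2| * #|Mon d| + \sum_v edge_count r d (valency v))%N ->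
  (#|T3| * 'C(d + 2, 2) + #|T2| * 'C(d + 1 - r, 2) + #|W| * 'C(d + 2, 2) <=
     #|{: dom}| - k + #|T2| * 'C(d + 2, 2) + \sum_v edge_count r d (valency v))%N.
Proof.
rewrite card_sum !card_prod !card_Mon.
have -> : (d - r.+1 + 2 = d + 1 - r)%N by lia.
lia.
Qed.

(** The family comes from a basis of the kernel at the given positions, cofactors [h] included. The
    count is written additively, so that no truncated subtraction occurs. *)
Lemma algebraic_spline_family : exists n : nat,
  (#|T3| * 'C(d + 2, 2) + #|T2| * 'C(d + 1 - r, 2) + #|W| * 'C(d + 2, 2) <=
     n + #|T2| * 'C(d + 2, 2) + \sum_v edge_count r d (valency v))%N /\
  exists (f : 'I_n -> T3 -> mp) (h : 'I_n -> T2 -> mp),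
  [/\ forall k u, f k u \is hom R d,
      forall k t, f k (sp t) - f k (sm t) =
        lform (cross (p0 (ta t)) (p0 (tb t))) ^+ r.+1 * h k t
    & forall c : 'I_n -> R, (forall u, \sum_k c k *: f k u = 0) ->
        (forall t, \sum_k c k *: h k t = 0) -> forall k, c k = 0].
Proof.
have [B [BA iB]] := left_kernel_family (A (pt 0)).
exists (#|{: dom}| - \rank (mxf (A (pt 0))))%N; split.
  exact: count_solutions (rank_leq_row _) rank_bound_at0.
exists (fun k u => \sum_a B k (inl (u, a)) *: monX R a).
exists (fun k t => \sum_a B k (inr (t, a)) *: monX R a); split.
- by move=> k u; apply: rpred_sum => a _; apply/rpredZ/hom_monX.
- move=> k t; apply/mpolyP => m.
  have hl : lform (cross (p0 (ta t)) (p0 (tb t))) ^+ r.+1 *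
      (\sum_a B k (inr (t, a)) *: monX R a) \is hom R d.
    apply: (@hom_eq _ (r.+1 + (d - r.+1))); first by lia.
    apply: homM; first by apply/homX1/hom_lform.
    by apply: rpred_sum => a _; apply/rpredZ/hom_monX.
  have hf u : \sum_a B k (inl (u, a)) *: monX R a \is hom R d.
    by apply: rpred_sum => a _; apply/rpredZ/hom_monX.
  have [md|md] := boolP (m \in monoms d); last first.
    rewrite (dhomog_nemf_coeff hl) ?(dhomog_nemf_coeff (rpredB (hf _) (hf _))) //;
    by rewrite -mem_monoms.
  have := BA k (t, SeqSub md); rewrite big_sumType /=.
  have e1 u : mcoeff m (\sum_a B k (inl (u, a)) *: monX R a) = B k (inl (u, SeqSub md)).
    exact: (mcoeff_sum_monX _ (SeqSub md)).
  rewrite mcoeffB !e1 mulr_sumr linear_sum /=.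
  have -> : \sum_(i : T3 * Mon d) B k (inl i) * A (pt 0) (inl i) (t, SeqSub md) =
      B k (inl (sp t, SeqSub md)) - B k (inl (sm t, SeqSub md)).
    rewrite sum_pair exchange_big /= (bigD1 (SeqSub md)) //=.
    rewrite [X in _ + X]big1 ?addr0; last first.
      by move=> b bm; apply: big1 => u _; rewrite (negbTE bm) !mulr0.
    have e v : B k (inl (v, SeqSub md)) = \sum_u B k (inl (u, SeqSub md)) * (v == u)%:R.
      rewrite (bigD1 v) //= eqxx mulr1 big1 ?addr0 // => w wv.
      by rewrite eq_sym (negbTE wv) mulr0.
    rewrite (e (sp t)) (e (sm t)) -sumrB; apply: eq_bigr => u _.
    by rewrite eqxx mulr1 mulrBr.
  move/eqP; rewrite addr_eq0 => /eqP ->.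
  rewrite sum_pair /= (bigD1 t) //= [X in _ + X]big1 ?addr0; last first.
    by move=> u ut; apply: big1 => a _; rewrite (negbTE ut) oppr0 mul0r mulr0.
  rewrite -sumrN; apply: eq_bigr => a _.
  rewrite eqxx /= mulN1r mulrN opprK -scalerAr mcoeffZ /cf /ell.
  by rewrite !pt0.
move=> c hf hh; apply: iB => -[[u a]|[t a]].
  have := congr1 (mcoeff (val a)) (hf u); rewrite mcoeff0 raddf_sum /= => h.
  by rewrite -[RHS]h; apply: eq_bigr => k _; rewrite mcoeffZ mcoeff_sum_monX.
have := congr1 (mcoeff (val a)) (hh t); rewrite mcoeff0 raddf_sum /= => h.
by rewrite -[RHS]h; apply: eq_bigr => k _; rewrite mcoeffZ mcoeff_sum_monX.
Qed.

End AlgebraicSplines.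

(** * The fan of a closed vertex star *)

Section SmallParameter.
Variable R : realFieldType.

Lemma small_perturbation (I : finType) (a b : I -> R) :
  exists2 e : R, 0 < e & forall i, 0 < a i -> 0 < a i + e * b i.
Proof.
suff [e e0 he] : exists2 e : R, 0 < e & forall e', 0 < e' -> e' <= e ->
    forall i, i \in enum I -> 0 < a i -> 0 < a i + e' * b i.
  by exists e => // i; apply: he => //; rewrite ?lexx // mem_enum.
elim: (enum I) => [|i l [e e0 IH]]; first by exists 1.
have [ai|ai] := ltP 0 (a i); last first.
  exists e => // e' e'0 e'e j; rewrite inE => /orP[/eqP ->|jl]; last exact: IH.
  by rewrite ltNge ai.
have d0 : 0 < a i / (1 + `|b i|) by rewrite divr_gt0 // ltr_pwDl.
exists (Num.min e (a i / (1 + `|b i|))); first by rewrite lt_min e0.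
move=> e' e'0; rewrite le_min => /andP[e'e e'd] j; rewrite inE.
move=> /orP[/eqP -> _|jl]; last exact: IH.
have : e' * (1 + `|b i|) <= a i by rewrite -ler_pdivlMr // ltr_pwDl.
have : - (e' * `|b i|) <= e' * b i.
  by rewrite -mulrN ler_pM2l // lerNl -normrN ler_norm.
lra.
Qed.

(** The point is sought on the moment curve [(1, t, t^2)], where every nonzero linear form becomes a
    nonzero polynomial in [t]; the product of these polynomials has a nonroot. *)
Lemma generic_point (I : finType) (L : I -> 'cV[R]_3) :
  (forall i, L i != 0) -> exists u : 'rV[R]_3, forall i, (u *m L i) 0 0 != 0.
Proof.
move=> L0.
pose q i : {poly R} := \poly_(k < 3) L i (inord k) 0.
have q0 i : q i != 0.
  apply: contra (L0 i) => /eqP qi; apply/eqP/matrixP => k j; rewrite ord1 mxE.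
  have : (q i)`_k = 0 by rewrite qi coef0.
  by rewrite coef_poly ltn_ord inord_val.
have P0 : \prod_i q i != 0 by apply/prodf_neq0 => i _.
have [t ht] := poly_nonroot P0.
exists (\row_k t ^+ k) => i.
move: ht; rewrite horner_prod => /prodf_neq0/(_ i isT).
rewrite horner_poly mxE; congr (is_true (_ != _)); apply: eq_bigr => k _.
by rewrite mxE inord_val mulrC.
Qed.

End SmallParameter.

Section Triple.
Variable R : realFieldType.
Implicit Types a b x : 'rV[R]_3.

(** The determinant of [a], [b], [x]; its sign distinguishes the two sides of the plane through 0,
    [a] and [b]. *)
Definition triple a b x : R := \sum_i cross a b 0 i * x 0 i.

Lemma tripleE a b x : triple a b x =
  (a 0 i1 * b 0 i2 - a 0 i2 * b 0 i1) * x 0 i0 +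
  (a 0 i2 * b 0 i0 - a 0 i0 * b 0 i2) * x 0 i1 +
  (a 0 i0 * b 0 i1 - a 0 i1 * b 0 i0) * x 0 i2.
Proof. by rewrite /triple sum3 !mxE. Qed.

Lemma tripleC a b x : triple b a x = - triple a b x.
Proof. by rewrite !tripleE; ring. Qed.

Lemma triple_rot a b x : triple a x b = - triple a b x.
Proof. by rewrite !tripleE; ring. Qed.

Lemma triple_l a b : triple a b a = 0.
Proof. by rewrite tripleE; ring. Qed.

Lemma triple_r a b : triple a b b = 0.
Proof. by rewrite tripleE; ring. Qed.

Lemma triple0 a b : triple a b 0 = 0.
Proof. by rewrite tripleE !mxE; ring. Qed.

Lemma tripleD a b x y : triple a b (x + y) = triple a b x + triple a b y.
Proof. by rewrite !tripleE !mxE; ring. Qed.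

Lemma tripleZ a b c x : triple a b (c *: x) = c * triple a b x.
Proof. by rewrite !tripleE !mxE; ring. Qed.

Lemma triple_sum a b (I : finType) (P : pred I) (f : I -> 'rV[R]_3) :
  triple a b (\sum_(i | P i) f i) = \sum_(i | P i) triple a b (f i).
Proof.
by apply: (big_morph (triple a b)) => [x y|]; [apply: tripleD|apply: triple0].
Qed.

Lemma triple_cross_gt0 a b : cross a b != 0 -> 0 < triple a b (cross a b).
Proof.
move=> ab; rewrite lt_def sumr_ge0 ?andbT => [|i _]; last exact: sqr_ge0.
apply: contra ab => /eqP h; apply/eqP/rowP => i; rewrite [RHS]mxE.
have nn (j : 'I_3) : true -> 0 <= cross a b 0 j * cross a b 0 j by move=> _; apply: sqr_ge0.
have /eqP := @psumr_eq0P _ _ _ _ nn h i isT.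
by rewrite mulf_eq0 orbb => /eqP.
Qed.

End Triple.

Section Fan.
Variables (R : realType) (V : finType) (K : complex R V) (g : V).
Hypothesis hK : closed_vertex_star K g.
Implicit Types (s t : {set V}) (v w a b u : V) (x y : 'rV[R]_3).

Local Notation p := (pos K).
Local Notation tets := (tetrahedra K).

Lemma pos_center : p g = 0.
Proof. by case: hK => [[]]. Qed.

Lemma complexK : simplicial_complex K.
Proof. by case: hK => [[[]]]. Qed.

Lemma tet_face s : s \in tets -> s \in faces K.
Proof. by rewrite inE => /andP[]. Qed.

Lemma tet_card s : s \in tets -> #|s| = 4%N.
Proof. by rewrite inE => /andP[_ /eqP]. Qed.

Lemma tet_center s : s \in tets -> g \in s.
Proof. by case: hK => [[_ + _ _ _] _]; apply. Qed.

Lemma face_tet s : s \in faces K -> exists2 t, t \in tets & s \subset t.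
Proof. by case: hK => [[[_ +] _ _ _ _] _]; apply. Qed.

Lemma sub_face s t : t \in faces K -> s \subset t -> s != finset.set0 -> s \in faces K.
Proof. by move=> tK st s0; case: complexK => _ h _ _; apply: h tK st s0. Qed.

Lemma tet_card_link s : s \in tets -> #|s :\ g| = 3%N.
Proof. by move=> sT; have := tet_card sT; rewrite (cardsD1 g) tet_center // => -[]. Qed.

(** As [g] sits at the origin, giving it minus the sum of the other coefficients turns a linear
    relation into an affine one. *)
Lemma tet_independent s (c : V -> R) : s \in tets ->
  \sum_(v in s :\ g) c v *: p v = 0 -> forall v, v \in s :\ g -> c v = 0.
Proof.
move=> sT h v /setD1P[vg vs]; case: complexK => _ _ aff _.
pose c' u := if u == g then - \sum_(w in s :\ g) c w else c u.
have := aff _ (tet_face sT) c'.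
have e1 : \sum_(u in s) c' u = 0.
  rewrite (big_setD1 g) ?tet_center //= /c' eqxx addrC; apply/eqP.
  rewrite subr_eq0; apply/eqP; apply: eq_bigr => u; rewrite !inE => /andP[/negbTE ->].
  by [].
have e2 : \sum_(u in s) c' u *: p u = 0.
  rewrite (big_setD1 g) ?tet_center //= pos_center scaler0 add0r -[RHS]h.
  by apply: eq_bigr => u; rewrite !inE /c' => /andP[/negbTE ->].
by move=> /(_ e1 e2 v vs); rewrite /c' (negbTE vg).
Qed.

(** Membership in [tets] stands under the existential, so that [lam] can be chosen as a total
    function of [s]. *)
Lemma coord_exists s : exists L : V -> 'cV[R]_3, s \in tets ->
  forall x, x = \sum_(v in s :\ g) (x *m L v) 0 0 *: p v.
Proof.
have [sT|_] := boolP (s \in tets); last by exists (fun=> 0).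
have [v0 v0s] : exists v, v \in s :\ g.
  by apply/set0Pn; rewrite -card_gt0 tet_card_link.
pose A : 'M[R]_(#|s :\ g|, 3) := \matrix_i p (enum_val i).
have fA : row_free A.
  rewrite -kermx_eq0; apply/rowV0P => u /sub_kermxP uA.
  pose c v := u 0 (enum_rank_in v0s v).
  have h : \sum_(v in s :\ g) c v *: p v = 0.
    rewrite big_enum_val /= -[RHS]uA mulmx_sum_row; apply: eq_bigr => i _.
    by rewrite /c enum_valK_in rowK.
  apply/rowP => i; rewrite mxE -(tet_independent sT h (enum_valP i)).
  by rewrite /c enum_valK_in.
have /row_fullP[B BA] : row_full A.
  by rewrite /row_full (eqP fA) tet_card_link.
exists (fun v => col (enum_rank_in v0s v) B) => _ x.
rewrite big_enum_val /= -{1}[x]mulmx1 -BA mulmxA mulmx_sum_row; apply: eq_bigr => i _.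
rewrite rowK enum_valK_in; congr (_ *: _).
by rewrite !mxE; apply: eq_bigr => j _; rewrite !mxE.
Qed.

Definition lam s : V -> 'cV[R]_3 := projT1 (cid (coord_exists s)).

Definition co s v x : R := (x *m lam s v) 0 0.

Lemma co_def s v x : co s v x = (x *m lam s v) 0 0.
Proof. by []. Qed.

Lemma coP s x : s \in tets -> x = \sum_(v in s :\ g) co s v x *: p v.
Proof. by rewrite /co /lam; case: cid => /= L h sT; apply: h sT x. Qed.

Lemma coD s v x y : co s v (x + y) = co s v x + co s v y.
Proof. by rewrite /co mulmxDl mxE. Qed.

Lemma coZ s v e x : co s v (e *: x) = e * co s v x.
Proof. by rewrite /co -scalemxAl mxE. Qed.

Lemma co_uniq s x (c : V -> R) : s \in tets -> x = \sum_(v in s :\ g) c v *: p v ->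
  forall v, v \in s :\ g -> co s v x = c v.
Proof.
move=> sT ex v vs; apply/eqP; rewrite -subr_eq0; apply/eqP.
apply: (tet_independent (c := fun v => co s v x - c v) sT _ vs).
under eq_bigr => u _ do rewrite scalerBl.
by rewrite sumrB -coP // -ex subrr.
Qed.

Lemma co_pos s v w : s \in tets -> v \in s :\ g -> w \in s :\ g ->
  co s w (p v) = (w == v)%:R.
Proof.
move=> sT vs ws; apply: (co_uniq (c := fun w => (w == v)%:R)) => //.
rewrite (bigD1 v) //= eqxx scale1r big1 ?addr0 // => u /andP[_ /negbTE ->].
by rewrite scale0r.
Qed.

(** A point of the cone over a simplex through [g] falls into that simplex after scaling down, so
    the star can be traded for a fan in which no coordinates need to sum to 1. *)
Definition cone s x : Prop := exists2 c : V -> R,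
  (forall v, v \in s -> 0 <= c v) & x = \sum_(v in s) c v *: p v.

Lemma sum_sub s t (c : V -> R) : s \subset t ->
  \sum_(v in s) c v *: p v = \sum_(v in t) (if v \in s then c v else 0) *: p v.
Proof.
move=> st; rewrite [RHS](bigID (mem s)) /= [X in _ + X]big1 ?addr0.
  apply: eq_big => [v|v vs]; last by rewrite vs.
  by rewrite andbC; case: (boolP (v \in s)) => // /(fintype.subsetP st) ->.
by move=> v /andP[_ /negbTE ->]; rewrite scale0r.
Qed.

Lemma sum_center s (c : V -> R) : g \in s ->
  \sum_(v in s) c v *: p v = \sum_(v in s :\ g) c v *: p v.
Proof. by move=> gs; rewrite (big_setD1 g) //= pos_center scaler0 add0r. Qed.

Lemma cone_sub s t x : s \subset t -> cone s x -> cone t x.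
Proof.
move=> st [c c0 ->]; exists (fun v => if v \in s then c v else 0).
  by move=> v _; case: ifP => // /c0.
exact: sum_sub.
Qed.

Lemma coneZ s e x : 0 <= e -> cone s x -> cone s (e *: x).
Proof.
move=> e0 [c c0 ->]; exists (fun v => e * c v) => [v vs|]; first by rewrite mulr_ge0 ?c0.
by rewrite scaler_sumr; apply: eq_bigr => v _; rewrite scalerA.
Qed.

Lemma coneZ_pos s e x : 0 < e -> cone s (e *: x) -> cone s x.
Proof.
move=> e0 /(coneZ (e := e^-1)); rewrite scalerA mulVf ?gt_eqF // scale1r; apply.
by rewrite invr_ge0 ltW.
Qed.

Lemma simplex_cone s x : simplex K s x -> cone s x.
Proof. by move=> [c [c0 _ ->]]; exists c. Qed.

Lemma cone_simplex s (c : V -> R) e : g \in s -> (forall v, v \in s -> 0 <= c v) ->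
  0 <= e -> e * \sum_(v in s) c v <= 1 -> simplex K s (e *: \sum_(v in s) c v *: p v).
Proof.
move=> gs c0 e0 e1; pose S := \sum_(v in s) c v.
exists (fun v => e * c v + (if v == g then 1 - e * S else 0)); split.
- move=> v vs; rewrite addr_ge0 ?mulr_ge0 ?c0 //.
  by case: ifP => // _; rewrite subr_ge0.
- rewrite big_split /= -mulr_sumr -/S (big_setD1 g) //= eqxx big1 ?addr0.
    by rewrite addrC subrK.
  by move=> v; rewrite !inE => /andP[/negbTE ->].
- rewrite scaler_sumr; apply: eq_bigr => v _; rewrite scalerDl scalerA.
  by case: eqP => [->|_]; rewrite ?pos_center ?scaler0 ?scale0r addr0.
Qed.

Lemma cone_inter s t x : s \in faces K -> t \in faces K -> g \in s -> g \in t ->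
  cone s x -> cone t x -> cone (s :&: t) x.
Proof.
move=> sK tK gs gt [c c0 ec] [c' c'0 ec'].
pose S := \sum_(v in s) c v; pose S' := \sum_(v in t) c' v.
have S0 : 0 <= S by apply: sumr_ge0.
have S'0 : 0 <= S' by apply: sumr_ge0.
pose e := (1 + S + S')^-1.
have e0 : 0 < e by rewrite invr_gt0; lra.
have h1 : simplex K s (e *: x).
  rewrite ec; apply: cone_simplex => //; first exact: ltW.
  by rewrite -/S mulrC ler_pdivrMr; lra.
have h2 : simplex K t (e *: x).
  rewrite ec'; apply: cone_simplex => //; first exact: ltW.
  by rewrite -/S' mulrC ler_pdivrMr; lra.
apply: (coneZ_pos e0); apply: simplex_cone.
by case: complexK => _ _ _ /(_ s t sK tK) <-.
Qed.

Lemma coneP s x : s \in tets -> cone s x <-> forall v, v \in s :\ g -> 0 <= co s v x.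
Proof.
move=> sT; split=> [[c c0 ex] v vs|h].
  rewrite (co_uniq (c := c) sT _ vs) ?c0 //; last by rewrite -sum_center // tet_center.
  by move: vs; rewrite !inE => /andP[].
apply: (@cone_sub (s :\ g)); first exact: finset.subsetDl.
by exists (fun v => co s v x) => //; apply: coP.
Qed.

(** A common point lies in the cone of the common face, so both coordinate systems read off the same
    coefficients. Hence a vertex with positive coordinate in one tetrahedron belongs to the other,
    which is how positions yield incidences below. *)
Lemma co_support s t x : s \in tets -> t \in tets -> cone s x -> cone t x ->
  exists2 c : V -> R, (forall v, v \in s :\ g -> co s v x = if v \in t then c v else 0)
    & (forall v, v \in t :\ g -> co t v x = if v \in s then c v else 0).
Proof.
move=> sT tT sx tx.
have [c c0 ex] := cone_inter (tet_face sT) (tet_face tT) (tet_center sT) (tet_center tT) sx tx.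
have gst : g \in s :&: t by rewrite inE !tet_center.
exists c => v.
  apply: (co_uniq (c := fun v => if v \in t then c v else 0)) => //.
  rewrite ex (sum_sub _ (finset.subsetIl s t)) sum_center ?tet_center //.
  by apply: eq_bigr => u; rewrite !inE => /andP[_ ->].
apply: (co_uniq (c := fun v => if v \in s then c v else 0)) => //.
rewrite ex (sum_sub _ (finset.subsetIr s t)) sum_center ?tet_center //.
by apply: eq_bigr => u; rewrite !inE => /andP[_ ->]; rewrite andbT.
Qed.

Lemma co_gt0_mem s t x v : s \in tets -> t \in tets -> cone s x -> cone t x ->
  v \in s :\ g -> 0 < co s v x -> v \in t.
Proof.
move=> sT tT sx tx vs; have [c h _] := co_support sT tT sx tx.
by rewrite h //; case: ifP => //; rewrite ltxx.
Qed.

(** On the star these sums give the piecewise linear function that is 1 on the faces without [g] and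
    at most 1 everywhere; it detects boundary points. *)
Definition height s x : R := \sum_(v in s :\ g) co s v x.

Lemma height_eq s t x : s \in tets -> t \in tets -> cone s x -> cone t x ->
  height s x = height t x.
Proof.
move=> sT tT sx tx; have [c h1 h2] := co_support sT tT sx tx.
rewrite /height (eq_bigr _ h1) (eq_bigr _ h2) -!big_mkcondr /=.
by apply: eq_bigl => v; rewrite !inE -!andbA [(v \in s) && _]andbC.
Qed.

Lemma nbhs_ray x y (A : set 'rV[R]_3) : nbhs x A -> exists2 e : R, 0 < e & A (x + e *: y).
Proof.
move=> /nbhs_ballP[e /= e0 he]; have d0 : 0 < 1 + `|y| by rewrite ltr_pwDl.
exists (e / 2 / (1 + `|y|)); first by rewrite !divr_gt0.
apply: he; rewrite -ball_normE /ball_ /= opprD addrA subrr add0r normrN normrZ.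
rewrite ger0_norm; last by rewrite !divr_ge0 // ltW.
have h : `|y| / (1 + `|y|) < 1 by rewrite ltr_pdivrMr // mul1r ltrDr.
rewrite -[X in X < _]mulrA [_^-1 * _]mulrC; apply: (@lt_trans _ _ (e / 2 * 1)); last by lra.
by rewrite ltr_pM2l // divr_gt0.
Qed.

Lemma realization_cone x : realization K x -> exists2 s, s \in tets & cone s x.
Proof.
move=> [s sK xs]; have [t tT st] := face_tet sK; exists t => //.
exact: cone_sub st (simplex_cone xs).
Qed.

Lemma fan_complete x : exists2 s, s \in tets & cone s x.
Proof.
have : nbhs (0 : 'rV[R]_3) (realization K) by case: hK => _; rewrite pos_center.
move=> /(nbhs_ray x)[e e0]; rewrite add0r => /realization_cone[s sT xs].
by exists s => //; apply: coneZ_pos xs.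
Qed.

Lemma interior_faceP s : s \in faces K -> interior_face K s <-> g \in s.
Proof.
move=> sK; split=> [|gs h]; last first.
  have : simplex K s (p g).
    exists (fun v => (v == g)%:R); split=> //.
      by rewrite (big_setD1 g) //= eqxx big1 ?addr0 // => v; rewrite !inE => /andP[/negbTE ->].
    rewrite (big_setD1 g) //= eqxx scale1r big1 ?addr0 // => v.
    by rewrite !inE => /andP[/negbTE ->]; rewrite scale0r.
  by move/h => [_]; apply; case: hK.
apply: contra_notT => gs x xs; split.
  by apply: subset_closure; exists s.
(* At a point of a face without [g] the height is 1, and moving outwards along [x] raises it above
   1, which cannot happen inside the star. *)
move=> xi; have := nbhs_ray x xi => -[e e0 [t tK xt]].
have [s' s'T ss'] := face_tet sK; have [t' t'T tt'] := face_tet tK.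
have cx : cone s' x by apply: cone_sub ss' (simplex_cone xs).
have exx : x + e *: x = (1 + e) *: x by rewrite scalerDl scale1r.
have e1 : 0 < 1 + e by rewrite addr_gt0.
have cx' : cone t' x.
  by apply: (coneZ_pos e1); rewrite -exx; apply: cone_sub tt' (simplex_cone xt).
have h1 : height s' x = 1.
  case: xs => c [c0 c1 ex].
  have sg : s \subset s' :\ g.
    apply/fintype.subsetP => v vs; rewrite !inE (fintype.subsetP ss') // andbT.
    by apply: contraNneq gs => <-.
  rewrite /height (eq_bigr (fun v => if v \in s then c v else 0)); last first.
    by apply: co_uniq => //; rewrite ex (sum_sub _ sg).
  rewrite -big_mkcondr /= -[RHS]c1; apply: eq_bigl => v.
  by case: (boolP (v \in s)) => vs; rewrite ?andbF // (fintype.subsetP sg).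
have h2 : height t' (x + e *: x) <= 1.
  case: xt => c [c0 c1 ex].
  have et : x + e *: x = \sum_(v in t' :\ g) (if v \in t then c v else 0) *: p v.
    by rewrite ex (sum_sub _ tt') sum_center // tet_center.
  rewrite /height (eq_bigr _ (co_uniq t'T et)) -[X in _ <= X]c1.
  rewrite -big_mkcondr /= [X in _ <= X](bigID (fun v => v \in t' :\ g)) /=.
  rewrite (eq_bigl (fun v => (v \in t) && (v \in t' :\ g))); last by move=> v; rewrite andbC.
  by rewrite lerDl; apply: sumr_ge0 => v /andP[/c0].
move: h2; rewrite exx /height.
under eq_bigr => v _ do rewrite coZ.
rewrite -mulr_sumr -/(height t' x) -(height_eq s'T t'T cx cx') h1; lra.
Qed.

Lemma interior_facesE i : interior_faces K i = [set s in faces_dim K i | g \in s]%SET.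
Proof.
apply/setP => s; rewrite !inE; apply: andb_id2l => /andP[sK _].
by apply/asboolP/idP => /(interior_faceP sK).
Qed.

End Fan.

(** * Sides of triangles and Euler's formula *)

Section FanCombinatorics.
Variables (R : realType) (V : finType) (K : complex R V) (g : V).
Hypothesis hK : closed_vertex_star K g.
Implicit Types (s t : {set V}) (v w a b u : V) (x y : 'rV[R]_3).

Local Notation p := (pos K).
Local Notation tets := (tetrahedra K).
Local Notation co := (co hK).
Local Notation cone := (cone K).

(* [u] is the vertex of the tetrahedron [s] opposite to the triangle [g a b]. *)
Definition opposite s a b u : Prop :=
  [/\ a \in s :\ g, b \in s :\ g, u \in s :\ g, uniq [:: a; b; u]
    & forall v, v \in s :\ g -> v \in [:: a; b; u]].

Lemma opposite_exists s a b : s \in tets -> a \in s :\ g -> b \in s :\ g -> a != b ->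
  exists u, opposite s a b u.
Proof.
move=> sT al bl ab.
have : #|s :\ g :\ a :\ b| = 1.
  have := tet_card_link hK sT; rewrite (cardsD1 a) al => -[].
  by rewrite (cardsD1 b) in_setD1 bl eq_sym ab => -[].
move=> /eqP/cards1P[u eu]; exists u.
have : u \in s :\ g :\ a :\ b by rewrite eu finset.in_set1.
rewrite in_setD1 => /andP[ub]; rewrite in_setD1 => /andP[ua ul]; split=> //.
  by rewrite /= !inE negb_or ab eq_sym ua eq_sym ub.
move=> v vl; rewrite !inE; have [//|va] := eqVneq v a; have [//|vb] := eqVneq v b.
by rewrite /= -finset.in_set1 -eu; do 2![apply/setD1P; split=> //].
Qed.

Lemma opposite_swap s a b u : opposite s a b u -> opposite s b a u.
Proof.
case=> al bl ul; rewrite /= !inE !negb_or => /andP[/andP[ab au] /andP[bu _]] h.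
split=> //; first by rewrite /= !inE !negb_or eq_sym ab bu au.
by move=> v /h; rewrite !inE orbCA.
Qed.

Lemma opposite_rot s a b u : opposite s a b u -> opposite s a u b.
Proof.
case=> al bl ul; rewrite /= !inE !negb_or => /andP[/andP[ab au] /andP[bu _]] h.
split=> //; first by rewrite /= !inE !negb_or au ab [u == b]eq_sym bu.
by move=> v /h; rewrite !inE [(_ == b) || _]orbC.
Qed.

(** In the expansion of [x] the terms along [a] and [b] drop out of the determinant. So the sign of
    the coordinate at [u] tells whether [x] lies on the same side of the plane as [u]. *)
Lemma triple_co s a b u x : s \in tets -> opposite s a b u ->
  triple (p a) (p b) x = co s u x * triple (p a) (p b) (p u).
Proof.
move=> sT [al bl ul _ h]; rewrite {1}(coP hK x sT) triple_sum (bigD1 u) //= tripleZ.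
rewrite big1 ?addr0 // => v /andP[/h]; rewrite !inE => /or3P[] /eqP -> => [_|_|].
- by rewrite tripleZ triple_l mulr0.
- by rewrite tripleZ triple_r mulr0.
- by rewrite eqxx.
Qed.

Lemma cross_neq0 s a b : s \in tets -> a \in s :\ g -> b \in s :\ g -> a != b ->
  cross (p a) (p b) != 0.
Proof.
move=> sT al bl ab; apply/eqP => h.
have e i j : p a 0 i * p b 0 j = p b 0 i * p a 0 j.
  have h0 := congr1 (fun z : 'rV[R]_3 => z 0 i0) h.
  have h1 := congr1 (fun z : 'rV[R]_3 => z 0 i1) h.
  have h2 := congr1 (fun z : 'rV[R]_3 => z 0 i2) h.
  move: h0 h1 h2; rewrite !mxE /= => h0 h1 h2.
  by case: (ord3P i) => ->; case: (ord3P j) => ->; lra.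
(* By [e] the combination [p b 0 j *: p a - p a 0 j *: p b] is zero, and independence kills its
   coefficients. *)
have a0 j : p a 0 j = 0.
  have := tet_independent hK (c := fun v => if v == a then p b 0 j else
    if v == b then - p a 0 j else 0) sT _ bl.
  rewrite eq_sym (negbTE ab) eqxx => h1; apply/eqP; rewrite -oppr_eq0; apply/eqP/h1.
  rewrite (bigD1 a) //= eqxx (bigD1 b) /=; last by rewrite bl eq_sym.
  rewrite eq_sym (negbTE ab) eqxx big1 ?addr0 => [|v /andP[/andP[_ /negbTE ->] /negbTE ->]];
    last by rewrite scale0r.
  by apply/rowP => i; rewrite !mxE mulNr mulrC e mulrC [_ * p b 0 i]mulrC subrr.
have := co_pos hK sT al al; rewrite eqxx.
rewrite (_ : p a = 0) /co ?mul0mx ?mxE => [/eqP|]; last by apply/rowP => j; rewrite a0 mxE.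
by rewrite eq_sym oner_eq0.
Qed.

Lemma triple_neq0 s a b u : s \in tets -> opposite s a b u ->
  triple (p a) (p b) (p u) != 0.
Proof.
move=> sT o; case: (o) => al bl _ /= /andP[]; rewrite !inE negb_or => /andP[ab _] _ _.
apply/eqP => h; have := triple_cross_gt0 (cross_neq0 sT al bl ab).
by rewrite (triple_co _ sT o) h mulr0 ltxx.
Qed.

(** The point [p a + p b] is pushed slightly along the normal. A tetrahedron whose cone contains the
    pushed point also contains the original one, as negative coordinates stay negative under a small
    push; so it contains [a] and [b], and its remaining vertex is on the positive side. *)
Lemma side_exists s0 a b : s0 \in tets -> a \in s0 :\ g -> b \in s0 :\ g -> a != b ->
  exists s u, [/\ s \in tets, opposite s a b u & 0 < triple (p a) (p b) (p u)].
Proof.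
move=> s0T al bl ab; pose n := cross (p a) (p b).
have n0 : 0 < triple (p a) (p b) n by apply/triple_cross_gt0/(cross_neq0 s0T).
pose x0 := p a + p b.
have cx0 v : v \in s0 :\ g -> co s0 v x0 = (v == a)%:R + (v == b)%:R.
  by move=> vl; rewrite coD !co_pos.
have [e e0 he] := small_perturbation (fun sv : {set V} * V => - co sv.1 sv.2 x0)
  (fun sv : {set V} * V => - co sv.1 sv.2 n).
have [s sT cs] := fan_complete hK (x0 + e *: n).
have [als bls] : a \in s /\ b \in s.
  have cs0 : cone s0 x0.
    by apply/(coneP hK _ s0T) => v vl; rewrite cx0 // addr_ge0.
  have csx : cone s x0.
    apply/(coneP hK _ sT) => v vl; rewrite leNgt; apply/negP => neg.
    have := he (s, v); rewrite /= oppr_gt0 => /(_ neg).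
    move/(coneP hK _ sT)/(_ _ vl): cs; rewrite coD coZ; lra.
  split.
    by apply: (co_gt0_mem (hK := hK) s0T sT cs0 csx al); rewrite cx0 // eqxx ltr_wpDr.
  by apply: (co_gt0_mem (hK := hK) s0T sT cs0 csx bl); rewrite cx0 // eqxx ltr_wpDl.
have ag : a != g by case/setD1P: al.
have bg : b != g by case/setD1P: bl.
have als' : a \in s :\ g by rewrite in_setD1 ag.
have bls' : b \in s :\ g by rewrite in_setD1 bg.
have [u o] := opposite_exists sT als' bls' ab.
exists s, u; split=> //.
have ul : u \in s :\ g by case: o.
have cu : 0 <= co s u (x0 + e *: n) by move/(coneP hK _ sT)/(_ _ ul): cs.
have : 0 < triple (p a) (p b) (x0 + e *: n).
  by rewrite !tripleD triple_l triple_r tripleZ !add0r mulr_gt0.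
rewrite (triple_co _ sT o) => h; rewrite ltNge; apply/negP => h'.
by move: h; rewrite ltNge mulr_ge0_le0.
Qed.

Lemma tet_eq_link s s' : s \in tets -> s' \in tets ->
  (forall v, v \in s :\ g -> v \in s') -> s = s'.
Proof.
move=> sT s'T h; apply/eqP; rewrite eqEcard (tet_card sT) (tet_card s'T) leqnn andbT.
apply/fintype.subsetP => v vs; have [->|vg] := eqVneq v g; first exact: (tet_center hK).
by apply: h; rewrite in_setD1 vg.
Qed.

(** For small [e] the point [x0 + e *: p u] has positive coordinates in [s] and nonnegative ones in
    [s'], so every vertex of [s] belongs to [s']. *)
Lemma side_unique s s' a b u u' : s \in tets -> s' \in tets ->
  opposite s a b u -> opposite s' a b u' ->
  0 < triple (p a) (p b) (p u) -> 0 < triple (p a) (p b) (p u') -> s = s'.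
Proof.
move=> sT s'T o o' tu tu'; pose x0 := p a + p b.
case: (o) => al bl ul un h; case: (o') => al' bl' ul' un' h'.
move: un; rewrite /= !inE !negb_or => /andP[/andP[ab au] /andP[bu _]].
move: un'; rewrite /= !inE !negb_or => /andP[/andP[_ au'] /andP[bu' _]].
have [e e0 he] := small_perturbation (fun v => co s' v x0) (fun v => co s' v (p u)).
have c' : cone s' (x0 + e *: p u).
  apply/(coneP hK _ s'T) => v vl; rewrite coD coZ.
  have : v \in [:: a; b; u'] by apply: h'.
  rewrite !inE => /or3P[]/eqP ev.
  - apply/ltW/he; rewrite coD !co_pos // ev eqxx; by rewrite ltr_wpDr.
  - apply/ltW/he; rewrite coD !co_pos // ev eqxx; by rewrite ltr_wpDl.
  - subst v; rewrite coD (co_pos hK s'T al' vl) (co_pos hK s'T bl' vl).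
    rewrite [u' == a]eq_sym (negbTE au') [u' == b]eq_sym (negbTE bu') !add0r.
    apply: mulr_ge0; first exact: ltW.
    by move: tu; rewrite (triple_co _ s'T o') pmulr_lgt0 // => /ltW.
have c : cone s (x0 + e *: p u).
  apply/(coneP hK _ sT) => v vl; rewrite !coD coZ !co_pos //.
  by rewrite !addr_ge0 // mulr_ge0 // ltW.
have uu' : u \in s'.
  apply: (co_gt0_mem (hK := hK) sT s'T c c' ul); rewrite !coD coZ !co_pos // eqxx.
  by rewrite eq_sym (negbTE au) eq_sym (negbTE bu) !add0r mulr1.
apply: tet_eq_link => // v /h; rewrite !inE => /or3P[]/eqP -> //.
  by case/setD1P: al'.
by case/setD1P: bl'.
Qed.

Definition verts : {set V} := [set v | (v != g) && ([set g; v] \in faces K)]%SET.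

Lemma vertP v : v \in verts <-> exists2 s, s \in tets & v \in s :\ g.
Proof.
rewrite inE; split=> [/andP[vg vK]|[s sT]].
  have [s sT gs] := face_tet hK vK; exists s => //; rewrite in_setD1 vg.
  by apply: (fintype.subsetP gs); rewrite !inE eqxx orbT.
rewrite in_setD1 => /andP[vg vs]; rewrite vg /=.
apply: (sub_face hK (tet_face sT)).
  by apply/fintype.subsetP => w; rewrite !inE => /orP[]/eqP ->; rewrite // (tet_center hK).
by apply/set0Pn; exists g; rewrite !inE eqxx.
Qed.

Lemma generic_direction : exists y, forall s v, s \in tets -> v \in s :\ g -> co s v y != 0.
Proof.
(* Pairs outside the fan get a dummy nonzero column, so that [generic_point] applies to all
   pairs. *)
pose L (sv : {set V} * V) : 'cV[R]_3 :=
  if (sv.1 \in tets) && (sv.2 \in sv.1 :\ g) then lam hK sv.1 sv.2 else const_mx 1.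
have [|y hy] := generic_point (L := L).
  move=> [s v]; rewrite /L /=; case: ifP => [/andP[sT vs]|_].
    apply/eqP => l0; have := co_pos hK sT vs vs; rewrite co_def l0 mulmx0 mxE eqxx.
    by move/eqP; rewrite eq_sym oner_eq0.
  by apply/eqP => /matrixP/(_ 0 0); rewrite !mxE => /eqP; rewrite oner_eq0.
exists y => s v sT vs; have := hy (s, v); by rewrite /L /= sT vs.
Qed.

(** These are the [v] for which [y + c *: p v] lies in the open cone of [s] when [c] is large. *)
Definition upper s y : {set V} :=
  [set v in s :\ g | [forall w in s :\ g, (w != v) ==> (0 < co s w y)]]%SET.

(** Open cones of different tetrahedra are disjoint, so for large [c] the point [y + c *: p v]
    determines [s]; each vertex is counted at most once. *)
Lemma sum_upper y : (\sum_(s in tets) #|upper s y| <= #|verts|)%N.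
Proof.
under eq_bigr => s _ do rewrite -sum1_card.
rewrite (exchange_big_dep (mem verts)) /=; last first.
  by move=> s v sT; rewrite inE => /andP[vs _]; apply/vertP; exists s.
rewrite -sum1_card; apply: leq_sum => v _; rewrite sum1_card.
apply/card_le1_eqP => s s' m m'.
have {m} /andP[sT'] : (s \in tets) && (v \in upper s y) := m.
have {m'} /andP[s'T'] : (s' \in tets) && (v \in upper s' y) := m'.
rewrite /upper finset.in_set => /andP[vs2 /forallP h'].
rewrite finset.in_set => /andP[vs1 /forallP h].
pose c := 1 + `|co s v y| + `|co s' v y|.
have pos_at z : z \in tets -> v \in z :\ g -> `|co z v y| < c ->
    (forall w, (w \in z :\ g) ==> ((w != v) ==> (0 < co z w y))) ->
    forall w, w \in z :\ g -> 0 < co z w (y + c *: p v).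
  move=> zT vz zc hz w wz; rewrite coD coZ co_pos //.
  have [->|wv] := eqVneq w v; last first.
    by rewrite mulr0 addr0; have := hz w; rewrite wz wv.
  rewrite mulr1; have := ler_norm (- co z v y); rewrite normrN; lra.
have c1 : `|co s v y| < c by rewrite /c; have := normr_ge0 (co s' v y); lra.
have c2 : `|co s' v y| < c by rewrite /c; have := normr_ge0 (co s v y); lra.
have h1 := pos_at _ sT' vs1 c1 h; have h2 := pos_at _ s'T' vs2 c2 h'.
apply/esym; apply: tet_eq_link => // w ws; apply: (co_gt0_mem (hK := hK) sT' s'T' _ _ ws (h1 w ws)).
  by apply/(coneP hK _ sT') => z /h1/ltW.
by apply/(coneP hK _ s'T') => z /h2/ltW.
Qed.

(* This is Euler's formula, read off the h-vector of the complete simplicial fan: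
   for generic [y] each edge is in [upper s y] for at most one [s], every [s] has
   a nonempty [upper s y] or [upper s (- y)], and the tetrahedra whose cones
   contain [y] and [- y] contribute three edges each. *)
Lemma euler_tets : (#|tets| + 4 <= 2 * #|verts|)%N.
Proof.
have [y hy] := generic_direction.
have [s1 s1T c1] := fan_complete hK y; have [s2 s2T c2] := fan_complete hK (- y).
have coN s v : co s v (- y) = - co s v y by rewrite -scaleN1r coZ mulN1r.
have P1 v : v \in s1 :\ g -> 0 < co s1 v y.
  move=> vs; rewrite lt_def hy //=; exact: (coneP hK _ s1T).1 c1 v vs.
have P2 v : v \in s2 :\ g -> co s2 v y < 0.
  by move=> vs; rewrite lt_def eq_sym hy //= -oppr_ge0 -coN; apply: (coneP hK _ s2T).1 c2 v vs.
have s12 : s1 != s2.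
  apply/eqP => e; have : (0 < #|s1 :\ g|)%N by rewrite (tet_card_link hK).
  move/card_gt0P => [v vs]; have := P1 v vs; have := P2 v; rewrite -e => /(_ vs); lra.
have U1 : #|upper s1 y| = 3%N.
  rewrite -(tet_card_link hK s1T); apply: eq_card => v; rewrite inE.
  apply/andb_idr => vs; apply/forallP => w; apply/implyP => ws; apply/implyP => _.
  exact: P1.
have U2 : #|upper s2 (- y)| = 3%N.
  rewrite -[RHS](tet_card_link hK s2T); apply: eq_card => v; rewrite inE.
  apply/andb_idr => vs; apply/forallP => w; apply/implyP => ws; apply/implyP => _.
  by rewrite coN oppr_gt0 P2.
(* Two of the three nonzero coordinates of [y] have equal signs; the remaining vertex is then in
   [upper s y] or in [upper s (- y)]. *)
have U s : s \in tets -> (1 <= #|upper s y| + #|upper s (- y)|)%N.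
  move=> sT; have [a al] : exists a, a \in s :\ g.
    by apply/set0Pn; rewrite -card_gt0 (tet_card_link hK).
  have [b] : exists b, b \in s :\ g :\ a.
    by apply/set0Pn; rewrite -card_gt0; have := tet_card_link hK sT; rewrite (cardsD1 a) al; case: #|_|.
  rewrite in_setD1 => /andP[ba bl].
  have [u o] := opposite_exists sT al bl (negbT (etrans (eq_sym a b) (negbTE ba))).
  case: (o) => _ _ ul /= /andP[]; rewrite !inE !negb_or => /andP[ab au] /andP[bu _] h.
  have key z v : v \in s :\ g -> (forall w, w \in s :\ g -> w != v -> 0 < co s w z) ->
      (0 < #|upper s z|)%N.
    move=> vs hv; apply/card_gt0P; exists v; rewrite inE vs; apply/forallP => w.
    by apply/implyP => ws; apply/implyP => wv; apply: hv.
  have two z v w1 w2 : v \in s :\ g -> (forall w, w \in s :\ g -> w != v -> (w == w1) || (w == w2)) ->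
      0 < co s w1 z -> 0 < co s w2 z -> (0 < #|upper s z|)%N.
    by move=> vs hv z1 z2; apply: (key z v vs) => w ws /(hv w ws)/orP[]/eqP ->.
  have ha w : w \in s :\ g -> w != a -> (w == b) || (w == u).
    by move=> /h; rewrite !inE => /or3P[]-> //; rewrite ?orbT.
  have hb w : w \in s :\ g -> w != b -> (w == a) || (w == u).
    by move=> /h; rewrite !inE => /or3P[]-> //; rewrite ?orbT.
  have hu w : w \in s :\ g -> w != u -> (w == a) || (w == b).
    by move=> /h; rewrite !inE => /or3P[]-> //; rewrite ?orbT.
  have na := coN s a; have nb := coN s b; have nu := coN s u.
  rewrite addn_gt0; apply/orP.
  case: (ltgtP 0 (co s a y)) (hy s a sT al) => [ca _|ca _|_ /=]; last by [].
    case: (ltgtP 0 (co s b y)) (hy s b sT bl) => [cb _|cb _|_ /=]; last by [].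
      by left; apply: (two y u a b).
    case: (ltgtP 0 (co s u y)) (hy s u sT ul) => [cu _|cu _|_ /=]; last by [].
      by left; apply: (two y b a u).
    by right; apply: (two (- y) a b u) => //; rewrite ?nb ?nu oppr_gt0.
  case: (ltgtP 0 (co s b y)) (hy s b sT bl) => [cb _|cb _|_ /=]; last by [].
    case: (ltgtP 0 (co s u y)) (hy s u sT ul) => [cu _|cu _|_ /=]; last by [].
      by left; apply: (two y a b u).
    by right; apply: (two (- y) b a u) => //; rewrite ?na ?nu oppr_gt0.
  by right; apply: (two (- y) u a b) => //; rewrite ?na ?nb oppr_gt0.
have := leq_add (sum_upper y) (sum_upper (- y)); rewrite -big_split /= addnn -mul2n.
apply: leq_trans; rewrite (bigD1 s1) //= (bigD1 s2) /=; last by rewrite s2T eq_sym.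
rewrite U1 U2 (cardsD1 s1) s1T (cardsD1 s2) in_setD1 s2T eq_sym s12 /=.
have : (#|tets :\ s1 :\ s2| <=
    \sum_(i | (i \in tets) && (i != s1) && (i != s2)) (#|upper i y| + #|upper i (- y)|))%N.
  rewrite -sum1_card (eq_bigl (fun i => (i \in tets) && (i != s1) && (i != s2))); last first.
    by move=> i; rewrite !in_setD1 andbC [_ && (i \in _)]andbC.
  by apply: leq_sum => i /andP[/andP[iT _] _]; apply: U.
by move: (\sum_(i | _) _)%N #|tets :\ s1 :\ s2| #|upper s1 _| #|upper s2 _| => S n m k; lia.
Qed.

End FanCombinatorics.

(** * Incidences of the fan *)

Section FanData.
Variables (R : realType) (V : finType) (K : complex R V) (g : V).
Hypothesis hK : closed_vertex_star K g.
Implicit Types (v w a b u : V) (x y : 'rV[R]_3).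

Local Notation p := (pos K).
Local Notation tets := (tetrahedra K).
Local Notation opposite := (opposite g).
Local Notation tri a b := (g |: [set a; b])%SET.

Definition T3 : finType := {s : {set V} | s \in tets}.
Definition T2 : finType := {t : {set V} | t \in interior_faces K 2}.
Definition W : finType := {v : V | v \in verts K g}.

Lemma vert_neq (v : W) : val v != g.
Proof. by have := valP v; rewrite inE => /andP[]. Qed.

Lemma tri_sub (s : {set V}) a b : s \in tets -> a \in s -> b \in s -> tri a b \subset s.
Proof.
move=> sT al bl; apply/fintype.subsetP => z; rewrite !inE => /or3P[]/eqP -> //.
exact: (tet_center hK).
Qed.

Lemma tri_interior s a b : s \in tets -> a \in s :\ g -> b \in s :\ g -> a != b ->
  tri a b \in interior_faces K 2.
Proof.
rewrite !in_setD1 => sT /andP[ag al] /andP[bg bl] ab.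
rewrite (interior_facesE hK) inE setU11 andbT inE cardsU1 cards2 ab !inE.
rewrite negb_or ![g == _]eq_sym ag bg andbT.
apply/andP; split=> //; apply: (sub_face hK (tet_face sT)); first exact: tri_sub.
by apply/set0Pn; exists g; rewrite setU11.
Qed.

Lemma triP t : t \in interior_faces K 2 -> exists s a b,
  [/\ s \in tets, a \in s :\ g, b \in s :\ g, a != b & t = tri a b].
Proof.
rewrite (interior_facesE hK) inE => /andP[]; rewrite inE => /andP[tK /eqP ct] gt.
have [s sT ts] := face_tet hK tK.
have : #|t :\ g| == 2%N by move: ct; rewrite (cardsD1 g) gt add1n => -[->].
move=> /cards2P[a [b]] H; case: H => ab e; exists s, a, b.
have sub z : z \in t :\ g -> z \in s :\ g.
  by rewrite !in_setD1 => /andP[-> /(fintype.subsetP ts)].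
by split=> //; rewrite ?sub ?e ?inE ?eqxx ?orbT // -e finset.setD1K.
Qed.

Lemma tri_inj a b a' b' : a != g -> b != g -> a' != g -> b' != g -> a != b ->
  tri a b = tri a' b' -> (a = a' /\ b = b') \/ (a = b' /\ b = a').
Proof.
move=> ag bg a'g b'g ab e.
have : a \in tri a' b' by rewrite -e !inE eqxx orbT.
have : b \in tri a' b' by rewrite -e !inE eqxx !orbT.
rewrite !inE (negbTE ag) (negbTE bg) /= => /orP[]/eqP eb /orP[]/eqP ea.
- by move: ab; rewrite ea eb eqxx.
- by right.
- by left.
- by move: ab; rewrite ea eb eqxx.
Qed.

Lemma ends_exist (t : T2) : exists e : W * W,
  val t = tri (val e.1) (val e.2) /\ e.1 != e.2.
Proof.
have [s [a [b [sT al bl ab e]]]] := triP (valP t).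
have av : a \in verts K g by apply/(vertP hK); exists s.
have bv : b \in verts K g by apply/(vertP hK); exists s.
by exists (exist _ a av, exist _ b bv); split=> //; rewrite -val_eqE.
Qed.

Definition ta (t : T2) : W := (projT1 (cid (ends_exist t))).1.
Definition tb (t : T2) : W := (projT1 (cid (ends_exist t))).2.

Lemma val_tri t : val t = tri (val (ta t)) (val (tb t)).
Proof. by rewrite /ta /tb; case: cid => /= e []. Qed.

Lemma ta_neq_tb t : ta t != tb t.
Proof. by rewrite /ta /tb; case: cid => /= e []. Qed.

Lemma ends_eq (t : T2) (v w : W) : v != w -> val t = tri (val v) (val w) ->
  (ta t = v /\ tb t = w) \/ (ta t = w /\ tb t = v).
Proof.
move=> vw; rewrite val_tri => /tri_inj.
rewrite !vert_neq val_eqE ta_neq_tb => /(_ isT isT isT isT isT).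
by case=> -[/val_inj -> /val_inj ->]; [left|right].
Qed.

Lemma ends_sub (t : T2) s : s \in tets -> val t \subset s ->
  val (ta t) \in s :\ g /\ val (tb t) \in s :\ g.
Proof.
move=> sT /fintype.subsetP ts; rewrite !in_setD1 !vert_neq.
by rewrite !ts // val_tri !inE eqxx !orbT.
Qed.

Lemma sides_exist (t : T2) : exists s : T3 * T3,
  (exists2 u, opposite (val s.1) (val (ta t)) (val (tb t)) u
     & 0 < triple (p (val (ta t))) (p (val (tb t))) (p u)) /\
  (exists2 u, opposite (val s.2) (val (ta t)) (val (tb t)) u
     & triple (p (val (ta t))) (p (val (tb t))) (p u) < 0).
Proof.
have [s0 [a [b [s0T al bl ab e]]]] := triP (valP t).
have [|tal tbl] := @ends_sub t s0 s0T.
  by rewrite e tri_sub //; [case/setD1P: al|case/setD1P: bl].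
have tab : val (ta t) != val (tb t) by rewrite val_eqE ta_neq_tb.
have [s1 [u1 [s1T o1 h1]]] := side_exists hK s0T tal tbl tab.
rewrite eq_sym in tab.
have [s2 [u2 [s2T o2 h2]]] := side_exists hK s0T tbl tal tab.
exists (exist _ s1 s1T, exist _ s2 s2T); split; first by exists u1.
exists u2; first exact: opposite_swap.
by rewrite tripleC oppr_lt0.
Qed.

Definition sp (t : T2) : T3 := (projT1 (cid (sides_exist t))).1.
Definition sm (t : T2) : T3 := (projT1 (cid (sides_exist t))).2.

Lemma sp_spec t : exists2 u, opposite (val (sp t)) (val (ta t)) (val (tb t)) u
   & 0 < triple (p (val (ta t))) (p (val (tb t))) (p u).
Proof. by rewrite /sp; case: cid => /= s []. Qed.

Lemma sm_spec t : exists2 u, opposite (val (sm t)) (val (ta t)) (val (tb t)) u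
   & triple (p (val (ta t))) (p (val (tb t))) (p u) < 0.
Proof. by rewrite /sm; case: cid => /= s []. Qed.

Lemma opposite_uniq s a b u u' : opposite s a b u -> opposite s a b u' -> u = u'.
Proof.
move=> [_ _ _ un h] [_ _ ul un' _]; have := h _ ul; rewrite !inE => /or3P[]/eqP // e;
by move: un'; rewrite e /= !inE eqxx ?orbT ?andbF.
Qed.

Lemma spP t (s : T3) u : opposite (val s) (val (ta t)) (val (tb t)) u ->
  (sp t == s) = (0 < triple (p (val (ta t))) (p (val (tb t))) (p u)).
Proof.
move=> o; have [u' o' h'] := sp_spec t; apply/eqP/idP => [e|h].
  by rewrite e in o'; rewrite (opposite_uniq o o').
by apply/val_inj; apply: (side_unique hK _ _ o' o h' h); apply: valP.
Qed.

Lemma smP t (s : T3) u : opposite (val s) (val (ta t)) (val (tb t)) u ->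
  (sm t == s) = (triple (p (val (ta t))) (p (val (tb t))) (p u) < 0).
Proof.
move=> o; have [u' o' h'] := sm_spec t; apply/eqP/idP => [e|h].
  by rewrite e in o'; rewrite (opposite_uniq o o').
apply/val_inj; apply: (side_unique hK _ _ (opposite_swap o') (opposite_swap o)).
- exact: valP.
- exact: valP.
- by rewrite tripleC oppr_gt0.
- by rewrite tripleC oppr_gt0.
Qed.

Definition orient (t : T2) (s : T3) : R := (sp t == s)%:R - (sm t == s)%:R.

Lemma orient_sg t (s : T3) u : opposite (val s) (val (ta t)) (val (tb t)) u ->
  orient t s = Num.sg (triple (p (val (ta t))) (p (val (tb t))) (p u)).
Proof.
move=> o; rewrite /orient (spP o) (smP o).
have := triple_neq0 hK (valP s) o; rewrite neq_lt => /orP[h|h].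
  by rewrite h lt_gtF // ltr0_sg // sub0r.
by rewrite h lt_gtF // gtr0_sg // subr0.
Qed.

Lemma orient0 t (s : T3) :
  ~~ ((val (ta t) \in val s) && (val (tb t) \in val s)) -> orient t s = 0.
Proof.
have in_s s' u : opposite s' (val (ta t)) (val (tb t)) u ->
    (val (ta t) \in s') && (val (tb t) \in s').
  by case=> /setD1P[_ ->] /setD1P[_ ->].
move=> h; rewrite /orient.
case: eqP => [e|_]; first by have [u /in_s] := sp_spec t; rewrite e (negbTE h).
case: eqP => [e|_]; first by have [u /in_s] := sm_spec t; rewrite e (negbTE h).
exact: subrr.
Qed.

(** Exchanging the two ends of [t] changes the sign of both factors, so the product does not depend
    on the chosen order. *)
Lemma orient_end (t : T2) (s : T3) (v z : W) u : opposite (val s) (val v) (val z) u ->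
  val t = tri (val v) (val z) ->
  orient t s * ((ta t == v)%:R - (tb t == v)%:R) =
  Num.sg (triple (p (val v)) (p (val z)) (p u)).
Proof.
move=> o et; have vz : v != z.
  by case: o => _ _ _ /= /andP[]; rewrite !inE negb_or val_eqE => /andP[].
have [[ea eb]|[ea eb]] := ends_eq vz et.
  rewrite (orient_sg (u := u)) ?ea ?eb //.
  by rewrite eqxx eq_sym (negbTE vz) subr0 mulr1.
rewrite (orient_sg (u := u)) ?ea ?eb; last exact: opposite_swap.
by rewrite eqxx eq_sym (negbTE vz) sub0r mulrN1 tripleC sgrN opprK.
Qed.

Lemma vert_of (s : T3) v : v \in val s :\ g -> exists w : W, val w = v.
Proof.
move=> vs; have h : v \in verts K g by apply/(vertP hK); exists (val s) => //; apply: valP.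
by exists (exist _ v h).
Qed.

(** If [v] is in [s], with further vertices [x] and [y], only the triangles [g v x] and [g v y]
    contribute. Their terms are the signs of the determinants of [v, x, y] and of [v, y, x], which
    cancel. *)
Lemma boundary_closed (s : T3) (v : W) :
  \sum_t orient t s * ((ta t == v)%:R - (tb t == v)%:R) = 0.
Proof.
have [vs|vs] := boolP (val v \in val s); last first.
  apply: big1 => t _; case: (eqVneq (ta t) v) => [e|ev].
    by rewrite orient0 ?mul0r // e (negbTE vs).
  case: (eqVneq (tb t) v) => [e|ew]; last by rewrite subrr mulr0.
  by rewrite orient0 ?mul0r // e (negbTE vs) andbF.
have vl : val v \in val s :\ g by rewrite in_setD1 vert_neq.
have [x0] : exists x : V, x \in val s :\ g :\ val v.
  apply/set0Pn; rewrite -card_gt0; have := tet_card_link hK (valP s).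
  by rewrite (cardsD1 (val v)) vl; case: #|_|.
rewrite in_setD1 => /andP[xv xl]; rewrite eq_sym in xv.
have [y0 o] := opposite_exists hK (valP s) vl xl xv.
have [x ex] := vert_of xl.
have yl : y0 \in val s :\ g by case: o.
have [y ey] := vert_of yl.
rewrite -ex -ey in o xv; have o' := opposite_rot o.
have vx : val v != val x by [].
have vy : val v != val y by case: o' => _ _ _ /= /andP[]; rewrite !inE negb_or => /andP[].
have xy : val x != val y by case: o => _ _ _ /= /and3P[_]; rewrite inE.
have xl' : val x \in val s :\ g by rewrite ex.
have yl' : val y \in val s :\ g by rewrite ey.
pose t1 : T2 := exist _ (tri (val v) (val x)) (tri_interior (valP s) vl xl' vx).
pose t2 : T2 := exist _ (tri (val v) (val y)) (tri_interior (valP s) vl yl' vy).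
have t12 : t2 != t1.
  apply/eqP => /(congr1 val) /= e; have : val y \in tri (val v) (val x).
    by rewrite -e !inE eqxx !orbT.
  by rewrite !inE (negbTE (vert_neq y)) ![val y == _]eq_sym (negbTE vy) (negbTE xy).
rewrite (bigD1 t1) //= (bigD1 t2) //= (orient_end o) // (orient_end o') //.
rewrite (triple_rot (p (val v)) (p (val x)) (p (val y))) sgrN addrA subrr add0r big1 // => t /andP[n1 n2].
have oth z : (ta t == v) && (tb t == z) || (ta t == z) && (tb t == v) -> val z \in val s -> False.
  move=> h zs; have et : val t = tri (val v) (val z).
    rewrite val_tri; case/orP: h => /andP[/eqP -> /eqP ->] //.
    by rewrite [[set val z; _]%SET]finset.setUC.
  have zv : v != z by case/orP: h => /andP[/eqP <- /eqP <-]; rewrite ?ta_neq_tb // eq_sym ta_neq_tb.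
  have zl : val z \in val s :\ g by rewrite in_setD1 vert_neq.
  case: (o) => _ _ _ _ /(_ _ zl); rewrite !inE => /or3P[]/eqP e.
  - by move: zv; rewrite -val_eqE e eqxx.
  - by case/eqP: n1; apply/val_inj; rewrite et e.
  - by case/eqP: n2; apply/val_inj; rewrite et e.
case: (eqVneq (ta t) v) => [e|ev].
  rewrite orient0 ?mul0r //; apply/negP => /andP[_ /(oth (tb t))]; apply.
  by rewrite e !eqxx.
case: (eqVneq (tb t) v) => [e|ew]; last by rewrite subrr mulr0.
rewrite orient0 ?mul0r //; apply/negP => /andP[/(oth (ta t)) + _]; apply.
by rewrite e !eqxx orbT.
Qed.

Lemma link_tri (s : T3) (v w : W) : v != w -> val v \in val s -> val w \in val s ->
  exists2 t : T2, val t = tri (val v) (val w) &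
    (ta t = v /\ tb t = w) \/ (ta t = w /\ tb t = v).
Proof.
move=> vw vs ws.
have vl : val v \in val s :\ g by rewrite in_setD1 vert_neq.
have wl : val w \in val s :\ g by rewrite in_setD1 vert_neq.
have vw' : val v != val w by [].
exists (exist _ (tri (val v) (val w)) (tri_interior (valP s) vl wl vw')) => //.
exact: ends_eq.
Qed.

(** Such a [y] is constant on the vertices other than [g] of each tetrahedron, and consecutive
    tetrahedra in a hereditary chain at [g] share such a vertex because they meet in three. *)
Lemma link_connected (y : W -> R) :
  (forall t, y (ta t) = y (tb t)) -> forall v w : W, y v = y w.
Proof.
move=> hy.
have loc (s : T3) (v w : W) : val v \in val s -> val w \in val s -> y v = y w.
  move=> vs ws; have [->//|vw] := eqVneq v w.
  have [t _ [[<- <-]|[<- <-]]] := link_tri vw vs ws; first exact: hy.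
  exact/esym/hy.
move=> v w.
have /(vertP hK)[s sT vs] := valP v; have /(vertP hK)[s' s'T ws] := valP w.
have : connect (adjacent_at K g) s s'.
  by case: hK => [[_ _ _ her _] _]; apply: her => //; apply: (tet_center hK).
move=> /connectP[l]; elim: l s sT v vs => [|s1 l IH] s sT v vs /=.
  move=> _ e; apply: (loc (exist _ s sT)); first by case/setD1P: vs.
  by rewrite /= -e; case/setD1P: ws.
case/andP=> /and5P[_ s1T gs gs1 /eqP c3] hp hl.
have [z] : exists z, z \in (s :&: s1) :\ g.
  by apply/set0Pn; rewrite -card_gt0; move: c3; rewrite (cardsD1 g) inE gs gs1; case: #|_|.
rewrite !inE => /and3P[zg zs zs1].
have zl : z \in s :\ g by rewrite in_setD1 zg.
have [z' ez] := @vert_of (exist _ s sT) z zl.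
transitivity (y z').
  by apply: (loc (exist _ s sT)); rewrite ?ez //; case/setD1P: vs.
by apply: (IH s1) => //; rewrite ez in_setD1 zg.
Qed.

Lemma link_adjacent (s : T3) (v w : W) : v != w -> val v \in val s -> val w \in val s ->
  adjacent ta tb v w.
Proof.
move=> vw vs ws; have [t _ h] := link_tri vw vs ws; apply/existsP; exists t.
by case: h => -[-> ->]; rewrite !eqxx ?orbT.
Qed.

(** A tetrahedron at [v] supplies two neighbours [a] and [b]. The tetrahedron on the other side of
    the triangle [g v a] supplies a third, different from [b] because the determinants have opposite
    signs. *)
Lemma link_valency3 (v : W) : exists u : W * W * W,
  [/\ adjacent ta tb v u.1.1, adjacent ta tb v u.1.2 & adjacent ta tb v u.2] /\
  uniq [:: v; u.1.1; u.1.2; u.2].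
Proof.
have /(vertP hK)[s sT vl] := valP v.
have [a0] : exists x : V, x \in s :\ g :\ val v.
  apply/set0Pn; rewrite -card_gt0; have := tet_card_link hK sT.
  by rewrite (cardsD1 (val v)) vl; case: #|_|.
rewrite in_setD1 => /andP[av al]; rewrite eq_sym in av.
have [b0 o] := opposite_exists hK sT vl al av.
have [s' [u0 [s'T o' neq]]] : exists s' u, [/\ s' \in tets, opposite s' (val v) a0 u & u != b0].
  have := triple_neq0 hK sT o; rewrite neq_lt => /orP[h|h].
    have [s' [u [s'T o' h']]] := side_exists hK sT vl al av.
    by exists s', u; split=> //; apply/eqP => e; move: h'; rewrite e ltNge (ltW h).
  rewrite eq_sym in av; have [s' [u [s'T o' h']]] := side_exists hK sT al vl av.
  exists s', u; split=> //; first exact: opposite_swap.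
  by apply/eqP => e; move: h'; rewrite e tripleC oppr_gt0 ltNge (ltW h).
have bl : b0 \in s :\ g by case: o.
have ul : u0 \in s' :\ g by case: o'.
have [a ea] := @vert_of (exist _ s sT) a0 al.
have [b eb] := @vert_of (exist _ s sT) b0 bl.
have [u eu] := @vert_of (exist _ s' s'T) u0 ul.
have vl' : val v \in s' :\ g by case: o'.
move: (o) (o') => [_ _ _ + _] [_ _ _ + _].
rewrite /= !inE !negb_or -ea -eb -eu !val_eqE.
move=> /andP[/andP[va vb] /andP[ab _]] /andP[/andP[_ vu] /andP[au _]].
move/setD1P: vl => [_ vs]; move/setD1P: vl' => [_ vs'].
move/setD1P: al => [_ als]; move/setD1P: bl => [_ bs]; move/setD1P: ul => [_ us].
exists (a, b, u); split=> /=.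
  split.
  - by apply: (@link_adjacent (exist _ s sT)); rewrite // ea.
  - by apply: (@link_adjacent (exist _ s sT)); rewrite // eb.
  - by apply: (@link_adjacent (exist _ s' s'T)); rewrite // eu.
rewrite !inE !negb_or va vb vu ab au eq_sym /= andbT.
by move: neq; rewrite -eu -eb val_eqE.
Qed.

Lemma card_vert_ge4 : (4 <= #|W|)%N.
Proof.
have [s sT _] := fan_complete hK 0.
have [v0 vl] : exists v, v \in s :\ g.
  by apply/set0Pn; rewrite -card_gt0 (tet_card_link hK).
have [v _] := @vert_of (exist _ s sT) v0 vl.
have [u [_ un]] := link_valency3 v.
by rewrite -[4%N]/(size [:: v; u.1.1; u.1.2; u.2]) -(card_uniqP un) max_card.
Qed.

End FanData.

(** * Algebraic splines on the star *)

Lemma lform_eq0 (R : realFieldType) (c : 'rV[R]_3) : lform c = 0 -> c = 0.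
Proof.
move=> h; apply/rowP => i; rewrite mxE.
have := mderiv_lform i c; rewrite h linear0 => /esym/eqP.
by rewrite mpolyC_eq0 => /eqP.
Qed.

Lemma sum_sig (S : nmodType) (I : finType) (A : {set I}) (f : I -> S) :
  \sum_(x : {i | i \in A}) f (val x) = \sum_(i in A) f i.
Proof.
rewrite [RHS](reindex_omap (val : {i | i \in A} -> I) insub) /=; last first.
  by move=> i iA; rewrite insubT.
by apply: eq_bigl => x; rewrite (valP x) /= valK eqxx.
Qed.

Section FanBound.
Variables (R : realType) (V : finType) (K : complex R V) (g : V).
Hypothesis hK : closed_vertex_star K g.
Local Notation p := (pos K).
Local Notation tets := (tetrahedra K).
Local Notation mp := (mpoly 3 R).
Local Notation W := (W K g).
Local Notation ta := (ta hK).
Local Notation tb := (tb hK).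
Local Notation sp := (sp hK).
Local Notation sm := (sm hK).

(** Double counting: a triangle has two sides, and a tetrahedron is a side of at most three
    triangles, each obtained by removing a vertex other than [g]. *)
Lemma euler_tris : (2 * #|T2 K| <= 3 * #|T3 K|)%N.
Proof.
have -> : (2 * #|T2 K| = \sum_(t : T2 K) \sum_(s : T3 K) ((sp t == s) + (sm t == s)))%N.
  rewrite mulnC -sum_nat_const; apply: eq_bigr => t _.
  have one (a : T3 K) : (\sum_(s : T3 K) (a == s) = 1)%N.
    by rewrite (bigD1 a) //= eqxx big1 ?addn0 // => s /negbTE; rewrite eq_sym => ->.
  by rewrite big_split /= !one.
rewrite exchange_big mulnC -sum_nat_const /=; apply: leq_sum => s _.
have spm t : sp t != sm t.
  apply/eqP => e; have [u o h] := sp_spec hK t; have [u' o' h'] := sm_spec hK t.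
  rewrite -e in o'; move: h h'; rewrite (opposite_uniq o o') => h h'.
  by move: (lt_trans h h'); rewrite ltxx.
have -> : (\sum_t ((sp t == s) + (sm t == s)) =
    #|[set t | (sp t == s) || (sm t == s)]%SET|)%N.
  rewrite -sum1_card [RHS]big_mkcond /=; apply: eq_bigr => t _; rewrite inE.
  by have := spm t; case: (sp t =P s) => [->|_]; case: (sm t =P s) => [->|_] //; rewrite eqxx.
rewrite -(card_imset _ val_inj).
rewrite -(tet_card_link hK (valP s)); apply: leq_trans (leq_imset_card (fun v => val s :\ v) _).
apply/subset_leq_card/fintype.subsetP => _ /imsetP[t + ->]; rewrite inE => ts.
have [u o] : exists u, opposite g (val s) (val (ta t)) (val (tb t)) u.
  by case/orP: ts => /eqP <-; [have [u o _] := sp_spec hK t|have [u o _] := sm_spec hK t]; exists u.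
apply/imsetP; exists u; first by case: o.
case: o => al bl ul; rewrite /= !inE !negb_or => /andP[/andP[ab au] /andP[bu _]] h.
move/setD1P: (al) => [ag as_]; move/setD1P: (bl) => [bg bs]; move/setD1P: (ul) => [ug us].
apply/setP => z; rewrite (val_tri hK) !inE.
apply/idP/idP => [/or3P[]/eqP ->|/andP[zu zs]].
- by rewrite eq_sym ug (tet_center hK (valP s)).
- by rewrite au as_.
- by rewrite bu bs.
have [//|zg] := eqVneq z g.
by have : z \in val s :\ g; [rewrite in_setD1 zg|move/h; rewrite !inE (negbTE zu) orbF].
Qed.

Lemma interior_edges : interior_faces K 1 = [set [set g; v] | v in verts K g]%SET.
Proof.
apply/setP => s; rewrite (interior_facesE hK) inE; apply/andP/imsetP => [|[v + ->]].
  move=> [+ gs]; rewrite inE => /andP[sK /eqP cs].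
  have : #|s :\ g| == 1%N by move: cs; rewrite (cardsD1 g) gs add1n => -[->].
  move=> /cards1P[v e]; have es : s = [set g; v]%SET by rewrite -e finset.setD1K.
  exists v => //; rewrite inE -es sK andbT.
  by have : v \in s :\ g; [rewrite e finset.in_set1|case/setD1P].
rewrite inE => /andP[vg vK]; rewrite inE vK cards2 [g == v]eq_sym vg; split=> //.
by rewrite !inE eqxx.
Qed.

Lemma edge_inj : {in verts K g &, injective (fun v => [set g; v]%SET)}.
Proof.
move=> v w; rewrite inE => /andP[vg _] _ e.
by have := set22 g v; rewrite e !inE (negbTE vg) => /eqP.
Qed.

Lemma card_verts : #|W| = #|interior_faces K 1|.
Proof. by rewrite interior_edges card_in_imset ?card_sig //; apply: edge_inj. Qed.

Lemma sum_edges (S : nmodType) (f : {set V} -> S) :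
  \sum_(s in interior_faces K 1) f s = \sum_(v : W) f [set g; val v]%SET.
Proof.
rewrite (sum_sig (verts K g) (fun v => f [set g; v]%SET)) interior_edges.
by rewrite big_imset //; apply: edge_inj.
Qed.

Lemma tri_face t : t \in interior_faces K 2 -> t \in faces_dim K 2.
Proof. by rewrite inE => /andP[]. Qed.

Lemma valencyE (v : W) : valency ta tb v = n_edge K [set g; val v]%SET.
Proof.
rewrite /valency -(card_imset _ val_inj) /n_edge; apply: eq_card => t; rewrite inE.
apply/imsetP/andP => [[t' + ->]|[tF vt]].
  rewrite inE => ht; split.
    exact: tri_face (valP t').
  apply/fintype.subsetP => z; rewrite (val_tri hK) !inE => /orP[]/eqP ->; rewrite ?eqxx //.
  by case/orP: ht => /eqP ->; rewrite eqxx ?orbT.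
have tI : t \in interior_faces K 2.
  rewrite (interior_facesE hK) inE tF; apply: (fintype.subsetP vt).
  by rewrite !inE eqxx.
exists (exist _ t tI) => //; rewrite inE.
have : val v \in t by apply: (fintype.subsetP vt); rewrite !inE eqxx orbT.
rewrite {1}[t](val_tri hK (exist _ t tI)) !inE (negbTE (vert_neq v)) !val_eqE.
by rewrite ![v == _]eq_sym.
Qed.

Lemma degree_bound_Dgamma r d : (Dgamma K r < d)%N ->
  (r < d)%N /\ degree_bound #|W| d (d - r).
Proof.
have := card_vert_ge4 hK; rewrite card_verts /Dgamma /degree_bound.
move: #|interior_faces K 1| => n n4.
have [->|n4'] := eqVneq n 4%N; first by lia.
have [->|n5'] := eqVneq n 5%N; first by lia.
lia.
Qed.

(** Form and cofactor stay existential, so that partial derivatives of a compatible family are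
    compatible one order lower, with the same form. *)
Definition compatible r (F : {set V} -> mp) : Prop :=
  forall s t, s \in tets -> t \in tets -> #|s :&: t| = 3%N ->
    exists (c : 'rV[R]_3) (h : mp), F s - F t = lform c ^+ r.+1 * h /\
      forall v, v \in s :&: t -> \sum_i c 0 i * p v 0 i = 0.

Lemma adjacent_sides (s s' : T3 K) : #|val s :&: val s'| = 3%N -> exists t : T2 K,
  val t = val s :&: val s' /\ ((sp t = s /\ sm t = s') \/ (sp t = s' /\ sm t = s)).
Proof.
move=> c3.
have gs : g \in val s :&: val s' by rewrite inE !(tet_center hK) //; apply: valP.
have tI : val s :&: val s' \in interior_faces K 2.
  rewrite (interior_facesE hK) inE gs andbT inE c3 eqxx andbT.
  apply: (sub_face hK (tet_face (valP s))); first exact: finset.subsetIl.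
  by apply/set0Pn; exists g.
pose t : T2 K := exist _ (val s :&: val s') tI.
exists t; split=> //.
have [al bl] := @ends_sub _ _ _ _ hK t _ (valP s) (finset.subsetIl _ _).
have [al' bl'] := @ends_sub _ _ _ _ hK t _ (valP s') (finset.subsetIr _ _).
have ab : val (ta t) != val (tb t) by rewrite val_eqE ta_neq_tb.
have [u o] := opposite_exists hK (valP s) al bl ab.
have [u' o'] := opposite_exists hK (valP s') al' bl' ab.
have ss' : s != s'.
  apply/eqP => e; move: c3; rewrite e finset.setIid (tet_card (valP s')); lia.
have := triple_neq0 hK (valP s) o; have := triple_neq0 hK (valP s') o'.
rewrite !neq_lt => /orP[h'|h'] /orP[h|h].
- case/eqP: ss'; transitivity (sm t); last by apply/eqP; rewrite (smP o').
  by apply/esym/eqP; rewrite (smP o).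
- by left; split; apply/eqP; rewrite ?(spP o) ?(smP o').
- by right; split; apply/eqP; rewrite ?(spP o') ?(smP o).
- case/eqP: ss'; transitivity (sp t); last by apply/eqP; rewrite (spP o').
  by apply/esym/eqP; rewrite (spP o).
Qed.

Lemma edge_count_edge r d (v : W) :
  ((edge_count r d (valency ta tb v))%:Z =
   (t_edge K r [set g; val v]%SET)%:Z * ('C(d + 1 - r, 2))%:Z -
   ((a_edge K r [set g; val v]%SET)%:Z * ('C(d + 1 - q_edge K r [set g; val v]%SET, 2))%:Z
    + (b_edge K r [set g; val v]%SET)%:Z * ('C(d + 2 - q_edge K r [set g; val v]%SET, 2))%:Z))%R.
Proof.
rewrite valencyE; set e := [set g; val v]%SET.
have n2 : (2 <= n_edge K e)%N.
  have [u [[/existsP[t1 h1] /existsP[t2 h2] _] un]] := link_valency3 hK v.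
  rewrite -valencyE /valency (cardsD1 t1) inE.
  have -> : (ta t1 == v) || (tb t1 == v) by case/orP: h1 => /andP[/eqP -> /eqP ->]; rewrite eqxx ?orbT.
  rewrite add1n ltnS; apply/card_gt0P; exists t2; rewrite !inE.
  have -> : (ta t2 == v) || (tb t2 == v) by case/orP: h2 => /andP[/eqP -> /eqP ->]; rewrite eqxx ?orbT.
  rewrite andbT; apply: contraTneq un => et; rewrite et in h2.
  move: h1 h2 => /orP[]/andP[/eqP <- /eqP <-] /orP[]/andP[/eqP e1 /eqP e2];
  by rewrite -?e1 -?e2 /= !inE ?e1 ?e2 ?eqxx ?orbT ?andbF.
have t2 : (2 <= t_edge K r e)%N by rewrite /t_edge leq_min n2.
rewrite edge_count_cap -/(t_edge K r e).
have := edge_count_binomial r d t2.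
rewrite /= -/(q_edge K r e) -/(a_edge K r e) -/(b_edge K r e).
move=> /(congr1 Posz); rewrite !PoszD !PoszM => h; apply/eqP; rewrite eq_sym subr_eq.
by rewrite -h addrA.
Qed.

Lemma fan_splines r d : (Dgamma K r < d)%N -> exists n : nat,
  (LBcs K d r <= n%:Z)%R /\ exists f : 'I_n -> {set V} -> mp,
  [/\ forall k s, f k s \is hom R d, forall k, compatible r (f k)
    & forall c : 'I_n -> R, (forall s, s \in tets -> \sum_k c k *: f k s = 0) ->
        forall k, c k = 0].
Proof.
move=> hd; have [rd db] := degree_bound_Dgamma hd.
have [n [hn [f [h [fh fE fi]]]]] := algebraic_spline_family (fun v => p (val v))
  (boundary_closed hK) (@link_connected _ _ _ _ hK) (ta_neq_tb hK) (link_valency3 hK) rd db.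
exists n; split.
  rewrite /LBcs !sum_edges.
  set T := \sum_(v : W) _; set Y := \sum_(v : W) _.
  have eS : (\sum_v edge_count r d (valency ta tb v))%N%:Z = T * ('C(d + 1 - r, 2))%:Z - Y.
    rewrite (big_morph Posz PoszD (erefl (Posz 0))) /T /Y mulr_suml -sumrB.
    by apply: eq_bigr => v _; apply: edge_count_edge.
  clearbody T Y.
  (* From [f3 + 4 <= 2 f1] and [2 f2 <= 3 f3] follows [f2 + 2 <= f3 + f1], the source of the leading
     coefficient 2 in [LBcs]. *)
  have e3 : (#|T3 K| + 4 <= 2 * #|W|)%N by rewrite !card_sig; apply: euler_tets hK.
  have c2 : #|T2 K| = #|interior_faces K 2| by rewrite card_sig.
  have e : ((#|T2 K| + 2) * 'C(d + 2, 2) <= (#|T3 K| + #|W|) * 'C(d + 2, 2))%N.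
    by rewrite leq_mul2r; apply/orP; right; have := euler_tris; lia.
  rewrite -c2; move: hn e eS; rewrite !mulnDl.
  move: (\sum_v edge_count r d (valency ta tb v))%N #|T3 K| #|T2 K| #|W| => S f3 f2 f1.
  move: 'C(d + 2, 2) 'C(d + 1 - r, 2) => N N' hn e eS.
  have h2 : (2 * N + f2 * N' <= n + S)%N by lia.
  have hZ : (2 * N%:Z + f2%:Z * N'%:Z <= n%:Z + S%:Z)%R by rewrite -!PoszM -!PoszD lez_nat.
  have -> : 2 * N%:Z + (f2%:Z - T) * N'%:Z + Y = (2 * N%:Z + f2%:Z * N'%:Z) - S%:Z.
    by rewrite eS; ring.
  by rewrite lerBlDr.
exists (fun k s => if insub s is Some s' then f k s' else 0); split.
- by move=> k s; case: insubP => [s' _ _|_]; [apply: fh|rewrite dhomog0].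
- move=> k s t sT tT c3; rewrite !insubT /=.
  have [t2 [et2 sides]] := @adjacent_sides (exist _ s sT) (exist _ t tT) c3.
  exists (cross (p (val (ta t2))) (p (val (tb t2)))).
  have vanish v : v \in s :&: t -> \sum_i cross (p (val (ta t2))) (p (val (tb t2))) 0 i * p v 0 i = 0.
    rewrite -et2 (val_tri hK) !inE => /or3P[]/eqP ->.
    - by rewrite (pos_center hK); apply: triple0.
    - exact: triple_l.
    - exact: triple_r.
  case: sides => -[e1 e2].
    by exists (h k t2); rewrite -fE e1 e2.
  by exists (- h k t2); split=> //; rewrite mulrN -fE e1 e2 opprB.
move=> c hc; apply: fi => [s|t].
  by rewrite -[RHS](hc (val s) (valP s)); apply: eq_bigr => k _; rewrite valK.
(* The form of a triangle is nonzero at the given positions. So a vanishing combination of the [f]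
   makes that of the cofactors vanish too, and independence of pairs becomes independence of the [f]
   alone. *)
have lne : lform (cross (p (val (ta t))) (p (val (tb t)))) != 0.
  apply/eqP => /lform_eq0/eqP; apply/negP.
  have [u [al bl _ un _] _] := sp_spec hK t.
  by apply: (cross_neq0 hK (valP (sp t)) al bl); rewrite val_eqE ta_neq_tb.
have : lform (cross (p (val (ta t))) (p (val (tb t)))) ^+ r.+1 * \sum_k c k *: h k t = 0.
  rewrite mulr_sumr.
  under eq_bigr => k _ do rewrite -scalerAr -fE scalerBr.
  rewrite sumrB.
  have z (s : T3 K) : \sum_k c k *: f k s = 0.
    by rewrite -[RHS](hc (val s) (valP s)); apply: eq_bigr => k _; rewrite valK.
  by rewrite !z subrr.
by move/eqP; rewrite mulf_eq0 expf_eq0 (negbTE lne) andbF => /eqP.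
Qed.

End FanBound.

(** * Polynomial functions *)

Section PolynomialFunctions.
Variable R : realType.
Local Notation mp := (mpoly 3 R).
Local Notation E := 'rV[R]_3.
Implicit Types (x y : E) (q : mp).
Local Open Scope classical_set_scope.

Definition pev q x : R := meval (x 0) q.

Lemma mpoly_ind_mul (P : mp -> Prop) : lin_closed P -> P 1 ->
  (forall i q, P q -> P (vx R i * q)) -> forall q, P q.
Proof.
move=> [P0 PD] P1 PM q.
have mon (m : multinom 3) : P (mpolyX R m).
  move: {2}(mdeg m) (erefl (mdeg m)) => d; elim: d m => [|d IH] m md.
    have -> : m = mnm0 by apply/eqP; rewrite -mdeg_eq0 md.
    by rewrite mpolyX0.
  have [i em] : exists i, m = mnm_add (mnm1 i) (mnm_sub m (mnm1 i)).
    by apply: multinom_divisible; rewrite md.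
  rewrite em mpolyXD; move: md; rewrite {1}em mdegD mdeg1 add1n => -[md'].
  exact/PM/IH.
rewrite (mpolyE q); apply: (big_ind P) => // [f g Pf Pg|m _].
  by rewrite -[f]scale1r; apply: PD.
by rewrite -[X in P X]addr0; apply: PD.
Qed.

Lemma pev_vx i x : pev (vx R i) x = x 0 i.
Proof. by rewrite /pev /vx mevalXU. Qed.

Lemma pev_lform (c : 'rV[R]_3) x : pev (lform c) x = \sum_i c 0 i * x 0 i.
Proof.
rewrite /pev /lform rmorph_sum /=; apply: eq_bigr => i _.
by rewrite mevalZ -/(pev _ _) pev_vx.
Qed.

Lemma is_derive_of_cvg (f : E -> R) x v l :
  (fun h : R => h^-1 *: ((f \o shift x) (h *: v) - f x)) @ 0^' --> l ->
  is_derive x v f l.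
Proof. by move=> h; apply: DeriveDef; [apply: cvgP h|apply: cvg_lim h]. Qed.

Lemma coord_is_derive x (i j : 'I_3) :
  is_derive x (delta_mx 0 i : E) (fun y : E => y 0 j) (i == j)%:R.
Proof.
apply: is_derive_of_cvg.
have H : \forall h \near (0 : R)^',
    cst ((i == j)%:R : R) h = h^-1 *: (((fun y : E => y 0 j) \o shift x) (h *: delta_mx 0 i) - x 0 j).
  near=> h; have h0 : h != 0 by near: h; apply: nbhs_dnbhs_neq.
  by rewrite /= !mxE eqxx /= addrK eq_sym [RHS]mulrA mulVf // mul1r.
by apply: cvg_trans (near_eq_cvg H) _; apply: cvg_cst.
Unshelve. all: by end_near. Qed.

Lemma pev_is_derive q x (i : 'I_3) :
  is_derive x (delta_mx 0 i : E) (pev q) (pev (mderiv i q) x).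
Proof.
move: q x; apply: mpoly_ind_mul => [|x|j q hq x].
- split=> [x|c f g hf hg x].
    rewrite linear0 (_ : pev 0 = cst 0); last by apply/funext => y; rewrite /pev meval0.
    exact: is_derive_cst.
  rewrite (_ : pev _ = c *: pev f + pev g); last first.
    by apply/funext => y; rewrite /pev mevalD mevalZ.
  apply: is_derive_eq; rewrite linearP /= /pev mevalD mevalZ.
  by [].
- rewrite (_ : pev 1 = cst 1); last by apply/funext => y; rewrite /pev meval1.
  by rewrite -mpolyC1 mderivC /pev meval0; apply: is_derive_cst.
rewrite (_ : pev _ = (fun y : E => y 0 j) * pev q); last first.
  by apply/funext => y; rewrite fctE /= /pev mevalM -/(pev (vx R j) y) pev_vx.
have hx := coord_is_derive x i j.
apply: is_derive_eq; rewrite mderivM mderiv_vx /pev mevalD !mevalM mevalC.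
rewrite -[meval _ (vx R j)]/(pev (vx R j) x) pev_vx.
by rewrite addrC; congr (_ + _); rewrite mulrC.
Qed.

Lemma pev_continuous q : continuous (pev q).
Proof.
move: q; apply: mpoly_ind_mul => [|x|j q hq x].
- split=> [x|c f g hf hg x].
    rewrite (_ : pev 0 = cst 0); last by apply/funext => y; rewrite /pev meval0.
    exact: cst_continuous.
  rewrite (_ : pev _ = c *: pev f + pev g); last first.
    by apply/funext => y; rewrite /pev mevalD mevalZ.
  by apply: continuousD; [apply: continuousZl_tmp; apply: hf|apply: hg].
- rewrite (_ : pev 1 = cst 1); last by apply/funext => y; rewrite /pev meval1.
  exact: cst_continuous.
rewrite (_ : pev _ = (fun y : E => y 0 j) * pev q); last first.
  by apply/funext => y; rewrite fctE /= /pev mevalM -/(pev (vx R j) y) pev_vx.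
by apply: continuousM; [apply: coord_continuous|apply: hq].
Qed.

(** Induction on a degree bound: the partial derivatives also vanish on [U], hence are zero, which
    in characteristic 0 leaves a constant. *)
Lemma pev_eq0_open (U : set E) x0 q : open U -> U x0 ->
  (forall x, U x -> pev q x = 0) -> q = 0.
Proof.
move=> oU Ux0.
suff H k : forall q, (forall m, mcoeff m q != 0 -> (mdeg m < k)%N) ->
    (forall x, U x -> pev q x = 0) -> q = 0.
  by apply: (H (mmeasure mdeg q)) => m; rewrite -mcoeff_msupp => /msize_mdeg_lt.
elim: k => [|k IH] {}q hq qU.
  by apply/mpolyP => m; rewrite mcoeff0; apply: contraTeq isT => /hq.
have dq i : mderiv i q = 0.
  apply: IH => [m|x Ux].
    rewrite mcoeff_mderiv => h; have : mcoeff (mnm_add m (mnm1 i)) q != 0.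
      by apply: contraNneq h => ->; rewrite mul0rn.
    by move/hq; rewrite mdegD mdeg1 addn1 ltnS.
  have := @derive_val _ _ _ _ _ _ _ (pev_is_derive q x i) => <-.
  rewrite (@near_eq_derive _ _ _ (pev q) (cst 0)) ?derive_cst //.
  by apply: filterS (open_nbhs_nbhs (conj oU Ux)) => y /qU.
have q0 m : m != mnm0 -> mcoeff m q = 0.
  rewrite -mdeg_eq0 => md.
  have [i em] : exists i, m = mnm_add (mnm1 i) (mnm_sub m (mnm1 i)).
    by apply: multinom_divisible; rewrite lt0n.
  rewrite addmC in em.
  have := mcoeff_mderiv i q (mnm_sub m (mnm1 i)); rewrite dq mcoeff0 -em => /esym/eqP.
  by rewrite -mulr_natr mulf_eq0 pnatr_eq0 orbF => /eqP.
have qC : q = mpolyC 3 (mcoeff mnm0 q).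
  apply/mpolyP => m; rewrite mcoeffC; case: eqP => [->|/eqP m0]; first by rewrite mulr1.
  by rewrite mulr0 q0 // eq_sym.
by have := qU _ Ux0; rewrite qC /pev mevalC => ->; rewrite mpolyC0.
Qed.

Lemma pev_eq0 x0 q : (\forall x \near x0, pev q x = 0) -> q = 0.
Proof.
move=> h; apply: (@pev_eq0_open [set x | pev q x = 0]° x0) => //.
  exact: open_interior.
by move=> x /interior_subset.
Qed.

Lemma continuous_near_eq (f h : E -> R) x : f x = h x ->
  (\forall y \near x, f y = h y) -> {for x, continuous f} -> {for x, continuous h}.
Proof.
move=> fhx fh fc A; rewrite -fhx => /fc hA.
have hA' : nbhs x (f @^-1` A) := hA.
suff : nbhs x (h @^-1` A) by [].
by apply: filterS2 fh hA' => y /= <-.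
Qed.

Lemma Cr_on_ext r (U : set E) (f h : E -> R) : open U ->
  (forall x, U x -> f x = h x) -> Cr_on r U f -> Cr_on r U h.
Proof.
move=> oU; elim: r f h => [|r IH] f h fh [fc fd].
  split=> // x Ux.
  have near_fh : \forall y \near x, f y = h y.
    by apply: filterS (open_nbhs_nbhs (conj oU Ux)) => y /fh.
  exact: continuous_near_eq (fh _ Ux) near_fh (fc _ Ux).
have near_fh x : U x -> \forall y \near x, f y = h y.
  by move=> Ux; apply: filterS (open_nbhs_nbhs (conj oU Ux)) => y /fh.
split=> [x Ux|i].
  exact: continuous_near_eq (fh _ Ux) (near_fh x Ux) (fc _ Ux).
have [fdi fDi] := fd i; split=> [x Ux|].
  by apply: near_eq_derivable (near_fh x Ux) (fdi x Ux).
apply: IH fDi => x Ux; exact: near_eq_derive (near_fh x Ux).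
Qed.

Lemma lin_continuous (a : R) (f h : E -> R) x : {for x, continuous f} ->
  {for x, continuous h} -> {for x, continuous (fun x => a * f x + h x)}.
Proof.
move=> fc hc; rewrite (_ : (fun x => _) = a *: f + h); last by apply/funext.
by apply: continuousD => //; apply: continuousZl_tmp.
Qed.

Lemma Cr_on_lin r (U U' : set E) (a : R) (f h : E -> R) : open U -> open U' ->
  Cr_on r U f -> Cr_on r U' h -> Cr_on r (U `&` U') (fun x => a * f x + h x).
Proof.
move=> oU oU'; elim: r f h => [|r IH] f h [fc fd] [hc hd].
  by split=> // x [Ux Ux']; apply: lin_continuous; [apply: fc|apply: hc].
split=> [x [Ux Ux']|i].
  by apply: lin_continuous; [apply: fc|apply: hc].
have [fdi fDi] := fd i; have [hdi hDi] := hd i.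
have der x : U x -> U' x -> is_derive x (delta_mx 0 i : E) (fun x => a * f x + h x)
    (a * 'D_(delta_mx 0 i) f x + 'D_(delta_mx 0 i) h x).
  move=> Ux Ux'; have d1 := derivableP (fdi x Ux); have d2 := derivableP (hdi x Ux').
  rewrite (_ : (fun x => _) = a *: f + h); last by apply/funext.
  exact: is_derive_eq.
split=> [x [Ux Ux']|]; first by case: (der x Ux Ux').
apply: (@Cr_on_ext _ _ (fun x => a * 'D_(delta_mx 0 i) f x + 'D_(delta_mx 0 i) h x)).
- exact: openI.
- by move=> x [Ux Ux']; case: (der x Ux Ux').
- exact: IH.
Qed.

End PolynomialFunctions.

(** * Smoothness of piecewise polynomials *)

Section Piecewise.
Variables (R : realType) (V : finType) (K : complex R V) (g : V).
Hypothesis hK : closed_vertex_star K g.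
Local Notation p := (pos K).
Local Notation tets := (tetrahedra K).
Local Notation mp := (mpoly 3 R).
Local Notation E := 'rV[R]_3.
Local Notation co := (co hK).
Local Notation cone := (cone K).
Implicit Types (F : {set V} -> mp) (s t : {set V}) (x y : E).
Local Open Scope classical_set_scope.

Lemma coE s v x : co s v x = pev (lform (lam hK s v)^T) x.
Proof.
by rewrite pev_lform co_def mxE; apply: eq_bigr => i _; rewrite mxE mulrC.
Qed.

Lemma co_continuous s v : continuous (co s v).
Proof.
by rewrite (_ : co s v = pev (lform (lam hK s v)^T)); [apply: pev_continuous|apply/funext => x; apply: coE].
Qed.

(** The cones are closed and finite in number, so those missing [x] miss a neighbourhood of it. Near
    [x] only pieces whose cones contain [x] occur. *)
Lemma near_cone x : \forall y \near x, forall s, s \in tets -> cone s y -> cone s x.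
Proof.
apply: (@filter_forall E {set V} (fun s => [set y | s \in tets -> cone s y -> cone s x]) (nbhs x)).
move=> s; have [sT|_] := boolP (s \in tets); last by apply: nearW => y.
have [cx|ncx] := pselect (cone s x); first by apply: nearW => y.
have [v vs neg] : exists2 v, v \in s :\ g & co s v x < 0.
  apply: contrapT => h; apply: ncx; apply/(coneP hK _ sT) => v vs.
  by rewrite leNgt; apply/negP => neg; apply: h; exists v.
apply: filterS (cvgr_lt (co s v x) (@co_continuous s v x) 0 neg) => y cy _.
by move/(coneP hK _ sT)/(_ v vs); rewrite leNgt cy.
Qed.

Definition agree F : Prop := forall s t x, s \in tets -> t \in tets ->
  cone s x -> cone t x -> pev (F s) x = pev (F t) x.

Lemma compatible_at r F s t x : compatible K r F -> s \in tets -> t \in tets ->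
  #|s :&: t| = 3%N -> (exists2 c : V -> R, (forall v, c v != 0 -> v \in s :&: t)
     & x = \sum_(v in s) c v *: p v) ->
  pev (F s) x = pev (F t) x.
Proof.
move=> hF sT tT c3 [c hc ->]; have [l [h [e lv]]] := hF _ _ sT tT c3.
set x0 := \sum_(v in s) _.
apply/eqP; rewrite -subr_eq0 /pev -mevalB e mevalM rmorphXn /=.
rewrite -[meval _ (lform l)]/(pev (lform l) x0) pev_lform.
rewrite (_ : \sum_i _ = 0) ?expr0n ?mul0r //.
under eq_bigr => i _ do rewrite summxE mulr_sumr.
rewrite exchange_big big1 //= => v vs.
have [->|/hc/lv h0] := eqVneq (c v) 0; first by apply: big1 => i _; rewrite mxE mul0r mulr0.
under eq_bigr => i _ do rewrite mxE mulrCA.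
by rewrite -mulr_sumr h0 mulr0.
Qed.

(** Two tetrahedra around a ray may share no triangle; the hereditary property joins them by a chain
    whose shared triangles all contain [v], so all their planes contain the ray. *)
Lemma compatible_chain r F s t v (c : R) : compatible K r F -> s \in tets -> t \in tets ->
  v \in s -> v \in t -> pev (F s) (c *: p v) = pev (F t) (c *: p v).
Proof.
move=> hF sT tT vs vt.
have : connect (adjacent_at K v) s t by case: hK => [[_ _ _ her _] _]; apply: her.
move=> /connectP[l]; elim: l s sT vs => [|s1 l IH] s sT vs /=; first by move=> _ ->.
case/andP=> /and5P[_ s1T _ vs1 /eqP c3] hp hl.
rewrite -(IH s1 s1T vs1 hp hl); apply: (compatible_at hF sT s1T c3).
exists (fun w => if w == v then c else 0) => [w|].
  by case: (w =P v) => [-> _|_]; [rewrite inE vs|rewrite eqxx].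
by rewrite (big_setD1 v) //= eqxx big1 ?addr0 // => w /setD1P[/negbTE -> _]; rewrite scale0r.
Qed.

(** Cases by the positive coordinates of [x] in [s]. With at least two, [s] and [t] share a triangle
    or coincide; with one, [x] lies on the ray of a vertex; with none, [x] is the origin and the
    chain is taken at [g]. *)
Lemma compatible_agree r F : compatible K r F -> agree F.
Proof.
move=> hF s t x sT tT cs ct.
have [/existsP[a /existsP[b /and5P[ab al bl ca cb]]]|no2] := boolP
  [exists a, exists b, [&& a != b, a \in s :\ g, b \in s :\ g, 0 < co s a x & 0 < co s b x]].
  have [->//|st] := eqVneq s t.
  have at_ := co_gt0_mem sT tT cs ct al ca; have bt := co_gt0_mem sT tT cs ct bl cb.
  apply: (compatible_at hF sT tT).
    apply/eqP; rewrite eqn_leq; apply/andP; split.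
      rewrite -ltnS -(tet_card sT); apply: proper_card; rewrite properE finset.subsetIl /=.
      apply: contra st => sub; rewrite eqEcard (tet_card sT) (tet_card tT) leqnn andbT.
      by apply: fintype.subset_trans sub (finset.subsetIr _ _).
    have : (g |: [set a; b] \subset s :&: t)%SET.
      apply/fintype.subsetP => z; rewrite !inE => /or3P[]/eqP ->.
      - by rewrite !(tet_center hK).
      - by rewrite at_ andbT; case/setD1P: al.
      - by rewrite bt andbT; case/setD1P: bl.
    move/subset_leq_card; apply: leq_trans.
    rewrite cardsU1 cards2 ab !inE negb_or ![g == _]eq_sym.
    by case/setD1P: al => -> _; case/setD1P: bl => -> _.
  exists (fun v => if v \in s :\ g then co s v x else 0) => [v|].
    case: ifP => [vl|_]; last by rewrite eqxx.
    move=> c0; rewrite inE; apply/andP; split; first by case/setD1P: vl.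
    apply: (co_gt0_mem sT tT cs ct vl); rewrite lt_def c0 /=.
    exact: (coneP hK _ sT).1 cs v vl.
  by rewrite {1}(coP hK x sT) (sum_sub _ _ (finset.subsetDl _ _)).
have [/existsP[a /andP[al ca]]|no1] := boolP [exists a, (a \in s :\ g) && (0 < co s a x)].
  have ex : x = co s a x *: p a.
    rewrite {1}(coP hK x sT) (bigD1 a) //= big1 ?addr0 // => v /andP[vl va].
    have : ~~ (0 < co s v x).
      apply: contra no2 => cv; apply/existsP; exists a; apply/existsP; exists v.
      by rewrite eq_sym va al vl ca cv.
    rewrite lt_def negb_and negbK ((coneP hK _ sT).1 cs v vl) orbF => /eqP ->.
    by rewrite scale0r.
  rewrite ex; apply: (compatible_chain _ hF) => //; first by case/setD1P: al.
  exact: co_gt0_mem sT tT cs ct al ca.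
have ex : x = 0 *: p g.
  rewrite scale0r (coP hK x sT) big1 // => v vl.
  have : ~~ (0 < co s v x) by apply: contra no1 => cv; apply/existsP; exists v; rewrite vl.
  rewrite lt_def negb_and negbK ((coneP hK _ sT).1 cs v vl) orbF => /eqP ->.
  by rewrite scale0r.
by rewrite ex; apply: (compatible_chain _ hF) => //; apply: (tet_center hK).
Qed.

Definition sigma x : {set V} := s2val (cid2 (fan_complete hK x)).

Lemma sigma_tet x : sigma x \in tets.
Proof. by rewrite /sigma; case: cid2. Qed.

Lemma sigma_cone x : cone (sigma x) x.
Proof. by rewrite /sigma; case: cid2. Qed.

(** Defined on the whole space, which the cones cover, so that it is itself the extension demanded
    by [Cr_function]. *)
Definition pw F x : R := pev (F (sigma x)) x.

Lemma pwE F s x : agree F -> s \in tets -> cone s x -> pw F x = pev (F s) x.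
Proof. by move=> aF sT cs; apply: aF => //; [apply: sigma_tet|apply: sigma_cone]. Qed.

Lemma pw_continuous F : agree F -> continuous (pw F).
Proof.
move=> aF; suff H (x : E) : pw F y @[y --> x] --> pw F x by move=> x; apply: H.
apply/(cvgrPdist_lt (F := nbhs x) (FF := nbhs_filter x)) => e e0.
have H : \forall y \near x, forall s, `|pev (F s) x - pev (F s) y| < e.
  apply: (@filter_forall E {set V} (fun s => [set y | `|pev (F s) x - pev (F s) y| < e]) (nbhs x)).
  move=> s; have : pev (F s) y @[y --> x] --> pev (F s) x by apply: pev_continuous.
  by move/(cvgrPdist_lt (F := nbhs x) (FF := nbhs_filter x)); apply.
apply: filterS2 (near_cone x) H => y cy hy.
have cx : cone (sigma y) x by apply: cy; [apply: sigma_tet|apply: sigma_cone].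
by rewrite (pwE aF (sigma_tet y) cx); apply: hy.
Qed.

Lemma near_line x v (P : set E) : nbhs x P -> \forall h \near (0 : R)^', P (h *: v + x).
Proof.
move=> xP; have : (fun h : R => h *: v + x) @ (0 : R) --> x.
  rewrite -[X in _ --> X]add0r -(scale0r v).
  by apply: cvgD; [apply: cvgZr_tmp; apply: cvg_id|apply: cvg_cst].
move/(_ P xP) => h.
have h' : \forall k \near (0 : R), P (k *: v + x) := h.
by rewrite near_withinE; apply: filterS h' => k Pk _.
Qed.

(** A nearby point lies in a cone that also contains [x], so the difference quotient is that of one
    polynomial. There are finitely many of these, hence one neighbourhood serves them all. *)
Lemma pw_is_derive F x (i : 'I_3) : agree F -> agree (fun s => mderiv i (F s)) ->
  is_derive x (delta_mx 0 i : E) (pw F) (pw (fun s => mderiv i (F s)) x).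
Proof.
move=> aF aD; apply: is_derive_of_cvg; apply/cvgrPdist_lt => e e0.
have H : \forall h \near (0 : R)^', forall s, `|pev (mderiv i (F s)) x -
    h^-1 *: ((pev (F s) \o shift x) (h *: delta_mx 0 i) - pev (F s) x)| < e.
  apply: (@filter_forall R {set V} (fun s => [set h | `|pev (mderiv i (F s)) x -
    h^-1 *: ((pev (F s) \o shift x) (h *: delta_mx 0 i) - pev (F s) x)| < e]) (0 : R)^').
  move=> s; have [d1 d2] := pev_is_derive (F s) x i.
  by move: d1; rewrite /derivable => /cvgrPdist_lt /(_ e e0); rewrite -/(derive _ _ _) d2.
apply: filterS2 (near_line (delta_mx 0 i) (near_cone x)) H => h cy hy.
set y := h *: delta_mx 0 i + x in cy *.
have cx : cone (sigma y) x by apply: cy; [apply: sigma_tet|apply: sigma_cone].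
have := hy (sigma y).
by rewrite (pwE aD (sigma_tet y) cx) (pwE aF (sigma_tet y) cx).
Qed.

Lemma mderiv_pow i (f : mp) k :
  mderiv i (f ^+ k.+1) = (k.+1%:R *: f ^+ k) * mderiv i f.
Proof.
elim: k => [|k IH]; first by rewrite expr1 expr0 scale1r mul1r.
rewrite exprS mderivM {}IH -!mul_mpolyC -[k.+2%:R]natr1 mpolyCD mpolyC1 !exprS.
by ring.
Qed.

Lemma compatible_deriv r F i : compatible K r.+1 F ->
  compatible K r (fun s => mderiv i (F s)).
Proof.
move=> hF s t sT tT c3; have [l [h [e lv]]] := hF _ _ sT tT c3.
exists l, (mpolyC 3 (r.+2%:R * l 0 i) * h + lform l * mderiv i h); split=> //.
rewrite -linearB /= e mderivM mderiv_pow mderiv_lform -mul_mpolyC mpolyCM !exprS.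
by ring.
Qed.

Lemma pw_Cr r F : compatible K r F -> Cr_on r setT (pw F).
Proof.
elim: r F => [|r IH] F hF; have aF := compatible_agree hF.
  by split=> // x _; apply: pw_continuous.
split=> [x _|i]; first exact: pw_continuous.
have hD := compatible_deriv i hF; have aD := compatible_agree hD.
have der x := pw_is_derive x aF aD.
split=> [x _|]; first by case: (der x).
rewrite (_ : (fun x => _) = pw (fun s => mderiv i (F s))); first exact: IH.
by apply/funext => x; case: (der x).
Qed.

Lemma near_simplex s : s \in tets -> exists x0, \forall x \near x0, simplex K s x.
Proof.
(* This is the barycentre of [s]; the term of [g] is invisible because [g] is at the origin. *)
move=> sT; pose x0 : E := \sum_(v in s :\ g) (4^-1 : R) *: p v.
have c0 v : v \in s :\ g -> co s v x0 = 4^-1 by apply: co_uniq.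
have h0 : height hK s x0 < 1.
  rewrite /height (eq_bigr (fun=> 4^-1)) => [|v vl]; last exact: c0.
  by rewrite sumr_const (tet_card_link hK sT); lra.
exists x0.
have hc : continuous (height hK s).
  rewrite (_ : height hK s = pev (\sum_(v in s :\ g) lform (lam hK s v)^T)).
    exact: pev_continuous.
  apply/funext => x; rewrite /height /pev rmorph_sum /=; apply: eq_bigr => v _.
  exact: coE.
have H1 : \forall x \near x0, forall v, v \in s :\ g -> 0 < co s v x.
  apply: (@filter_forall E V (fun v => [set x | v \in s :\ g -> 0 < co s v x]) (nbhs x0)).
  move=> v; have [vl|_] := boolP (v \in s :\ g); last by apply: nearW.
  have pv : 0 < co s v x0 by rewrite c0 // invr_gt0 ltr0n.
  by apply: filterS (cvgr_gt (co s v x0) (@co_continuous s v x0) 0 pv) => x hx _.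
have H2 : \forall x \near x0, height hK s x < 1.
  exact: (cvgr_lt (height hK s x0) (hc x0) 1 h0).
apply: filterS2 H1 H2 => x cp h1.
pose c v := if v == g then 1 - height hK s x else co s v x.
have cl v : v \in s :\ g -> c v = co s v x by rewrite /c => /setD1P[/negbTE ->].
exists c; split.
- move=> v vs; rewrite /c; case: eqP => [_|/eqP vg]; first by lra.
  by apply/ltW/cp; rewrite in_setD1 vg.
- rewrite (big_setD1 g) ?(tet_center hK) //= {1}/c eqxx (eq_bigr _ cl) -/(height hK s x).
  by rewrite subrK.
- rewrite (sum_center hK) ?(tet_center hK) // {1}(coP hK x sT).
  by apply: eq_bigr => v vl; rewrite cl.
Qed.

Lemma simplex_poly_eq0 s (q : mp) : s \in tets ->
  (forall x, simplex K s x -> pev q x = 0) -> q = 0.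
Proof.
move=> sT h; have [x0 nx] := near_simplex sT.
by apply: (@pev_eq0 R x0); apply: filterS nx => x /h.
Qed.

Lemma realization_simplex x : realization K x -> exists2 s, s \in tets & simplex K s x.
Proof.
move=> [s sK [c [c0 c1 ->]]]; have [t tT st] := face_tet hK sK; exists t => //.
exists (fun v => if v \in s then c v else 0); split.
- by move=> v _; case: ifP => // /c0.
- rewrite -[RHS]c1 -big_mkcondr /=; apply: eq_bigl => v.
  by case: (boolP (v \in s)) => [/(fintype.subsetP st) ->|]; rewrite ?andbF.
- exact: sum_sub.
Qed.

End Piecewise.

(** * Dimensions of spline spaces *)

Lemma sum_bin2 D : (\sum_(0 <= i < D.+1) 'C(i + 2, 2) = 'C(D + 3, 3))%N.
Proof.
elim: D => [|D IH]; first by rewrite big_nat1.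
by rewrite big_nat_recr //= IH !addSn [RHS]binS -[(D + 2).+1]addnS.
Qed.

Section SplineSpaces.
Variables (R : realType) (V : finType) (K : complex R V) (g : V).
Hypothesis hK : closed_vertex_star K g.
Local Notation tets := (tetrahedra K).
Local Notation mp := (mpoly 3 R).
Local Notation E := 'rV[R]_3.
Local Open Scope classical_set_scope.

Lemma Cr_function_subspace r (F G : realization K -> R) a :
  Cr_function r F -> Cr_function r G -> Cr_function r (fun x => a * F x + G x).
Proof.
move=> [U [f [oU AU fr fE]]] [U' [f' [oU' AU' fr' fE']]].
exists (U `&` U'), (fun x => a * f x + f' x); split.
- exact: openI.
- by move=> x Ax; split; [apply: AU|apply: AU'].
- exact: Cr_on_lin.
- by move=> x; rewrite fE fE'.
Qed.

Lemma poly_spline_subspace r (P : pred mp) : P 0 ->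
  (forall a q q', P q -> P q' -> P (a *: q + q')) ->
  subspace [set F : realization K -> R | Cr_function r F /\
    forall s, s \in tets -> poly_on s P F].
Proof.
move=> P0 PD; split.
  split=> [|s _]; last by exists 0 => // x _; rewrite meval0.
  exists setT, (fun=> 0); split=> //; first exact: openT.
  have : Cr_on r setT (pw hK (fun=> 0)).
    apply: pw_Cr => s t _ _ _; exists 0, 0; rewrite mulr0 subrr; split=> // v _.
    by apply: big1 => i _; rewrite mxE mul0r.
  by congr Cr_on; apply/funext => x; rewrite /pw /pev meval0.
move=> a F G [Fr FP] [Gr GP]; split; first exact: Cr_function_subspace.
move=> s sT; have [q Pq Fq] := FP s sT; have [q' Pq' Gq'] := GP s sT.
exists (a *: q + q'); first exact: PD.
by move=> x xs; rewrite Fq // Gq' // mevalD mevalZ.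
Qed.

Lemma degree_lin d a (q q' : mp) : (mmeasure mdeg q <= d.+1)%N ->
  (mmeasure mdeg q' <= d.+1)%N -> (mmeasure mdeg (a *: q + q')%R <= d.+1)%N.
Proof.
move=> h h'; apply: leq_trans (mmeasureD_le _ _ _) _; rewrite geq_max h' andbT.
exact: leq_trans (mmeasureZ_le _ _ _) h.
Qed.

Lemma hom_degree d (q : mp) : q \is hom R d -> (mmeasure mdeg q <= d.+1)%N.
Proof.
move=> /dhomogP hq; rewrite mmeasureE; apply/bigmax_leqP_seq => m mq _.
by rewrite hq.
Qed.

Lemma splines_subspace r d : subspace (splines K r d).
Proof.
apply: poly_spline_subspace; first by rewrite mmeasure0.
by move=> a q q'; apply: degree_lin.
Qed.

Lemma homogeneous_subspace r d : subspace (homogeneous_splines K r d).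
Proof.
apply: poly_spline_subspace; first exact: dhomog0.
by move=> a q q' hq hq'; rewrite rpredD // rpredZ.
Qed.

Lemma homogeneous_sub r d : homogeneous_splines K r d `<=` splines K r d.
Proof.
move=> F [Fr FP]; split=> // s sT; have [q hq Fq] := FP s sT.
by exists q => //; apply: hom_degree.
Qed.

Lemma splines_sub r d : splines K r d `<=` splines K r d.+1.
Proof.
move=> F [Fr FP]; split=> // s sT; have [q hq Fq] := FP s sT.
by exists q => //; apply: leqW.
Qed.

Let tet_of (x : realization K) : {set V} := s2val (cid2 (realization_simplex hK (set_mem (valP x)))).

(** The spanning functions are monomials cut off to the points that [tet_of] assigns to one
    tetrahedron. They need not be splines; they span a finite-dimensional space that contains the
    splines, as [has_dim_exists] demands. *)
Lemma splines_span r d : exists N (b : 'I_N -> realization K -> R),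
  forall F, splines K r d F -> exists c, F = comb b c.
Proof.
pose I := ({set V} * bmultinom 3 d.+1)%type.
exists #|{: I}|, (fun k x => (tet_of x == (enum_val k).1)%:R *
  pev (mpolyX R (bmnm (enum_val k).2)) (val x)) => F [_ FP].
have hP s : exists q, s \in tets -> (mmeasure mdeg q <= d.+1)%N /\
    forall x : realization K, simplex K s (val x) -> F x = meval (val x 0) q.
  have [sT|_] := boolP (s \in tets); last by exists 0.
  by have [q h1 h2] := FP s sT; exists q.
pose q s := projT1 (cid (hP s)).
exists (fun k => mcoeff (bmnm (enum_val k).2) (q (enum_val k).1)); apply/funext => x.
have xt : tet_of x \in tets by rewrite /tet_of; case: cid2.
have xs : simplex K (tet_of x) (val x) by rewrite /tet_of; case: cid2.
have [q1 q2] := projT2 (cid (hP (tet_of x))) xt.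
rewrite (q2 x xs) -/(q (tet_of x)) /comb; rewrite -/(q (tet_of x)) in q1.
rewrite (sum_enum_val (fun k : I => mcoeff (bmnm k.2) (q k.1) *
  ((tet_of x == k.1)%:R * pev (mpolyX R (bmnm k.2)) (val x)))).
rewrite sum_pair /= (bigD1 (tet_of x)) //= [X in _ + X]big1 ?addr0; last first.
  by move=> s sx; apply: big1 => m _; rewrite eq_sym (negbTE sx) mul0r mulr0.
rewrite {1}(mpolywE q1) rmorph_sum /=; apply: eq_bigr => m _.
by rewrite eqxx mul1r mevalZ.
Qed.

Lemma spline_dim r d : exists2 n, has_dim (splines K r d) n &
  forall k, has_independent (splines K r d) k -> (k <= n)%N.
Proof.
have [N [b hb]] := splines_span r d.
exact: has_dim_exists (splines_subspace r d) hb.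
Qed.

Lemma homogeneous_dim r d : exists2 n, has_dim (homogeneous_splines K r d) n &
  forall k, has_independent (homogeneous_splines K r d) k -> (k <= n)%N.
Proof.
have [N [b hb]] := splines_span r d.
apply: (has_dim_exists (homogeneous_subspace r d) (b := b)) => F /homogeneous_sub.
exact: hb.
Qed.

Lemma simplex_realization s x : s \in tets -> simplex K s x -> realization K x.
Proof. by move=> /tet_face sK xs; exists s. Qed.

Lemma spline_family r d n (f : 'I_n -> {set V} -> mp) :
  (forall k s, f k s \is hom R d) -> (forall k, compatible K r (f k)) ->
  (forall c : 'I_n -> R, (forall s, s \in tets -> \sum_k c k *: f k s = 0) ->
        forall k, c k = 0) ->
  has_independent (homogeneous_splines K r d) n.
Proof.
move=> fh fc fi; have ag k := compatible_agree hK (fc k).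
exists (fun k x => pw hK (f k) (val x)) => [c hc|k].
  apply: fi => s sT; apply: (simplex_poly_eq0 hK sT) => x xs.
  have xr : realization K x by apply: simplex_realization xs.
  have := hc (exist _ x (mem_set xr)); rewrite /comb /= => h; rewrite -[RHS]h.
  rewrite /pev rmorph_sum /=; apply: eq_bigr => k _; rewrite mevalZ.
  by rewrite (pwE hK (ag k) sT (simplex_cone xs)).
split.
  exists setT, (pw hK (f k)); split=> //; first exact: openT.
  exact: pw_Cr.
move=> s sT; exists (f k s) => [|x xs]; first exact: fh.
by rewrite (pwE hK (ag k) sT (simplex_cone xs)).
Qed.

Lemma polynomial_family r d : has_independent (homogeneous_splines K r d) 'C(d + 2, 2).
Proof.
rewrite -card_Mon; apply: (spline_family (f := fun k _ => monX R (enum_val k))).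
- by move=> k s; apply: hom_monX.
- move=> k s t _ _ _; exists 0, 0; rewrite mulr0 subrr; split=> // v _.
  by apply: big1 => i _; rewrite mxE mul0r.
move=> c hc k; have [s sT _] := fan_complete hK 0.
have := congr1 (mcoeff (val (enum_val k))) (hc s sT).
have -> : \sum_k0 c k0 *: monX R (enum_val k0) =
    \sum_(m : Mon d) c (enum_rank m) *: monX R m.
  rewrite -[RHS](sum_enum_val (fun m : Mon d => c (enum_rank m) *: monX R m)).
  by apply: eq_bigr => j _; rewrite enum_valK.
by rewrite mcoeff0 mcoeff_sum_monX enum_valK.
Qed.

(** A tetrahedron has interior points, so the two polynomials representing [F] on it coincide;
    degree at most [d] and homogeneity of degree [d + 1] leave only 0. *)
Lemma homogeneous_inter r d F x : splines K r d F -> homogeneous_splines K r d.+1 F -> F x = 0.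
Proof.
move=> [_ h1] [_ h2]; have [s sT xs] := realization_simplex hK (set_mem (valP x)).
have [q dq Fq] := h1 s sT; have [q' hq' Fq'] := h2 s sT.
have e : q = q'.
  apply/eqP; rewrite -subr_eq0; apply/eqP; apply: (simplex_poly_eq0 hK sT) => y ys.
  have yr : realization K y by apply: simplex_realization ys.
  have Y1 := Fq (exist _ y (mem_set yr)) ys; have Y2 := Fq' (exist _ y (mem_set yr)) ys.
  by rewrite /pev mevalB; move: Y1 Y2 => /= <- <-; rewrite subrr.
suff q0 : q = 0 by rewrite (Fq x xs) q0 meval0.
apply/mpolyP => m; rewrite mcoeff0; apply/eqP; rewrite -[_ == 0]negbK -mcoeff_msupp.
apply/negP => mq; have := msize_mdeg_lt mq; rewrite e in mq.
by rewrite (dhomog_mf hq' mq) => h; have := leq_trans h dq; rewrite ltnn.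
Qed.

Lemma homogeneous_lower r d n :
  (forall k, has_independent (homogeneous_splines K r d) k -> (k <= n)%N) ->
  (('C(d + 2, 2))%:Z <= n%:Z)%R /\
  ((Dgamma K r < d)%N -> (Num.max ('C(d + 2, 2))%:Z (LBcs K d r) <= n%:Z)%R).
Proof.
move=> nmax.
have h1 : (('C(d + 2, 2))%:Z <= n%:Z)%R by rewrite lez_nat; apply/nmax/polynomial_family.
split=> // hd; rewrite ge_max h1 /=.
have [k [kL [f [fh fc fi]]]] := fan_splines hK hd.
by apply: le_trans kL _; rewrite lez_nat; apply/nmax/(spline_family fh fc fi).
Qed.

Definition lower_bound r i : int :=
  if (Dgamma K r < i)%N then Num.max ('C(i + 2, 2))%:Z (LBcs K i r) else ('C(i + 2, 2))%:Z.

(** The homogeneous splines of degrees 0 to [d] form a direct sum inside the splines of degree [d],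
    so their lower bounds add up. *)
Lemma spline_lower r d : exists2 n, has_independent (splines K r d) n &
  (\sum_(0 <= i < d.+1) lower_bound r i <= n%:Z)%R.
Proof.
have hom_ind i : exists2 n, has_independent (homogeneous_splines K r i) n &
    (lower_bound r i <= n%:Z)%R.
  have [n hn nmax] := homogeneous_dim r i.
  exists n; first exact: has_independent_of_dim.
  have [h1 h2] := homogeneous_lower nmax.
  by rewrite /lower_bound; case: ifP => // /h2.
elim: d => [|d [n in_ hn]].
  have [n [u iu Lu] hn] := hom_ind 0%N.
  by exists n; rewrite ?big_nat1 //; exists u => // k; apply: homogeneous_sub.
have [k ik hk] := hom_ind d.+1.
exists (n + k)%N; last by rewrite big_nat_recr //= PoszD lerD.
apply: (has_independent_cat (splines_subspace r d) (homogeneous_subspace r d.+1)) => //.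
- exact: splines_sub.
- exact: homogeneous_sub.
- by move=> F h1 h2 x; apply: homogeneous_inter h1 h2.
Qed.

End SplineSpaces.

Theorem theorem1p2 (R : realType) (V : finType) (K : complex R V) (g : V)
    (r d : nat) (hK : closed_vertex_star K g) (hd : (Dgamma K r < d)%N) :
  (exists2 n : nat, has_dim (homogeneous_splines K r d) n
     & Num.max ('C(d + 2, 2))%:Z (LBcs K d r) <= n%:Z)
  /\
  (exists2 n : nat, has_dim (splines K r d) n
     & ('C(Dgamma K r + 3, 3))%:Z
       + \sum_((Dgamma K r).+1 <= i < d.+1)
           Num.max ('C(i + 2, 2))%:Z (LBcs K i r) <= n%:Z).
Proof.
split.
  have [n hn nmax] := homogeneous_dim hK r d; exists n => //.
  by have [_] := homogeneous_lower hK nmax; apply.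
have [n hn nmax] := spline_dim hK r d; exists n => //.
have [k /nmax kn] := spline_lower hK r d.
rewrite (big_cat_nat (n := (Dgamma K r).+1)) //=; last by rewrite ltnS ltnW.
move=> h; apply: le_trans (_ : k%:Z <= _); last by rewrite lez_nat.
apply: le_trans h; rewrite lerD //.
  rewrite -sum_bin2 (big_morph Posz PoszD (erefl (Posz 0))) !big_nat.
  by apply: ler_sum => i /andP[_ iD]; rewrite /lower_bound ltnNge -ltnS iD.
rewrite !big_nat; apply: ler_sum => i /andP[Di _].
by rewrite /lower_bound Di.
Qed.
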